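(* Let $\beta\in(1/2,1)$ and let $q\ge1$ be an integer. Let $X_n=\sum_{i\ge 1}\alpha_i(W_{n-i}-W_{n-i-1})$ and $S_N=\sum_{n=1}^N [H_q(X_n)-\mathbf{E}(H_q(X_n))]$, where $\alpha_i=\kappa i^{-\beta}$ with $\kappa=(\sum_{j\ge1}j^{-2\beta})^{-1/2}$. For $\varepsilon>0$ set $$f_1(\varepsilon)=\sum_{N\ge1}\frac1N\mathbf P(|S_N|>\varepsilon N),\qquad f_2(\varepsilon)=\sum_{N\ge1}\frac1N\mathbf P\left(|S_N|>\varepsilon N^{-2\beta q+q+2}\right).$$ If $q>\frac1{2\beta-1}$, then $\displaystyle\lim_{\varepsilon\to0}\frac{1}{-\log\varepsilon}f_1(\varepsilon)=2$. If $q<\frac{1}{2\beta-1}$, then $\displaystyle\lim_{\varepsilon\to0}\frac{1}{-\log\varepsilon}f_2(\varepsilon)=\frac{1}{1+\frac q2-\beta q}$.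
   Context: $(W_t)_{t\in\mathbb R}$ is a two-sided standard Brownian motion on $\mathbb R$. $H_q$ is the Hermite polynomial normalized as $H_q(x)=\frac{(-1)^q}{q!}e^{x^2/2}\frac{d^q}{dx^q}e^{-x^2/2}$. The normalization of $\alpha_i$ gives $\sum_{i\ge1}\alpha_i^2=1$. *)

(* Defs.v *)
From HB Require Import structures.
From mathcomp Require Export all_boot all_order all_algebra.
From mathcomp Require Export all_classical all_reals all_analysis.
Export Order.TTheory GRing.Theory Num.Theory.
Export numFieldNormedType.Exports.

#[export] Set Implicit Arguments.
#[export] Unset Strict Implicit.
#[export] Unset Printing Implicit Defensive.

Local Open Scope classical_set_scope.
Local Open Scope ring_scope.

(* Since B i may be setT, this covers every subfamily. *)
Definition independent_family d (T : measurableType d) (R : realType)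
    (P : probability T R) (k : nat) (Y : 'I_k -> T -> R) : Prop :=
  forall B : 'I_k -> set R, (forall i, measurable (B i)) ->
    P [set w | forall i, B i (Y i w)] =
    (\prod_(i < k) P [set w | B i (Y i w)])%E.

(* The second parameter of normal_prob is the standard deviation. *)
Record two_sided_brownian_motion d (T : measurableType d) (R : realType)
    (P : probability T R) (W : R -> {RV P >-> R}) : Prop := {
  tsbm_start : {ae P, forall w, W 0 w = 0} ;
  tsbm_gaussian : forall s t : R, s < t ->
    forall B : set R, measurable B ->
      P [set w | B (W t w - W s w)] = normal_prob 0 (Num.sqrt (t - s)) B ;
  tsbm_independent : forall (k : nat) (t : nat -> R),
    (forall i, (i < k)%N -> t i < t i.+1) ->
    independent_family P (fun (i : 'I_k) w => W (t i.+1) w - W (t i) w) ;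
  tsbm_continuous : {ae P, forall w, continuous (fun t : R => W t w)} }.

Definition hermite (R : realType) (q : nat) (x : R) : R :=
  (-1) ^+ q / q`!%:R * expR (x ^+ 2 / 2) *
  derive1n q (fun y : R => expR (- (y ^+ 2 / 2))) x.

Definition kappa (R : realType) (beta : R) : R :=
  limn (fun n => \sum_(1 <= j < n.+1) (j%:R : R) `^ (- (2 * beta))) `^ (- (1 / 2)).

Definition alpha (R : realType) (beta : R) (i : nat) : R :=
  kappa beta * i%:R `^ (- beta).

(* The infinite series defining the moving average converges in L^2(P), so
   X n is determined up to almost sure equality. *)
Definition is_moving_average d (T : measurableType d) (R : realType)
    (P : probability T R) (W : R -> {RV P >-> R}) (a : nat -> R)
    (X : nat -> {RV P >-> R}) : Prop :=
  forall n : nat,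
    'E_P[(fun w => (X n w - \sum_(1 <= i < M.+1)
       a i * (W (n%:R - i%:R) w - W (n%:R - i%:R - 1) w)) ^+ 2)%R]%E
    @[M --> \oo] --> 0%E.

Definition hermite_sum d (T : measurableType d) (R : realType)
    (P : probability T R) (q : nat) (X : nat -> {RV P >-> R})
    (N : nat) (w : T) : R :=
  \sum_(1 <= n < N.+1)
    (hermite q (X n w) - fine 'E_P[(fun v => hermite q (X n v))%R]%E).

Definition f1 d (T : measurableType d) (R : realType) (P : probability T R)
    (q : nat) (X : nat -> {RV P >-> R}) (eps : R) : \bar R :=
  (\sum_(1 <= N <oo) (N%:R^-1)%:E *
     P [set w | (eps * N%:R < `|hermite_sum q X N w|)%R])%E.

Definition f2 d (T : measurableType d) (R : realType) (P : probability T R)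
    (beta : R) (q : nat) (X : nat -> {RV P >-> R}) (eps : R) : \bar R :=
  (\sum_(1 <= N <oo) (N%:R^-1)%:E *
     P [set w | (eps * N%:R `^ (- (2 * beta * q%:R) + q%:R + 2)
                   < `|hermite_sum q X N w|)%R])%E.

(* Main.v *)
Require Import Defs.
From mathcomp Require Import measurable_realfun.
From mathcomp Require Import ring lra zify.

(* Let [N ^ gam] be the order of [S_N], that is [gam = 1/2] if
   [q (2 beta - 1) > 1] and [gam = 1 - q (beta - 1/2)] if [q (2 beta - 1) < 1].
   In both cases the threshold is [eps N ^ (2 gam)], so that the probabilities are
   close to 1 for [N] much smaller than [eps ^ (-1/gam)] and summably small beyond;
   the weights [1/N] turn this into the limit [1/gam].  No limit theorem is needed
   for this, only [E S_N^2 <= C N ^ (2 gam)] and the fact that [S_N / N ^ gam] does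
   not concentrate at 0; both pass to [S_N] from its version with [X_n] truncated
   to [M] noise variables, [M] going to infinity for fixed [N].

   The second moments come from [E H_q(X) H_q(Y) = E[XY]^q / q!].  The
   anticoncentration comes from Gaussian integration by parts: an identity
   [E[f'(F) V] = E[f(F) U]] with [V >= 0], applied to [f t = e atan (t / e)], bounds
   [P(|F| <= e)] by [P(V < eta) + O(e / eta)].
   - Short memory: for a fixed truncation lag [m], [V] is the squared norm of the
     gradient of [S_N / sqrt N]; its mean is bounded below and its variance is
     [O(1/N)] by finite range dependence.  The [L^2] error made by replacing [M] by
     [m] is small uniformly in [N] and [M].
   - Long memory: let [G_j] be the [j]-th derivative of [S_N / N ^ gam] in the
     direction of the indicator of a window of [N] noise variables preceding time 0.
     The last derivative [G_q] is deterministic and bounded below, and [V = G_(j+1)^2]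
     carries the anticoncentration from [G_(j+1)] to [G_j]. *)

Local Open Scope classical_set_scope.
Local Open Scope ring_scope.

(** * Gaussian integration by parts on the line *)

(** A truncated moving average does not have variance 1, so [H_q] evaluated at it would leave the
    q-th chaos. The two-parameter polynomial [herm s x p], taken at the exact variance [s], keeps
    all covariances exact for every truncation level; the price is only an error in probability for
    fixed [N]. With finitely many noise variables the Malliavin calculus is finite-dimensional: it
    reduces to the formula on the line and Fubini.

    The two choices of [V] cannot be exchanged. In the direction of the window, the q-th derivative
    has order [N^(1 - q (beta - 1/2) - gam)]. This is constant for the long-memory exponent, but
    tends to 0 for [gam = 1/2] when [q (2 beta - 1) > 1]. The variance of the squared gradient, on
    the other hand, is controlled through finite range dependence, and the passage to a finite range
    at scale [N^(1/2)] rests on the summability of the q-th powers of the covariances.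

    In the short-memory case the level [e] of the anticoncentration has to be fixed before the
    truncation lag [m], because [m] is then chosen so that the approximation error is small compared
    with [e]. *)

Lemma near_infty_ger_succ {R : realType} (r : R) : \forall n \near \oo, r <= n.+1%:R.
Proof.
near=> n; apply: (@le_trans _ _ n%:R); last by rewrite ler_nat.
by near: n; exact: nbhs_infty_ger.
Unshelve. all: end_near. Qed.

Section normal_integral.
Context {R : realType}.
Local Notation mu := (@lebesgue_measure R).
Local Notation N01 := (@normal_prob R 0 1).
Local Notation pdf := (@normal_pdf R 0 1).

(** Change of variables through the Radon-Nikodym derivative, which agrees with [pdf] almost
    everywhere because both have the same integral over every measurable set. *)
Lemma ge0_integral_normal_prob (f : R -> \bar R) :
  measurable_fun [set: R] f -> (forall x, 0 <= f x)%E ->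
  (\int[N01]_x f x = \int[mu]_x (f x * (pdf x)%:E))%E.
Proof.
move=> mf f0; have dom := @normal_prob_dominates R 0 1.
rewrite -(Radon_Nikodym_SigmaFinite.change_of_variables dom)//.
apply: ae_eq_integral => //.
- apply: emeasurable_funM => //; apply: (measurable_int mu).
  exact: Radon_Nikodym_SigmaFinite.f_integrable.
- apply: emeasurable_funM => //; apply/measurableT_comp => //.
  exact: measurable_normal_pdf.
- apply: ae_eqe_mul2l => /=; apply: integral_ae_eq => //=.
  + exact: Radon_Nikodym_SigmaFinite.f_integrable.
  + by apply/measurableT_comp => //; exact: measurable_normal_pdf.
  + move=> E _ mE; rewrite -Radon_Nikodym_SigmaFinite.f_integral//.
Qed.

Lemma integrable_normal_prob (f : R -> R) :
  mu.-integrable [set: R] (EFin \o (fun x => f x * pdf x)) ->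
  measurable_fun [set: R] f ->
  N01.-integrable [set: R] (EFin \o f).
Proof.
move=> /integrableP[_ fi] mf; apply/integrableP; split.
  exact/measurable_EFinP.
rewrite ge0_integral_normal_prob//.
  under eq_integral => x _.
    rewrite /= -EFinM -{1}(ger0_norm (normal_pdf_ge0 0 1 x)) -normrM.
    over.
  by [].
by apply/measurableT_comp => //; exact/measurable_EFinP.
Qed.

Lemma integral_normal_probE (f : R -> R) :
  mu.-integrable [set: R] (EFin \o (fun x => f x * pdf x)) ->
  measurable_fun [set: R] f ->
  (\int[N01]_x (f x)%:E = \int[mu]_x (f x * pdf x)%:E)%E.
Proof.
move=> fi mf.
rewrite integralE [RHS]integralE !ge0_integral_normal_prob//; first last.
- by apply/measurable_funepos/measurable_EFinP.
- by apply/measurable_funeneg/measurable_EFinP.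
congr (_ - _)%E; apply: eq_integral => x _.
- by rewrite !funeposE maxe_pMl ?lee_fin ?normal_pdf_ge0// mul0e.
- rewrite (funenegE (fun y : R => (f y)%:E) x) (funenegE (fun y : R => (f y * pdf y)%:E) x).
  by rewrite maxe_pMl ?lee_fin ?normal_pdf_ge0// mul0e -EFinM mulNr.
Qed.

Lemma normal_pdf01E x : pdf x = normal_peak 1 * expR (- (x ^+ 2 / 2)).
Proof.
rewrite normal_pdfE ?oner_neq0// /normal_fun subr0 expr1n.
by congr (_ * expR _); rewrite mulNr.
Qed.

(** The Gaussian of standard deviation 2 absorbs any polynomial: for [y = 1 + x^2], one term of the
    exponential series bounds [y^p] by a multiple of [exp (y / 4)], and [exp (x^2 / 4 - x^2 / 2) <=
    exp (- x^2 / 8)]. *)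
Lemma normal_pdf_growth p : exists2 C : R, 0 <= C &
  forall x, (1 + x ^+ 2) ^+ p * pdf x <= C * normal_pdf 0 2 x.
Proof.
have n2 : (2 : R) != 0 by rewrite pnatr_eq0.
pose k : R := p.+1`!%:R * 4 ^+ p.+1 * expR (4^-1).
have k0 : 0 <= k by rewrite !mulr_ge0 ?expR_ge0 ?exprn_ge0.
have pk : 0 < @normal_peak R 2 by exact: normal_peak_gt0.
exists (normal_peak 1 * k / normal_peak 2).
  by rewrite !mulr_ge0 ?normal_peak_ge0 ?invr_ge0.
move=> x; rewrite normal_pdf01E (normal_pdfE _ n2) [leRHS]mulrA divfK ?gt_eqF//.
rewrite mulrCA -[leRHS]mulrA ler_wpM2l ?normal_peak_ge0// /normal_fun subr0.
set y := 1 + x ^+ 2.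
have y1 : 1 <= y by rewrite lerDl sqr_ge0.
have y0 : 0 <= y by rewrite (le_trans ler01).
have h : y ^+ p <= p.+1`!%:R * 4 ^+ p.+1 * expR (y / 4).
  have := @expR_ge1Dxn R (y / 4) p (divr_ge0 y0 (ler0n _ _)).
  move=> /(le_trans _)-/(_ ((y / 4) ^+ p.+1 / p.+1`!%:R)) /(_ ltac:(by rewrite lerDr)).
  rewrite ler_pdivrMr ?ltr0n ?fact_gt0// expr_div_n.
  rewrite ler_pdivrMr ?exprn_gt0// => h.
  apply: (@le_trans _ _ (y ^+ p.+1)); first by rewrite exprS ler_peMl ?exprn_ge0.
  by rewrite (le_trans h)// le_eqVlt; apply/orP; left; apply/eqP; ring.
apply: (@le_trans _ _ (p.+1`!%:R * 4 ^+ p.+1 * expR (y / 4) * expR (- (x ^+ 2 / 2)))).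
  by rewrite ler_wpM2r ?expR_ge0.
rewrite /k -!mulrA !ler_wpM2l// ?exprn_ge0//.
rewrite -!expRD ler_expR /y.
have -> : (2 : R) ^+ 2 *+ 2 = 8 by rewrite -mulr_natr; ring.
have := sqr_ge0 x; lra.
Qed.

Lemma integrable_growth_pdf (f : R -> R) C p :
  measurable_fun [set: R] f -> (forall x, `|f x| <= C * (1 + x ^+ 2) ^+ p) ->
  mu.-integrable [set: R] (EFin \o (fun x => f x * pdf x)).
Proof.
move=> mf fC; have [D D0 hD] := normal_pdf_growth p.
have C0 : 0 <= C.
  have := fC 0; rewrite expr0n addr0 expr1n mulr1; exact: le_trans.
apply: (@le_integrable _ _ _ mu _ measurableT _ (EFin \o (fun x => C * D * normal_pdf 0 2 x))).
- apply/measurable_EFinP; apply: measurable_funM => //.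
  exact: measurable_normal_pdf.
- move=> x _; rewrite /= lee_fin normrM (ger0_norm (normal_pdf_ge0 0 1 x)).
  rewrite [leRHS]ger0_norm ?mulr_ge0 ?normal_pdf_ge0//.
  apply: (@le_trans _ _ (C * (1 + x ^+ 2) ^+ p * pdf x)).
    by rewrite ler_wpM2r ?normal_pdf_ge0.
  by rewrite -!mulrA ler_wpM2l.
- apply: (@eq_integrable _ _ _ mu _ measurableT (fun x => (C * D)%:E * (normal_pdf 0 2 x)%:E)%E) => //.
  by apply: integrableZl => //; exact: integrable_normal_pdf.
Qed.

Lemma integrable_growth_normal (f : R -> R) C p :
  measurable_fun [set: R] f -> (forall x, `|f x| <= C * (1 + x ^+ 2) ^+ p) ->
  N01.-integrable [set: R] (EFin \o f).
Proof. by move=> mf fC; apply: integrable_normal_prob => //; exact: integrable_growth_pdf fC. Qed.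

Lemma is_derive_pdf (x : R) : is_derive x 1 pdf (- x * pdf x).
Proof.
have -> : pdf = (fun x => normal_peak 1 * expR (- (x ^+ 2 / 2))).
  by apply/funext => z; exact: normal_pdf01E.
apply: is_derive_eq.
by rewrite /GRing.scale /=; field.
Qed.

Lemma continuous_pdf : continuous pdf.
Proof. by apply: continuous_normal_pdf; rewrite oner_neq0. Qed.

(** The derivative of [phi * pdf] is [(psi - x phi) * pdf], and [phi * pdf] vanishes at infinity, so
    this derivative integrates to 0. *)
Lemma normal_ibp (phi psi : R -> R) C p :
  (forall x : R, is_derive x 1 phi (psi x)) -> continuous psi ->
  (forall x, `|phi x| <= C * (1 + x ^+ 2) ^+ p) ->
  (forall x, `|psi x| <= C * (1 + x ^+ 2) ^+ p) ->
  (\int[N01]_x (x * phi x)%:E = \int[N01]_x (psi x)%:E)%E.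
Proof.
move=> dphi cpsi phiC psiC.
have C0 : 0 <= C.
  have := phiC 0; rewrite expr0n addr0 expr1n mulr1; exact: le_trans.
have dG (x : R) : is_derive x 1 (fun x => phi x * pdf x) ((psi x - x * phi x) * pdf x).
  have dp := is_derive_pdf x; have dph := dphi x.
  apply: is_derive_eq; rewrite /GRing.scale/=; ring.
have cphi : continuous phi.
  move=> x; apply: differentiable_continuous; apply/derivable1_diffP.
  by have [] := dphi x.
pose g x := (psi x - x * phi x) * pdf x.
have cg : continuous g.
  move=> x; apply: cvgM; last exact: continuous_pdf.
  by apply: cvgB; [exact: cpsi|apply: cvgM; [exact: cvg_id|exact: cphi]].
have mphi : measurable_fun [set: R] phi by exact: continuous_measurable_fun.
have mpsi : measurable_fun [set: R] psi by exact: continuous_measurable_fun.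
have mxphi : measurable_fun [set: R] (fun x => x * phi x) by exact: measurable_funM.
have y1 (x : R) : 1 <= 1 + x ^+ 2 by rewrite lerDl sqr_ge0.
have xphiC (x : R) : `|x * phi x| <= C * (1 + x ^+ 2) ^+ p.+1.
  rewrite normrM exprS mulrCA ler_pM//.
  have := sqr_ge0 (`|x| - 1); have := normr_ge0 x; rewrite -[x ^+ 2]real_normK ?num_real//.
  by rewrite sqrrB expr1n mulr1; lra.
have ipsi : mu.-integrable [set: R] (EFin \o (fun x => psi x * pdf x)) by exact: integrable_growth_pdf psiC.
have ixphi : mu.-integrable [set: R] (EFin \o (fun x => x * phi x * pdf x)) by exact: integrable_growth_pdf xphiC.
have gE : EFin \o g = (fun x => (psi x * pdf x)%:E - (x * phi x * pdf x)%:E)%E.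
  by apply/funext => x; rewrite /= /g mulrBl EFinB.
have ig : mu.-integrable [set: R] (EFin \o g).
  rewrite gE; exact: integrableB.
rewrite !integral_normal_probE//.
suff g0 : (\int[mu]_x (g x)%:E = 0)%E.
  rewrite -[LHS]add0e -g0 -integralD//.
  by apply: eq_integral => x _; rewrite /g mulrBl -EFinD subrK.
pose I (n : nat) := [set` `[- n.+1%:R, n.+1%:R] : interval R].
pose G x := phi x * pdf x.
have IG n : (\int[mu]_(x in I n) (g x)%:E = (G n.+1%:R - G (- n.+1%:R))%:E)%E.
  rewrite /I (@continuous_FTC2 _ g G).
  - by rewrite EFinB.
  - by rewrite (lt_trans (y:=0))// oppr_lt0.
  - exact: continuous_subspaceT.
  - have cG : continuous G by move=> x; apply: cvgM; [exact: cphi|exact: continuous_pdf].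
    split.
    + by move=> x _; have [] := dG x.
    + exact/cvg_at_right_filter/cG.
    + exact/cvg_at_left_filter/cG.
  - by move=> x _; rewrite derive1E; have [_] := dG x.
have [D D0 hD] := normal_pdf_growth p.+1.
pose B := C * (D * normal_peak 2).
(* The growth bound is taken at exponent [p.+1]: the spare factor [1 + x^2] provides the decay of
   the boundary terms. *)
have Gle x : `|G x| <= B / (1 + x ^+ 2).
  have yx : 0 < 1 + x ^+ 2 by rewrite (lt_le_trans ltr01).
  rewrite ler_pdivlMr// /G normrM (ger0_norm (normal_pdf_ge0 0 1 x)).
  apply: (@le_trans _ _ (C * ((1 + x ^+ 2) ^+ p.+1 * pdf x))).
    rewrite [leRHS](_ : _ = C * (1 + x ^+ 2) ^+ p * (pdf x * (1 + x ^+ 2))); last by rewrite exprS; ring.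
    rewrite -[leLHS]mulrA; apply: ler_wpM2r => //.
    by apply: mulr_ge0; [exact: normal_pdf_ge0|exact: ltW].
  rewrite ler_wpM2l// (le_trans (hD x))// ler_wpM2l// normal_pdf_ub// pnatr_eq0//.
have B0 : 0 <= B by rewrite !mulr_ge0 ?normal_peak_ge0.
have Gn : (fun n => (G n.+1%:R - G (- n.+1%:R))%:E)%E @ \oo --> (0%:E : \bar R).
  apply: cvg_EFin; first by near=> n.
  apply/(@cvgr0Pnorm_le _ R^o) => e e0; near=> n.
  rewrite (le_trans (ler_normB _ _))//.
  have h (z : R) : z ^+ 2 = n.+1%:R ^+ 2 -> `|G z| <= e / 2.
    move=> z2; rewrite (le_trans (Gle z))// z2 ler_pdivrMr; last by rewrite ltr_pwDl ?sqr_ge0.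
    rewrite mulrAC ler_pdivlMr//.
    have : B * 2 / e <= n.+1%:R.
      by near: n; apply: near_infty_ger_succ.
    rewrite ler_pdivrMr// => h; rewrite (le_trans h)// mulrC ler_pM2l//.
    have : (1 : R) <= n.+1%:R by rewrite ler1n.
    by move=> h1; rewrite expr2; nra.
  rewrite (le_trans (lerD (h _ _) (h _ _)))//; last by rewrite -splitr.
  by rewrite sqrrN.
have [] := @dominated_convergence _ _ _ mu setT measurableT
  (fun n => (EFin \o g) \_ (I n)) (EFin \o g) (EFin \o (fun x => `|g x|)).
- move=> n; apply/measurable_restrict => //; first exact: measurable_itv.
  rewrite setTI; apply: (measurable_funS measurableT) => //.
  by apply/measurable_EFinP; exact: continuous_measurable_fun.
- by apply/measurable_EFinP; exact: continuous_measurable_fun.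
- apply: aeW => x _; apply: cvg_near_cst; near=> n.
  rewrite patchE ifT// inE /I /= in_itv /= -ler_norml.
  by near: n; exact: near_infty_ger_succ.
- exact: (integrable_abse ig).
- by apply: aeW => x n _; rewrite patchE; case: ifPn => // _; rewrite abse0 lee_fin.
move=> _ _; rewrite (_ : [sequence _]_n = (fun n => (G n.+1%:R - G (- n.+1%:R))%:E)); last first.
  by apply/funext => n /=; rewrite -integral_mkcond IG.
by move=> /(cvg_unique _ Gn) <-.
Unshelve. all: end_near. Qed.
End normal_integral.

(** * Smooth functionals of polynomial growth and Hermite polynomials *)

Section functionals.
Context {R : realType}.
Implicit Types (x a h : nat -> R) (g : (nat -> R) -> R).

Definition upd x k (t : R) : nat -> R := fun i => if i == k then t else x i.

Definition delta k : nat -> R := fun i => (i == k)%:R.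

Definition dot K a x : R := \sum_(i < K) a i * x i.

(** The summand 1 makes the powers increase with the exponent, so that growth bounds with different
    exponents can be added. *)
Definition sqsum K x : R := 1 + \sum_(i < K) x i ^+ 2.

(** Measurability is required along every measurable family, on any space: no sigma-algebra on
    sequences is fixed, and the integration by parts evaluates the functional on a product space.
    Separate continuity is enough, since variables are integrated one at a time. *)
Record tame K g : Prop := Tame {
  tame_growth : exists C p, forall x, `|g x| <= C * sqsum K x ^+ p ;
  tame_measurable : forall d (T : measurableType d) (Z : nat -> T -> R),
    (forall i, measurable_fun [set: T] (Z i)) ->
    measurable_fun [set: T] (fun w => g (Z ^~ w)) ;
  tame_continuous : forall k x, continuous (fun t => g (upd x k t)) }.

(* [dg h x] is the derivative of [g] at [x] in the direction [h]. *)
Record smooth K g (dg : (nat -> R) -> (nat -> R) -> R) : Prop := Smooth {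
  smooth_tame : tame K g ;
  smooth_dtame : forall h, tame K (dg h) ;
  smooth_derive : forall k x (t : R), (k < K)%N ->
    is_derive t 1 (fun t => g (upd x k t)) (dg (delta k) (upd x k t)) ;
  smooth_lin : forall h x, dg h x = \sum_(k < K) h k * dg (delta k) x }.

Lemma sqsum_ge1 K x : 1 <= sqsum K x.
Proof. by rewrite lerDl sumr_ge0// => i _; exact: sqr_ge0. Qed.

Lemma sqsum_ge0 K x : 0 <= sqsum K x.
Proof. exact: le_trans (sqsum_ge1 K x). Qed.

Lemma growth_ge0 K g C p : (forall x, `|g x| <= C * sqsum K x ^+ p) -> 0 <= C.
Proof.
move=> /(_ (fun=> 0)) /(le_trans (normr_ge0 _)).
by rewrite pmulr_lge0// exprn_gt0// (lt_le_trans ltr01)// sqsum_ge1.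
Qed.

Lemma sqsumX_le K x p q : (p <= q)%N -> sqsum K x ^+ p <= sqsum K x ^+ q.
Proof. by move=> pq; rewrite ler_weXn2l ?sqsum_ge1. Qed.

Lemma tame_cst K c : tame K (fun=> c).
Proof.
split => [|d T Z mZ|k x]; last exact: cst_continuous.
  by exists `|c|, 0%N => x; rewrite expr0 mulr1.
exact: measurable_cst.
Qed.

Lemma tame_var K i : (i < K)%N -> tame K (fun x => x i).
Proof.
move=> iK; split => [|d T Z mZ|k x]; last first.
- rewrite /upd; case: (i == k); [by move=> t; exact: cvg_id|exact: cst_continuous].
- exact: mZ.
- exists 1, 1%N => x; rewrite mul1r expr1.
  apply: (@le_trans _ _ (1 + x i ^+ 2)).
    have := sqr_ge0 (`|x i| - 1); have := normr_ge0 (x i).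
    by rewrite -[x i ^+ 2]real_normK ?num_real// sqrrB expr1n mulr1; lra.
  rewrite lerD2l (bigD1 (Ordinal iK))//= lerDl sumr_ge0// => j _; exact: sqr_ge0.
Qed.

Lemma tameD K g1 g2 : tame K g1 -> tame K g2 -> tame K (fun x => g1 x + g2 x).
Proof.
move=> [[C1 [p1 h1]] m1 c1] [[C2 [p2 h2]] m2 c2]; split => [|d T Z mZ|k x].
- exists (C1 + C2), (maxn p1 p2) => x.
  rewrite (le_trans (ler_normD _ _))// mulrDl lerD//.
  + by rewrite (le_trans (h1 x))// ler_wpM2l ?(growth_ge0 h1)// sqsumX_le// leq_maxl.
  + by rewrite (le_trans (h2 x))// ler_wpM2l ?(growth_ge0 h2)// sqsumX_le// leq_maxr.
- by apply: measurable_funD; [exact: m1|exact: m2].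
- by move=> t; apply: cvgD; [exact: c1|exact: c2].
Qed.

Lemma tameM K g1 g2 : tame K g1 -> tame K g2 -> tame K (fun x => g1 x * g2 x).
Proof.
move=> [[C1 [p1 h1]] m1 c1] [[C2 [p2 h2]] m2 c2]; split => [|d T Z mZ|k x].
- exists (C1 * C2), (p1 + p2)%N => x.
  by rewrite normrM exprD mulrACA ler_pM.
- by apply: measurable_funM; [exact: m1|exact: m2].
- by move=> t; apply: cvgM; [exact: c1|exact: c2].
Qed.

Lemma tameN K g : tame K g -> tame K (fun x => - g x).
Proof.
move=> tg; have := tameM (tame_cst K (-1)) tg.
by congr tame; apply/funext => x; rewrite mulN1r.
Qed.

Lemma tameB K g1 g2 : tame K g1 -> tame K g2 -> tame K (fun x => g1 x - g2 x).
Proof. by move=> t1 t2; apply: tameD => //; exact: tameN. Qed.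

Lemma tameX K g n : tame K g -> tame K (fun x => g x ^+ n).
Proof.
move=> tg; elim: n => [|n IH].
  rewrite (_ : (fun _ => _) = fun=> 1) ?tame_cst//. exact: tame_cst.
rewrite (_ : (fun _ => _) = fun x => g x * g x ^+ n); first exact: tameM.
by apply/funext => x; rewrite exprS.
Qed.

Lemma tame_sum K (I : Type) (r : seq I) (Q : pred I) (g : I -> (nat -> R) -> R) :
  (forall i, Q i -> tame K (g i)) -> tame K (fun x => \sum_(i <- r | Q i) g i x).
Proof.
move=> tg; elim: r => [|i r IH].
  rewrite (_ : (fun _ => _) = fun=> 0); first exact: tame_cst.
  by apply/funext => x; rewrite big_nil.
under eq_fun do rewrite big_cons.
case Qi : (Q i); last exact: IH.
by apply: tameD => //; exact: tg.
Qed.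

Lemma tame_comp K (f : R -> R) C g : continuous f -> (forall t, `|f t| <= C) ->
  tame K g -> tame K (fun x => f (g x)).
Proof.
move=> cf fC [_ mg cg]; split => [|d T Z mZ|k x].
- by exists C, 0%N => x; rewrite expr0 mulr1.
- apply: measurableT_comp; [exact: continuous_measurable_fun|exact: mg].
- by move=> t; apply: continuous_comp; [exact: cg|exact: cf].
Qed.

Lemma tame_dot K a : tame K (dot K a).
Proof.
apply: tame_sum => i _; apply: tameM; first exact: tame_cst.
exact: tame_var.
Qed.

Lemma dotC K a x : dot K a x = dot K x a.
Proof. by apply: eq_bigr => i _; rewrite mulrC. Qed.

Lemma dot_delta K a k : (k < K)%N -> dot K a (delta k) = a k.
Proof.
move=> kK; rewrite /dot (bigD1 (Ordinal kK))//= /delta eqxx mulr1 big1 ?addr0//.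
by move=> i /eqP ik; rewrite (_ : _ == _ = false) ?mulr0//; apply/eqP => ik'; apply/ik/val_inj.
Qed.

Lemma smooth_cst K c : smooth K (fun=> c) (fun _ _ => 0).
Proof.
split=> [|h|k x t _|h x]; [exact: tame_cst|exact: tame_cst|exact: is_derive_cst|].
by rewrite big1// => i _; rewrite mulr0.
Qed.

Lemma smooth_eq K g dg g' dg' : smooth K g dg -> g =1 g' -> dg =2 dg' -> smooth K g' dg'.
Proof.
move=> sg /funext <- e; suff <- : dg = dg' by [].
by apply/funext => h; apply/funext => x; exact: e.
Qed.

Lemma smooth_dot K a : smooth K (dot K a) (fun h _ => dot K h a).
Proof.
split=> [|h|k x t kK|h x]; [exact: tame_dot|exact: tame_cst| |].
- rewrite dotC dot_delta//.
  pose b := dot K a (upd x k 0).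
  have -> : (fun t => dot K a (upd x k t)) = (fun t => a k * t + b).
    apply/funext => u; rewrite /b /dot (bigD1 (Ordinal kK))//= [in RHS](bigD1 (Ordinal kK))//=.
    rewrite /upd eqxx mulr0 add0r; congr +%R; apply: eq_bigr => i /eqP ik.
    by case: eqP => // ik'; case: ik; exact: val_inj.
  by apply: is_derive_eq; rewrite /GRing.scale/=; ring.
- by rewrite /dot; apply: eq_bigr => i _; rewrite -/(dot K _ _) (dotC _ (delta _)) dot_delta.
Qed.

Lemma smoothD K g1 dg1 g2 dg2 : smooth K g1 dg1 -> smooth K g2 dg2 ->
  smooth K (fun x => g1 x + g2 x) (fun h x => dg1 h x + dg2 h x).
Proof.
move=> [t1 u1 d1 l1] [t2 u2 d2 l2]; split=> [|h|k x t kK|h x].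
- exact: tameD.
- exact: tameD.
- by have ? := d1 k x t kK; have ? := d2 k x t kK; exact: is_deriveD.
- rewrite l1 l2 -big_split/=; apply: eq_bigr => i _; by rewrite mulrDr.
Qed.

Lemma smoothM K g1 dg1 g2 dg2 : smooth K g1 dg1 -> smooth K g2 dg2 ->
  smooth K (fun x => g1 x * g2 x) (fun h x => dg1 h x * g2 x + g1 x * dg2 h x).
Proof.
move=> [t1 u1 d1 l1] [t2 u2 d2 l2]; split=> [|h|k x t kK|h x].
- exact: tameM.
- by apply: tameD; apply: tameM.
- have ? := d1 k x t kK; have ? := d2 k x t kK.
  by apply: is_derive_eq; rewrite /GRing.scale/=; ring.
- rewrite l1 l2 mulr_suml mulr_sumr -big_split/=; apply: eq_bigr => i _; ring.
Qed.

Lemma smoothZ K c g dg : smooth K g dg ->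
  smooth K (fun x => c * g x) (fun h x => c * dg h x).
Proof.
move=> /(smoothM (smooth_cst K c)); congr smooth.
by apply/funext => h; apply/funext => x; rewrite mul0r add0r.
Qed.

Lemma smooth_sum K (I : Type) (r : seq I) (g : I -> (nat -> R) -> R) dg :
  (forall i, smooth K (g i) (dg i)) ->
  smooth K (fun x => \sum_(i <- r) g i x) (fun h x => \sum_(i <- r) dg i h x).
Proof.
move=> sg; elim: r => [|i r IH].
  by apply: smooth_eq (smooth_cst K 0) _ _ => [x|h x]; rewrite big_nil.
by apply: smooth_eq (smoothD (sg i) IH) _ _ => [x|h x]; rewrite big_cons.
Qed.

Lemma smooth_comp K (f f' : R -> R) C g dg :
  (forall t : R, is_derive t 1 f (f' t)) -> continuous f' ->
  (forall t, `|f t| <= C) -> (forall t, `|f' t| <= C) -> smooth K g dg ->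
  smooth K (fun x => f (g x)) (fun h x => f' (g x) * dg h x).
Proof.
move=> df cf' fC f'C [tg dtg dg' lg]; split=> [|h|k x t kK|h x].
- apply: tame_comp fC tg => t; apply: differentiable_continuous.
  by apply/derivable1_diffP; have [] := df t.
- by apply: tameM => //; exact: tame_comp f'C tg.
- have ? := df (g (upd x k t)); have ? := dg' k x t kK.
  have := @is_derive1_comp R f (fun t => g (upd x k t)) t _ _ _ _.
  by apply.
- by rewrite lg mulr_sumr; apply: eq_bigr => i _; rewrite mulrCA.
Qed.

(* [s ^ (p / 2) * H_p (x / sqrt s)], a polynomial in [s] as well. *)
Fixpoint herm (s x : R) (p : nat) : R :=
  match p with
  | 0 => 1
  | p1.+1 => match p1 with
             | 0 => x
             | p2.+1 => (x * herm s x p1 - s * herm s x p2) / p%:R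
             end
  end.

(** The derivative of [herm s x p] in [x]. The case [p = 0] is set apart because [herm s x p.-1]
    would give 1 there. *)
Definition hermd (s x : R) (p : nat) : R := if p is p'.+1 then herm s x p' else 0.

Lemma hermSS (s x : R) p : herm s x p.+2 = (x * herm s x p.+1 - s * herm s x p) / p.+2%:R.
Proof. by []. Qed.

Lemma herm_rec (s x : R) p : p.+1%:R * herm s x p.+1 = x * herm s x p - s * hermd s x p.
Proof.
case: p => [|p]; first by rewrite /= mulr0 subr0 mul1r mulr1.
by rewrite hermSS mulrC divfK// pnatr_eq0.
Qed.

(** The derivative of [herm] lowers the degree by one without a factor, thanks to the normalization
    by the factorial. The recursion has two steps, so two consecutive degrees are carried through
    the induction. *)
Lemma smooth_herm K s a p : smooth K (fun x => herm s (dot K a x) p)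
  (fun h x => dot K h a * hermd s (dot K a x) p).
Proof.
suff : smooth K (fun x => herm s (dot K a x) p)
  (fun h x => dot K h a * hermd s (dot K a x) p) /\
  smooth K (fun x => herm s (dot K a x) p.+1)
  (fun h x => dot K h a * herm s (dot K a x) p) by case.
elim: p => [|p [IH1 IH2]].
  split => /=.
    by apply: smooth_eq (smooth_cst K 1) _ _ => [x|h x] //; rewrite mulr0.
  by apply: smooth_eq (smooth_dot K a) _ _ => [x|h x] //; rewrite mulr1.
split => //.
apply: smooth_eq (smoothZ p.+2%:R^-1 (smoothD (smoothM (smooth_dot K a) IH2) (smoothZ (- s) IH1))) _ _ => [x|h x].
- by rewrite hermSS mulNr mulrC.
- have := herm_rec s (dot K a x) p => e.
  have -> : dot K h a * herm s (dot K a x) p.+1 + dot K a x * (dot K h a * herm s (dot K a x) p) +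
    - s * (dot K h a * hermd s (dot K a x) p) =
    dot K h a * (herm s (dot K a x) p.+1 + p.+1%:R * herm s (dot K a x) p.+1).
    by rewrite e; ring.
  have -> : herm s (dot K a x) p.+1 + p.+1%:R * herm s (dot K a x) p.+1 =
    p.+2%:R * herm s (dot K a x) p.+1 by rewrite -[p.+2%:R]natr1; ring.
  by rewrite mulrCA mulKf// pnatr_eq0.
Qed.

Lemma tame_herm K s a p : tame K (fun x => herm s (dot K a x) p).
Proof. exact: smooth_tame (smooth_herm K s a p). Qed.

End functionals.

(** * Independent standard normal variables *)

Section independent_normal.
Context d d' (T : measurableType d) (T' : measurableType d') (R : realType).
Variables (P : probability T R) (X : {RV P >-> T'}) (Y : T -> R).
Local Notation N01 := (@normal_prob R 0 1).
Hypothesis mY : measurable_fun [set: T] Y.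
Hypothesis XY : forall A (B : set R), measurable A -> measurable B ->
  P (X @^-1` A `&` Y @^-1` B) = (P (X @^-1` A) * N01 B)%E.

(** Independence identifies the law of [(X, Y)] with a product measure, and Fubini applies. The
    target [T'] is general because it will be [T] with a smaller sigma-algebra. *)
Lemma integral_independent_normal (f : T' * measurableTypeR R -> R) :
  measurable_fun [set: T' * measurableTypeR R] f ->
  P.-integrable setT (fun w => (f (X w, Y w))%:E) ->
  (\int[P]_w (f (X w, Y w))%:E =
   \int[distribution P X]_x \int[N01]_y (f (x, y))%:E)%E.
Proof.
move=> mf fi.
pose phi w : T' * measurableTypeR R := (X w, Y w).
have mphi : measurable_fun [set: T] phi by exact: measurable_fun_pair.
pose Phi : {RV P >-> (T' * measurableTypeR R)%type} := mfun_Sub (mem_set mphi).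
have E (A : set (T' * measurableTypeR R)) : measurable A ->
    (distribution P X \x N01)%E A = distribution P Phi A.
  move=> mA; have h := @product_measure_unique _ _ T' (measurableTypeR R) R (distribution P X) N01 (distribution P Phi).
  exact: h.
have fi' : (distribution P Phi).-integrable setT (EFin \o f).
  by apply: integrable_pushforward => //; exact/measurable_EFinP.
rewrite (integral12_prod_meas1 (f := EFin \o f)).
  rewrite (eq_measure_integral (distribution P Phi)) => [|A mA _]; last exact: E.
  by rewrite integral_distribution//; exact/measurable_EFinP.
apply/integrableP; split; first exact/measurable_EFinP.
rewrite (eq_measure_integral (distribution P Phi)) => [|A mA _]; last exact: E.
by case/integrableP : fi'.
Qed.

End independent_normal.

(** The coordinates from [K] on are set to 0, hence measurable for any sigma-algebra; the
    conditioning on all coordinates but one relies on this. *)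
Record iid_normal d (T : measurableType d) (R : realType) (P : probability T R)
    (K : nat) (xi : nat -> T -> R) : Prop := IIDNormal {
  iid_measurable : forall i, measurable_fun [set: T] (xi i) ;
  iid_tail : forall i, (K <= i)%N -> xi i = cst 0 ;
  iid_law : forall i (B : set R), (i < K)%N -> measurable B ->
    P (xi i @^-1` B) = normal_prob 0 1 B ;
  iid_independent : forall B : nat -> set R, (forall i, measurable (B i)) ->
    P [set w | forall i, (i < K)%N -> B i (xi i w)] =
    (\prod_(i < K) P (xi i @^-1` B i))%E }.

Section iid_normal_theory.
Context d (T : measurableType d) (R : realType) (P : probability T R).
Variables (K : nat) (xi : nat -> T -> R).
Hypothesis hxi : iid_normal P K xi.
Local Notation N01 := (@normal_prob R 0 1).
Let mxi := iid_measurable hxi.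

Lemma exprD_le (a b : R) n : 0 <= a -> 0 <= b ->
  (a + b) ^+ n <= 2 ^+ n * (a ^+ n + b ^+ n).
Proof.
wlog ab : a b / a <= b => [W a0 b0|a0 b0].
  have [ab|/ltW ba] := leP a b; first exact: W.
  by rewrite addrC [in leRHS]addrC; exact: W.
apply: (@le_trans _ _ ((2 * b) ^+ n)).
  by rewrite lerXn2r ?nnegrE ?addr_ge0 ?mulr_ge0// mulrDl mul1r lerD2r.
by rewrite exprMn ler_wpM2l ?exprn_ge0// lerDr exprn_ge0.
Qed.

Lemma iid_pow_integrable i n : P.-integrable setT (EFin \o (fun w => (xi i w ^+ 2) ^+ n)).
Proof.
have mp : measurable_fun [set: R] (fun x : R => (x ^+ 2) ^+ n).
  by apply: measurable_funX; exact: measurable_funX.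
have mpx : measurable_fun setT (fun w => (xi i w ^+ 2) ^+ n).
  by apply: measurable_funX; exact: measurable_funX.
have [iK|Ki] := ltnP i K; last first.
  rewrite (iid_tail hxi Ki).
  rewrite (_ : _ \o _ = cst (((0 : R) ^+ 2) ^+ n)%:E)//.
  exact: finite_measure_integrable_cst.
apply/integrableP; split; first exact/measurable_EFinP.
have /integrableP[_] : N01.-integrable [set: R] (EFin \o (fun x : R => (x ^+ 2) ^+ n)).
  apply: (@integrable_growth_normal _ _ 1 n) => // x.
  rewrite mul1r ger0_norm; last by rewrite exprn_ge0// sqr_ge0.
  by rewrite lerXn2r ?nnegrE ?addr_ge0 ?sqr_ge0// lerDr.
congr (_ < _)%E.
have mxi' : @measurable_fun _ _ T (measurableTypeR R) setT (xi i) by exact: mxi.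
pose Xi : {RV P >-> measurableTypeR R} :=
  MeasurableFun.Pack (MeasurableFun.Class (isMeasurableFun.Build _ _ T (measurableTypeR R) (xi i) mxi')).
rewrite (eq_measure_integral (distribution P Xi)) => [|A mA _]; last first.
  by apply/esym; exact: (iid_law hxi).
by rewrite ge0_integral_distribution//; apply/measurableT_comp => //; exact/measurable_EFinP.
Qed.

Lemma iid_sqsum_integrable n : P.-integrable setT (EFin \o (fun w => sqsum K (xi ^~ w) ^+ n)).
Proof.
elim: {1}K => [|k IH].
  rewrite (_ : _ \o _ = cst 1%E) ?finite_measure_integrable_cst//.
  by apply/funext => w /=; rewrite /sqsum big_ord0 addr0 expr1n.
have m k' : measurable_fun setT (fun w => sqsum k' (xi ^~ w)).
  apply: measurable_funD => //; apply: measurable_sum => i.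
  exact: measurable_funX.
apply: (@le_integrable _ _ _ _ _ measurableT _ (fun w => (2 ^+ n)%:E *
   ((sqsum k (xi ^~ w) ^+ n)%:E + ((xi k w ^+ 2) ^+ n)%:E))%E).
- by apply/measurable_EFinP; exact: measurable_funX.
- have e0 k' w : 0 <= sqsum k' (xi ^~ w) ^+ n by rewrite exprn_ge0 ?sqsum_ge0.
  have f0 w : 0 <= (xi k w ^+ 2) ^+ n by rewrite exprn_ge0 ?sqr_ge0.
  move=> w _; rewrite /= lee_fin ger0_norm//.
  rewrite [leRHS]ger0_norm; last by rewrite mulr_ge0 ?addr_ge0// exprn_ge0.
  have -> : sqsum k.+1 (xi ^~ w) = sqsum k (xi ^~ w) + xi k w ^+ 2.
    by rewrite /sqsum big_ord_recr/= addrA.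
  by apply: exprD_le; [exact: sqsum_ge0|exact: sqr_ge0].
- apply: integrableZl => //; apply: integrableD => //.
  exact: (iid_pow_integrable k n).
Qed.

Lemma tame_rv g : tame K g -> measurable_fun setT (fun w => g (xi ^~ w)).
Proof. by move=> tg; exact: (tame_measurable tg). Qed.

Lemma tame_integrable g : tame K g ->
  P.-integrable setT (EFin \o (fun w => g (xi ^~ w))).
Proof.
move=> tg; have [C [p gC]] := tame_growth tg.
have mg : measurable_fun setT (fun w => g (xi ^~ w)) by exact: tame_rv.
apply: (@le_integrable _ _ _ _ _ measurableT _ (fun w => C%:E *
   (sqsum K (xi ^~ w) ^+ p)%:E)%E).
- exact/measurable_EFinP.
- move=> w _ /=; rewrite lee_fin (le_trans (gC _))//.
  exact: ler_norm.
- by apply: integrableZl => //; exact: iid_sqsum_integrable.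
Qed.

Lemma normal_ibp_upd k x g dg : (k < K)%N -> smooth K g dg ->
  (\int[N01]_t (t * g (upd x k t))%:E = \int[N01]_t (dg (delta k) (upd x k t))%:E)%E.
Proof.
move=> kK [tg tdg dg' _].
have up (g1 : (nat -> R) -> R) C1 p1 : (forall x, `|g1 x| <= C1 * sqsum K x ^+ p1) ->
    forall t, `|g1 (upd x k t)| <= (C1 * sqsum K x ^+ p1) * (1 + t ^+ 2) ^+ p1.
  move=> gC t; rewrite (le_trans (gC _))// -mulrA ler_wpM2l ?(growth_ge0 gC)//.
  rewrite -exprMn lerXn2r ?nnegrE ?mulr_ge0 ?sqsum_ge0 ?addr_ge0 ?sqr_ge0//.
  (* Since [sqsum K x >= 1], the right-hand side is at most [sqsum K x * (1 + t^2)]: with the other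
     coordinates frozen, growth becomes polynomial in [t], with a constant depending on [x]. *)
  have : sqsum K (upd x k t) <= sqsum K x + t ^+ 2.
    rewrite /sqsum -addrA lerD2l (bigD1 (Ordinal kK))//= [in leRHS](bigD1 (Ordinal kK))//=.
    rewrite (eq_bigr (fun i : 'I_K => x i ^+ 2)).
      by rewrite {1}/upd eqxx; have := sqr_ge0 (x k); lra.
    move=> i /eqP ik; rewrite /upd; case: eqP => // ik'; case: ik; exact: val_inj.
  move/le_trans; apply; rewrite mulrDr mulr1 lerD2l ler_peMl ?sqr_ge0 ?sqsum_ge1//.
have [C1 [p1 g1]] := tame_growth tg.
have [C2 [p2 g2]] := tame_growth (tdg (delta k)).
have lep (C p q : R) n m : (n <= m)%N -> 0 <= C -> C <= p -> forall t : R,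
    C * (1 + t ^+ 2) ^+ n <= p * (1 + t ^+ 2) ^+ m.
  move=> nm C0 Cp t; apply: ler_pM => //.
    by rewrite exprn_ge0// addr_ge0// sqr_ge0.
  by apply: ler_weXn2l => //; rewrite lerDl sqr_ge0.
pose D1 := C1 * sqsum K x ^+ p1; pose D2 := C2 * sqsum K x ^+ p2.
have D10 : 0 <= D1 by rewrite mulr_ge0 ?exprn_ge0 ?sqsum_ge0// (growth_ge0 g1).
have D20 : 0 <= D2 by rewrite mulr_ge0 ?exprn_ge0 ?sqsum_ge0// (growth_ge0 g2).
apply: (@normal_ibp _ _ _ (D1 + D2) (maxn p1 p2)).
- by move=> t; exact: dg'.
- exact: tame_continuous.
- by move=> t; rewrite (le_trans (up _ _ _ g1 t))// lep ?leq_maxl// lerDl.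
- by move=> t; rewrite (le_trans (up _ _ _ g2 t))// lep ?leq_maxr// lerDr.
Qed.

(** A pi-system of boxes; the sigma-algebra it generates is that of the coordinates below [K] other
    than [k]. *)
Definition others k : set (set T) :=
  [set A | exists2 B : nat -> set R, (forall i, measurable (B i)) &
    A = [set w | forall i, (i < K)%N -> i != k -> B i (xi i w)] ].

Lemma measurable_box (Q : pred nat) (B : nat -> set R) : (forall i, measurable (B i)) ->
  measurable [set w | forall i, (i < K)%N -> Q i -> B i (xi i w)].
Proof.
move=> mB.
rewrite (_ : [set w | _] = \bigcap_i [set w | (i < K)%N -> Q i -> B i (xi i w)]); last first.
  by apply/seteqP; split => [w h i _ /=|w h i]; [exact: h|exact: (h i I)].
apply: bigcapT_measurable => i.
case: (boolP ((i < K)%N && Q i)) => [/andP[iK Qi]|nQ].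
  rewrite (_ : [set w | _] = xi i @^-1` B i); last first.
    by apply/seteqP; split => w /=; [exact|move=> ? _ _].
  by rewrite -[X in measurable X]setTI; exact: mxi.
rewrite (_ : [set w | _] = setT)//; apply/seteqP; split => // w _ /= iK Qi.
by move: nQ; rewrite iK Qi.
Qed.

Lemma others_measurable k : others k `<=` measurable.
Proof. by move=> _ [B mB ->]; exact: (measurable_box (fun i => i != k)). Qed.

Lemma othersI k : setI_closed (others k).
Proof.
move=> _ _ [B mB ->] [C mC ->]; exists (fun i => B i `&` C i).
  by move=> i; exact: measurableI.
by apply/seteqP; split => [w [h1 h2] i iK ik|w h]; [split; [exact: h1|exact: h2]|
  split => i iK ik; have [] := h i iK ik].
Qed.

Lemma others_independent_box k A (B : set R) : (k < K)%N -> others k A -> measurable B ->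
  P (A `&` xi k @^-1` B) = (P A * N01 B)%E.
Proof.
move=> kK [C mC ->] mB.
pose D i := if i == k then B else C i.
pose E i := if i == k then setT else C i.
have mD i : measurable (D i) by rewrite /D; case: eqP.
have mE i : measurable (E i) by rewrite /E; case: eqP.
have -> : [set w | forall i, (i < K)%N -> i != k -> C i (xi i w)] `&` xi k @^-1` B =
    [set w | forall i, (i < K)%N -> D i (xi i w)].
  apply/seteqP; split => [w [h1 h2] i iK|w h].
    by rewrite /D; case: eqP => [->//|/eqP ik]; exact: h1.
  split=> [i iK ik|]; first by have := h i iK; rewrite /D (negbTE ik).
  by have := h k kK; rewrite /D eqxx.
have -> : [set w | forall i, (i < K)%N -> i != k -> C i (xi i w)] =
    [set w | forall i, (i < K)%N -> E i (xi i w)].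
  apply/seteqP; split => [w h1 i iK|w h i iK ik].
    by rewrite /E; case: eqP => [->//|/eqP ik]; exact: h1.
  by have := h i iK; rewrite /E (negbTE ik).
rewrite !(iid_independent hxi)// (bigD1 (Ordinal kK))//= [in RHS](bigD1 (Ordinal kK))//=.
rewrite /D /E eqxx preimage_setT probability_setT mul1e muleC (iid_law hxi)//.
congr (_ * _)%E; apply: eq_bigr => i /eqP ik.
by case: eqP => // ik'; case: ik; exact: val_inj.
Qed.

(** For fixed [B] both sides are finite measures in [A]; they agree on the pi-system [others k],
    hence on the sigma-algebra it generates. *)
Lemma others_independent k A (B : set R) : (k < K)%N -> <<s others k >> A -> measurable B ->
  P (A `&` xi k @^-1` B) = (P A * N01 B)%E.
Proof.
move=> kK sA mB.
have mkB : measurable (xi k @^-1` B).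
  by rewrite -[X in measurable X]setTI; exact: mxi.
pose m1 := mrestr P mkB.
have c0 : (0 <= fine (N01 B))%R by exact: fine_ge0.
pose m2 := mscale (NngNum c0) P.
have -> : P (A `&` xi k @^-1` B) = m1 A by [].
have -> : (P A * N01 B)%E = m2 A.
  by rewrite /m2 /mscale /= muleC fineK// fin_num_measure.
have oT : others k setT.
  by exists (fun=> setT) => //; apply/seteqP; split.
apply: (g_sigma_algebra_measure_unique (others k) (@others_measurable k) (fun=> setT)) => //.
- by apply/seteqP; split => // w _; exists 0%N.
- exact: othersI.
- move=> C oC; rewrite /m1 /m2 /mrestr /mscale /=.
  transitivity (P (C `&` xi k @^-1` B)) => //.
  rewrite (@others_independent_box k C B kK oC mB) /mscale /=.
  by rewrite muleC fineK// fin_num_measure.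
- by move=> _; rewrite -ge0_fin_numE//; apply: (fin_num_measure P); rewrite setTI.
Qed.


(** Fubini separates coordinate [k] from the others; with these frozen, the formula is the one on
    the line. *)
Lemma iid_ibp_coord k g dg : (k < K)%N -> smooth K g dg ->
  \int[P]_w (xi k w * g (xi ^~ w)) = \int[P]_w dg (delta k) (xi ^~ w).
Proof.
move=> kK sg; have [tg tdg _ _] := sg.
pose T' := g_sigma_algebraType (others k).
have mid : measurable_fun [set: T] (id : T -> T').
  move=> _ A mA; rewrite setTI preimage_id.
  exact: (smallest_sub (@sigma_algebra_measurable _ T) (@others_measurable k)).
(* [X] is the identity of [T], onto the coarser sigma-algebra. Coordinate [k] need not be measurable
   there, because [upd] overwrites it. *)
pose X : {RV P >-> T'} := mfun_Sub (mem_set mid).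
have mxi' i : i != k -> measurable_fun [set: T'] (xi i).
  move=> ik; have [iK|Ki] := ltnP i K; last first.
    by rewrite (iid_tail hxi Ki); exact: measurable_cst.
  move=> _ B mB; rewrite setTI; apply: sub_sigma_algebra.
  exists (fun j => if j == i then B else setT); first by move=> j; case: eqP.
  apply/seteqP; split => [w h j jK jk|w /(_ i iK ik)]; last by rewrite eqxx.
  by case: eqP => // ->.
have mupd (g1 : (nat -> R) -> R) : tame K g1 ->
    measurable_fun [set: T' * measurableTypeR R] (fun z => g1 (upd (xi ^~ z.1) k z.2)).
  move=> tg1; apply: (tame_measurable tg1 (Z := fun i (z : T' * measurableTypeR R) => if i == k then z.2 else xi i z.1)).
  move=> i; case: eqP => [_|/eqP ik]; first exact: measurable_snd.
  by apply: measurableT_comp; [exact: mxi'|exact: measurable_fst].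
have updE w : upd (xi ^~ w) k (xi k w) = xi ^~ w.
  by apply/funext => i; rewrite /upd; case: eqP => // ->.
have indep := @integral_independent_normal _ _ T T' R P X (xi k) (@mxi k) _.
rewrite /Rintegral; congr fine.
have tv := tame_var (R := R) kK.
transitivity (\int[P]_w (xi k w * g (upd (xi ^~ w) k (xi k w)))%:E)%E.
  by apply: eq_integral => w _; rewrite updE.
transitivity (\int[P]_w (dg (delta k) (upd (xi ^~ w) k (xi k w)))%:E)%E; last first.
  by apply: eq_integral => w _; rewrite updE.
rewrite (indep _ (fun z => z.2 * g (upd (xi ^~ z.1) k z.2))); last first.
- rewrite (_ : (fun w => _) = (EFin \o (fun w => xi k w * g (xi ^~ w)))); last first.
    by apply/funext => w /=; rewrite updE.
  exact: tame_integrable (tameM tv tg).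
- by apply: measurable_funM; [exact: measurable_snd|exact: mupd].
- by move=> A B mA mB; apply: others_independent.
rewrite (indep _ (fun z => dg (delta k) (upd (xi ^~ z.1) k z.2))); last first.
- rewrite (_ : (fun w => _) = (EFin \o (fun w => dg (delta k) (xi ^~ w)))); last first.
    by apply/funext => w /=; rewrite updE.
  exact: tame_integrable (tdg _).
- exact: mupd.
- by move=> A B mA mB; apply: others_independent.
by apply: eq_integral => w _ /=; exact: normal_ibp_upd.
Qed.

Definition Ex (g : (nat -> R) -> R) : R := \int[P]_w g (xi ^~ w).

Lemma Ex_cst c : Ex (fun=> c) = c.
Proof. transitivity (fine (c%:E * P setT)); last by rewrite probability_setT mule1.
by rewrite /Ex /Rintegral integral_cst. Qed.

Lemma ExD g1 g2 : tame K g1 -> tame K g2 -> Ex (fun x => g1 x + g2 x) = Ex g1 + Ex g2.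
Proof. by move=> t1 t2; rewrite /Ex RintegralD//; exact: tame_integrable. Qed.

Lemma ExB g1 g2 : tame K g1 -> tame K g2 -> Ex (fun x => g1 x - g2 x) = Ex g1 - Ex g2.
Proof. by move=> t1 t2; rewrite /Ex RintegralB//; exact: tame_integrable. Qed.

Lemma ExZ c g : tame K g -> Ex (fun x => c * g x) = c * Ex g.
Proof. by move=> t; rewrite /Ex RintegralZl//; exact: tame_integrable. Qed.

Lemma Ex_sum (I : Type) (r : seq I) (Q : pred I) (g : I -> (nat -> R) -> R) :
  (forall i, tame K (g i)) ->
  Ex (fun x => \sum_(i <- r | Q i) g i x) = \sum_(i <- r | Q i) Ex (g i).
Proof.
move=> tg; elim: r => [|i r IH].
  rewrite big_nil (_ : (fun _ => _) = fun=> 0) ?Ex_cst//.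
  by apply/funext => x; rewrite big_nil.
rewrite big_cons -IH; case Qi : (Q i).
  rewrite -ExD//; last exact: tame_sum.
  by congr Ex; apply/funext => x; rewrite big_cons Qi.
by congr Ex; apply/funext => x; rewrite big_cons Qi.
Qed.

Lemma le_Ex g1 g2 : tame K g1 -> tame K g2 -> (forall x, g1 x <= g2 x) -> Ex g1 <= Ex g2.
Proof.
by move=> t1 t2 le12; apply: le_Rintegral => //; exact: tame_integrable.
Qed.

Lemma Ex_ge0 g : (forall x, 0 <= g x) -> 0 <= Ex g.
Proof. by move=> g0; apply: Rintegral_ge0. Qed.

Lemma iid_ibp h g dg : smooth K g dg -> Ex (fun x => dot K h x * g x) = Ex (dg h).
Proof.
move=> sg; have [tg tdg _ lg] := sg.
have -> : dg h = fun x => \sum_(k < K) h k * dg (delta k) x by apply/funext => x; exact: lg.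
have -> : (fun x => dot K h x * g x) = fun x => \sum_(k < K) h k * (x k * g x).
  by apply/funext => x; rewrite mulr_suml; apply: eq_bigr => k _; rewrite mulrA.
rewrite !Ex_sum.
- apply: eq_bigr => k _; rewrite !ExZ//; last by apply: tameM => //; exact: tame_var.
  by congr *%R; rewrite /Ex (iid_ibp_coord (ltn_ord k) sg).
- by move=> k; apply: tameM => //; exact: tame_cst.
- by move=> k; apply: tameM; [exact: tame_cst|apply: tameM => //; exact: tame_var].
Qed.

End iid_normal_theory.

(** * Hermite covariances and the anticoncentration inequality *)

Section gaussian_calculus.
Context d (T : measurableType d) (R : realType) (P : probability T R).
Variables (K : nat) (xi : nat -> T -> R).
Hypothesis hxi : iid_normal P K xi.
Local Notation E := (Ex P xi).
Local Notation H a p := (fun x => herm (dot K a a) (dot K a x) p).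
Implicit Types (a b h : nat -> R).

(** The recurrence writes [(p + 1) H_(p+1)] as [x H_p - s H_(p-1)]. Integrating [x H_p] by parts in
    the direction [a] produces a term that cancels [s H_(p-1)], and only the derivative of the
    second factor remains because [B] is constant along [a]. *)
Lemma dotZ_herm_cov a b s p q B dB : smooth K B dB -> (forall x, dB a x = 0) ->
  p.+1%:R * E (fun x => herm (dot K a a) (dot K a x) p.+1 * herm s (dot K b x) q * B x) =
  dot K a b * E (fun x => herm (dot K a a) (dot K a x) p * hermd s (dot K b x) q * B x).
Proof.
move=> sB dB0; have tB := smooth_tame sB.
have sp := smooth_herm K (dot K a a) a p; have sq := smooth_herm K s b q.
have tp := smooth_tame sp; have tq := smooth_tame sq.
have td s' a' p' : tame K (fun x => hermd s' (dot K a' x) p').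
  by case: p' => [|p'] /=; [exact: tame_cst|exact: tame_herm].
have ibp := iid_ibp hxi a (smoothM (smoothM sp sq) sB).
rewrite -!(ExZ hxi); first last.
- by apply: tameM => //; apply: tameM => //; exact: tame_herm.
- by apply: tameM => //; apply: tameM.
transitivity (E (fun x => dot K a x * (herm (dot K a a) (dot K a x) p * herm s (dot K b x) q * B x) -
   dot K a a * (hermd (dot K a a) (dot K a x) p * herm s (dot K b x) q * B x))).
  by congr Ex; apply/funext => x; rewrite !mulrA herm_rec; ring.
rewrite (ExB hxi); first last.
- by apply: tameM; [exact: tame_cst|apply: tameM => //; exact: tameM].
- by apply: tameM; [exact: tame_dot|apply: tameM => //; exact: tameM].
rewrite ibp -(ExB hxi); first last.
- by apply: tameM; [exact: tame_cst|apply: tameM => //; exact: tameM].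
- exact: (smooth_dtame (smoothM (smoothM sp sq) sB)).
congr Ex; apply/funext => x; rewrite dB0; ring.
Qed.

(** Iterating the previous identity lowers both degrees to 0. The parameter [s] of the second factor
    is free: each step only differentiates that factor, and its derivative does not depend on [s]
    beyond the lower-degree polynomial. The factor [B] lets expectations of products split off when
    [a] is orthogonal to everything that [B] depends on. *)
Lemma Ex_herm_cov a b s p B dB : smooth K B dB -> (forall x, dB a x = 0) ->
  E (fun x => herm (dot K a a) (dot K a x) p * herm s (dot K b x) p * B x) =
  dot K a b ^+ p / p`!%:R * E B.
Proof.
move=> sB dB0; elim: p => [|p IH].
  by rewrite expr0 fact0 divr1 mul1r; congr Ex; apply/funext => x; rewrite /= !mul1r.
have := dotZ_herm_cov b s p p.+1 sB dB0; rewrite /= IH => e.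
apply: (mulfI (x := p.+1%:R)); first by rewrite pnatr_eq0.
rewrite e exprS factS natrM invfM.
have : p.+1%:R != 0 :> R by rewrite pnatr_eq0.
have : p`!%:R != 0 :> R by rewrite pnatr_eq0 -lt0n fact_gt0.
by move=> f0 p0; field; rewrite f0 nat1r p0.
Qed.

Lemma Ex_herm2 a b s p :
  E (fun x => herm (dot K a a) (dot K a x) p * herm s (dot K b x) p) =
  dot K a b ^+ p / p`!%:R.
Proof.
have := @Ex_herm_cov a b s p _ _ (smooth_cst K 1) (fun=> erefl).
rewrite Ex_cst mulr1 => <-; congr Ex; apply/funext => x; by rewrite mulr1.
Qed.

Lemma Ex_herm1 a p : E (fun x => herm (dot K a a) (dot K a x) p.+1) = 0.
Proof.
have := @dotZ_herm_cov a a 0 p 0 _ _ (smooth_cst K 1) (fun=> erefl).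
rewrite /= (_ : Ex _ _ (fun x => _ * 0 * 1) = 0); last first.
  by rewrite -[RHS](Ex_cst P xi); congr Ex; apply/funext => x; rewrite mulr0 mul0r.
rewrite mulr0 => /eqP; rewrite mulf_eq0 pnatr_eq0/= => /eqP <-.
by congr Ex; apply/funext => x; rewrite !mulr1.
Qed.

Lemma Ex_sqr_sum (I : finType) (c : I -> R) (u : I -> (nat -> R) -> R) :
  (forall i, tame K (u i)) ->
  E (fun x => (\sum_i c i * u i x) ^+ 2) =
  \sum_i \sum_j c i * c j * E (fun x => u i x * u j x).
Proof.
move=> tu.
transitivity (E (fun x => \sum_i \sum_j c i * c j * (u i x * u j x))).
  congr Ex; apply/funext => x; rewrite expr2 mulr_suml; apply: eq_bigr => i _.
  by rewrite mulr_sumr; apply: eq_bigr => j _; ring.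
have t2 i j : tame K (fun x => u i x * u j x) by exact: tameM.
have t3 i j : tame K (fun x => c i * c j * (u i x * u j x)).
  by apply: tameM => //; exact: tame_cst.
rewrite (Ex_sum hxi); last by move=> i; exact: tame_sum.
by apply: eq_bigr => i _; rewrite (Ex_sum hxi)//; apply: eq_bigr => j _; rewrite (ExZ hxi).
Qed.

Lemma Ex_sqr_herm_sum (I : finType) (c : I -> R) (a : I -> nat -> R) s p :
  (forall i, dot K (a i) (a i) = s) ->
  E (fun x => (\sum_i c i * herm s (dot K (a i) x) p) ^+ 2) =
  \sum_i \sum_j c i * c j * (dot K (a i) (a j) ^+ p / p`!%:R).
Proof.
move=> as_; rewrite (Ex_sqr_sum c (u := fun i x => herm s (dot K (a i) x) p)); last first.
  by move=> i; exact: tame_herm.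
apply: eq_bigr => i _; apply: eq_bigr => j _.
have := Ex_herm2 (a i) (a j) s p; rewrite as_ => ->.
by [].
Qed.

Definition Pr (A : set T) : R := fine (P A).

Lemma Pr_ge0 A : 0 <= Pr A.
Proof. exact: fine_ge0. Qed.

Lemma Pr_EFin A : measurable A -> P A = (Pr A)%:E.
Proof. by move=> mA; rewrite /Pr fineK// fin_num_measure. Qed.

Lemma Pr_le A B : measurable A -> measurable B -> A `<=` B -> Pr A <= Pr B.
Proof.
move=> mA mB AB; rewrite /Pr fine_le ?fin_num_measure//.
by apply: le_measure => //; rewrite inE.
Qed.

Lemma Pr_le1 A : measurable A -> Pr A <= 1.
Proof. by move=> mA; rewrite -lee_fin -Pr_EFin// probability_le1. Qed.

Lemma Pr_setU A B : measurable A -> measurable B -> Pr (A `|` B) <= Pr A + Pr B.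
Proof.
move=> mA mB; rewrite -lee_fin EFinD -!Pr_EFin//; last exact: measurableU.
exact: measureU2.
Qed.

Lemma Pr_setC A : measurable A -> Pr (~` A) = 1 - Pr A.
Proof.
move=> mA; apply: EFin_inj; rewrite EFinB -!Pr_EFin//; last exact: measurableC.
exact: probability_setC.
Qed.

Lemma Pr_markov_set A g : measurable A -> tame K g -> (forall x, 0 <= g x) ->
  forall c, 0 < c -> (forall w, A w -> c <= g (xi ^~ w)) -> c * Pr A <= E g.
Proof.
move=> mA tg g0 c c0 Ac.
have ig := tame_integrable hxi tg.
rewrite -lee_fin EFinM -Pr_EFin// /Ex /Rintegral fineK ?integrable_fin_num//.
rewrite -integral_cst//; apply: (@le_trans _ _ (\int[P]_(w in A) (g (xi ^~ w))%:E)%E).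
  apply: ge0_le_integral => //.
  - by move=> w _; rewrite lee_fin ltW.
  - apply: measurable_funTS; apply/measurable_EFinP; exact: (tame_rv hxi).
apply: ge0_subset_integral => //.
- by apply/measurable_EFinP; exact: (tame_rv hxi).
- by move=> w _; rewrite lee_fin.
Qed.

Lemma measurable_le_set (f g : T -> R) : measurable_fun setT f -> measurable_fun setT g ->
  measurable [set w | f w <= g w].
Proof.
move=> mf mg; rewrite -[X in measurable X]setTI.
exact: measurable_fun_le.
Qed.

Lemma measurable_lt_set (f g : T -> R) : measurable_fun setT f -> measurable_fun setT g ->
  measurable [set w | f w < g w].
Proof.
move=> mf mg; rewrite (_ : [set w | _] = ~` [set w | g w <= f w]).
  by apply: measurableC; exact: measurable_le_set.
by apply/seteqP; split => w /=; [rewrite ltNge => /negP|move/negP; rewrite -ltNge].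
Qed.

Lemma Pr_chebyshev g c : tame K g -> 0 < c ->
  Pr [set w | c <= `|g (xi ^~ w)|] <= E (fun x => g x ^+ 2) / c ^+ 2.
Proof.
move=> tg c0; rewrite ler_pdivlMr ?exprn_gt0// mulrC.
apply: Pr_markov_set.
- apply: measurable_le_set => //; apply: measurableT_comp => //; exact: (tame_rv hxi).
- exact: tameX.
- by move=> x; exact: sqr_ge0.
- exact: exprn_gt0.
- by move=> w /= cg; rewrite -[leRHS]real_normK ?num_real// lerXn2r ?nnegrE ?(ltW c0).
Qed.

End gaussian_calculus.

(** * Anticoncentration from integration by parts *)

Section slope.
Context {R : realType}.
Implicit Types e t : R.

Definition slope (e t : R) : R := e * atan (e^-1 * t).

Definition dslope (e t : R) : R := (1 + (e^-1 * t) ^+ 2)^-1.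

Lemma is_derive_slope (e t : R) : e != 0 -> is_derive t (1 : R) (slope e) (dslope e t).
Proof.
move=> e0; rewrite /slope.
have h : is_derive t 1 (fun t => e^-1 * t) e^-1.
  by apply: is_derive_eq; rewrite /GRing.scale/=; ring.
have h2 := is_derive1_atan (e^-1 * t).
have h3 : is_derive t 1 (fun t => atan (e^-1 * t)) ((1 + (e^-1 * t) ^+ 2)^-1 * e^-1).
  exact: (@is_derive1_comp R atan (fun t => e^-1 * t) t _ _ h2 h).
apply: is_derive_eq; rewrite /GRing.scale/= /dslope mulrC divfK//.
Qed.

Lemma continuous_dslope e : continuous (dslope e).
Proof.
move=> t; rewrite /dslope; apply: cvgV.
  by rewrite gt_eqF// ltr_pwDl// sqr_ge0.
apply: cvgD; first exact: cvg_cst.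
have h : (fun x => e^-1 * x) @ t --> e^-1 * t by apply: cvgMr; exact: cvg_id.
exact: cvgM.
Qed.

Lemma slope_le e t : 0 < e -> `|slope e t| <= 2 * e.
Proof.
move=> e0; rewrite normrM gtr0_norm// mulrC ler_pM2r// ler_norml.
have [h1 h2] : - (pi / 2) < atan (e^-1 * t) /\ atan (e^-1 * t) < pi / 2 :> R.
  by split; [exact: atan_gtNpi2|exact: atan_ltpi2].
have := @pihalf_lt2 R.
by lra.
Qed.

Lemma dslope_ge0 e t : 0 <= dslope e t.
Proof. by rewrite invr_ge0 addr_ge0// sqr_ge0. Qed.

Lemma dslope_le1 e t : `|dslope e t| <= 1.
Proof.
rewrite ger0_norm ?dslope_ge0// invf_le1 ?lerDl ?sqr_ge0//.
by rewrite ltr_pwDl ?sqr_ge0.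
Qed.

Lemma dslope_ge_half e t : 0 < e -> `|t| <= e -> 2^-1 <= dslope e t.
Proof.
move=> e0 te; rewrite lef_pV2 ?posrE//; last by rewrite ltr_pwDl ?sqr_ge0.
have : (e^-1 * t) ^+ 2 <= 1.
  rewrite -real_normK ?num_real// normrM normfV (gtr0_norm e0) exprn_ile1//.
    by rewrite mulr_ge0// invr_ge0 ltW.
  by rewrite mulrC ler_pdivrMr// mul1r.
lra.
Qed.

Lemma smooth_slope K e g dg : 0 < e -> smooth K g dg ->
  smooth K (fun x => slope e (g x)) (fun h x => dslope e (g x) * dg h x).
Proof.
move=> e0; apply: (@smooth_comp _ _ _ _ (1 + 2 * e)).
- by move=> t; apply: is_derive_slope; rewrite gt_eqF.
- exact: continuous_dslope.
- by move=> t; rewrite (le_trans (slope_le t e0))// lerDr.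
- by move=> t; rewrite (le_trans (dslope_le1 e t))// lerDl mulr_ge0 ?ltW.
Qed.

Lemma tame_slope K e g : 0 < e -> tame K g -> tame K (fun x => slope e (g x)).
Proof.
move=> e0; apply: (@tame_comp _ _ _ (2 * e)); last by move=> t; exact: slope_le.
move=> t; apply: differentiable_continuous; apply/derivable1_diffP.
by have [] := is_derive_slope t (lt0r_neq0 e0).
Qed.

Lemma tame_dslope K e g : tame K g -> tame K (fun x => dslope e (g x)).
Proof.
by apply: (@tame_comp _ _ _ 1); [exact: continuous_dslope|move=> t; exact: dslope_le1].
Qed.

End slope.

Section anticoncentration.
Context d (T : measurableType d) (R : realType) (P : probability T R).
Variables (K : nat) (xi : nat -> T -> R).
Hypothesis hxi : iid_normal P K xi.
Local Notation E := (Ex P xi).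
Local Notation Pr := (Pr P).

(** Where [|F| <= e] and [V >= eta], the integrand on the left of the identity is at least
    [eta / 2], since the derivative of [slope e] is at least 1/2 on [[-e, e]]; the right side is at
    most [2 e E M], since [|slope e| <= 2 e]. The ratio is the [4 e / eta]. The majorant [M] is
    there so that second moments can be used in place of [E |U|]. *)
Lemma anticoncentration F V U M e eta : 0 < e -> 0 < eta ->
  tame K F -> tame K V -> tame K U -> tame K M ->
  (forall x, 0 <= V x) -> (forall x, `|U x| <= M x) ->
  E (fun x => dslope e (F x) * V x) = E (fun x => slope e (F x) * U x) ->
  Pr [set w | `|F (xi ^~ w)| <= e] <=
    Pr [set w | V (xi ^~ w) < eta] + 4 * e / eta * E M.
Proof.
move=> e0 eta0 tF tV tU tM V0 UM FV.
have mF := tame_rv hxi tF; have mV := tame_rv hxi tV.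
have mA : measurable [set w | `|F (xi ^~ w)| <= e].
  by apply: measurable_le_set => //; exact: measurableT_comp.
have mB : measurable [set w | V (xi ^~ w) < eta] by exact: measurable_lt_set.
have mC : measurable [set w | eta <= V (xi ^~ w)] by exact: measurable_le_set.
have mAC := measurableI _ _ mA mC.
have : Pr [set w | `|F (xi ^~ w)| <= e] <=
    Pr ([set w | V (xi ^~ w) < eta] `|`
        ([set w | `|F (xi ^~ w)| <= e] `&` [set w | eta <= V (xi ^~ w)])).
  apply: Pr_le => //; first exact: measurableU.
  by move=> w /= Fw; have [|] := ltP (V (xi ^~ w)) eta; [left|right].
move/le_trans; apply; rewrite (le_trans (Pr_setU P mB mAC))// lerD2l.
have h : 2^-1 * eta * Pr ([set w | `|F (xi ^~ w)| <= e] `&` [set w | eta <= V (xi ^~ w)]) <=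
    E (fun x => dslope e (F x) * V x).
  apply: (Pr_markov_set hxi) => //.
  - by apply: tameM => //; exact: tame_dslope.
  - by move=> x; rewrite mulr_ge0 ?dslope_ge0.
  - by rewrite mulr_gt0.
  - by move=> w [/= Fw Vw]; rewrite ler_pM ?(ltW eta0)//; exact: dslope_ge_half.
have {}h : 2^-1 * eta * Pr ([set w | `|F (xi ^~ w)| <= e] `&` [set w | eta <= V (xi ^~ w)]) <= 2 * e * E M.
  apply: (le_trans h); rewrite FV -(ExZ hxi)//; apply: (le_Ex hxi).
  - by apply: tameM => //; exact: tame_slope.
  - by apply: tameM => //; exact: tame_cst.
  - move=> x; rewrite (le_trans (ler_norm _))// normrM ler_pM//; exact: slope_le.
rewrite mulrAC ler_pdivlMr//; lra.
Qed.

End anticoncentration.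

(** * The variance of the squared gradient of a Hermite sum *)

Section moments.
Context d (T : measurableType d) (R : realType) (P : probability T R).

Fixpoint normal_moment (s : R) (n : nat) : R :=
  match n with
  | 0 => 1
  | n1.+1 => match n1 with 0 => 0 | n2.+1 => n1%:R * s * normal_moment s n2 end
  end.

Lemma smooth_dotX K (a : nat -> R) n : smooth K (fun x => dot K a x ^+ n)
  (fun h x => n%:R * dot K a x ^+ n.-1 * dot K h a).
Proof.
elim: n => [|n IH].
  by apply: smooth_eq (smooth_cst K 1) _ _ => [x|h x]; rewrite ?expr0// !mul0r.
apply: smooth_eq (smoothM (smooth_dot K a) IH) _ _ => [x|h x]; first by rewrite exprS.
case: n IH => [|n] IH; first by rewrite expr0; ring.
by rewrite /= -[n.+2%:R]natr1 !exprS; ring.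
Qed.

Lemma Ex_dotX K xi (a : nat -> R) n : iid_normal P K xi ->
  Ex P xi (fun x => dot K a x ^+ n) = normal_moment (dot K a a) n.
Proof.
move=> hxi.
suff : Ex P xi (fun x => dot K a x ^+ n) = normal_moment (dot K a a) n /\
  Ex P xi (fun x => dot K a x ^+ n.+1) = normal_moment (dot K a a) n.+1 by case.
elim: n => [|n [IH1 IH2]].
  split; first exact: (Ex_cst P xi 1).
  have := iid_ibp hxi a (smooth_cst K 1); rewrite (Ex_cst P xi 0) => e0.
  transitivity (0 : R) => //; rewrite -[RHS]e0.
  by congr Ex; apply/funext => x; rewrite mulr1.
split => //; have := iid_ibp hxi a (smooth_dotX K a n.+1).
rewrite (_ : (fun x => dot K a x * dot K a x ^+ n.+1) = (fun x => dot K a x ^+ n.+2)); last first.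
  by apply/funext => x; rewrite -exprS.
move=> ->; rewrite [RHS]/= -IH1 -(ExZ hxi); last by apply: tameX; exact: tame_dot.
by congr Ex; apply/funext => x /=; ring.
Qed.

Lemma herm_poly (s : R) p : exists Q : {poly R}, forall x, herm s x p = Q.[x].
Proof.
suff [Q [_ [hQ _]]] : exists Q Q' : {poly R}, (forall x, herm s x p = Q.[x]) /\
  (forall x, herm s x p.+1 = Q'.[x]) by exists Q.
elim: p => [|p [Q [Q' [hQ hQ']]]].
  by exists 1, 'X; split => x; rewrite ?hornerE.
exists Q', (p.+2%:R^-1 *: ('X * Q' - s *: Q)); split => // x.
by rewrite hermSS hQ hQ' !hornerE mulrC.
Qed.

(** All moments of a centered normal variable are functions of its variance, so the constant serves
    every [K], every family and every direction; only this uniformity matters. *)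
Lemma Ex_herm4 (s : R) p : exists C : R, forall K xi, iid_normal P K xi -> forall a,
  dot K a a = s -> Ex P xi (fun x => herm s (dot K a x) p ^+ 4) = C.
Proof.
have [Q hQ] := herm_poly s p.
exists (\sum_(i < size (Q ^+ 4)) (Q ^+ 4)`_i * normal_moment s i) => K xi hxi a as_.
transitivity (Ex P xi (fun x => \sum_(i < size (Q ^+ 4)) (Q ^+ 4)`_i * dot K a x ^+ i)).
  by congr Ex; apply/funext => x; rewrite hQ -horner_exp horner_coef.
have t i : tame K (fun x => dot K a x ^+ i) by apply: tameX; exact: tame_dot.
rewrite (Ex_sum hxi); last by move=> i; apply: tameM; [exact: tame_cst|exact: t].
by apply: eq_bigr => i _; rewrite (ExZ hxi)// Ex_dotX// as_.
Qed.

End moments.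

Definition near_idx (w i j : nat) : bool := (i <= j + w)%N && (j <= i + w)%N.

Lemma near_idxC w i j : near_idx w i j = near_idx w j i.
Proof. by rewrite /near_idx andbC. Qed.

Lemma near_idx_trans w w' i j k :
  near_idx w i j -> near_idx w' j k -> near_idx (w + w') i k.
Proof. rewrite /near_idx => /andP[? ?] /andP[? ?]; apply/andP; split; lia. Qed.

Lemma near_idx_le w w' i j : (w <= w')%N -> near_idx w i j -> near_idx w' i j.
Proof. rewrite /near_idx => ? /andP[? ?]; apply/andP; split; lia. Qed.

Lemma near_idx_count w N i : (\sum_(j < N) near_idx w i j <= w.*2.+1)%N.
Proof.
rewrite -big_mkcond /= sum1_card cardE -(size_map val).
rewrite -(size_iota (i - w) w.*2.+1); apply: uniq_leq_size.
  by rewrite map_inj_uniq ?enum_uniq//; exact: val_inj.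
move=> _ /mapP[j jn ->]; move: jn; rewrite mem_enum unfold_in mem_iota => /andP[? ?].
by rewrite -[\val j]/(nat_of_ord j); apply/andP; split; lia.
Qed.

Section stein.
Context d (T : measurableType d) (R : realType) (P : probability T R).
Variables (K : nat) (xi : nat -> T -> R).
Hypothesis hxi : iid_normal P K xi.
Local Notation E := (Ex P xi).
Local Notation Pr := (Pr P).
Variables (N : nat) (a : 'I_N -> nat -> R) (s c : R) (p : nat).
Hypothesis as_ : forall i, dot K (a i) (a i) = s.
Let h i x := herm s (dot K (a i) x) p.

Definition chaos x := c * \sum_i herm s (dot K (a i) x) p.+1.
Definition grad_sqr x := c ^+ 2 * \sum_i \sum_j dot K (a i) (a j) * (h i x * h j x).

Let th i : tame K (h i). Proof. exact: tame_herm. Qed.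

Lemma smooth_chaos : smooth K chaos (fun b x => c * \sum_i dot K b (a i) * h i x).
Proof.
apply: smoothZ; apply: smooth_sum => i; exact: (smooth_herm K s (a i) p.+1).
Qed.

Lemma tame_chaos : tame K chaos. Proof. exact: smooth_tame smooth_chaos. Qed.

Lemma tame_grad_sqr : tame K grad_sqr.
Proof.
apply: tameM; first exact: tame_cst.
apply: tame_sum => i _; apply: tame_sum => j _; apply: tameM; first exact: tame_cst.
exact: tameM.
Qed.

(** Expanding [dot] over the noise coordinates exhibits the squared Euclidean norm of the gradient
    of [chaos]. *)
Lemma grad_sqr_ge0 x : 0 <= grad_sqr x.
Proof.
rewrite mulr_ge0 ?sqr_ge0//.
suff -> : \sum_i \sum_j dot K (a i) (a j) * (h i x * h j x) =
    \sum_(k < K) (\sum_i a i k * h i x) ^+ 2 by apply: sumr_ge0 => k _; exact: sqr_ge0.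
under [RHS]eq_bigr => k _ do rewrite expr2 mulr_suml.
rewrite [RHS]exchange_big/=; apply: eq_bigr => i _.
under [RHS]eq_bigr => k _ do rewrite mulr_sumr.
rewrite [RHS]exchange_big/=; apply: eq_bigr => j _.
by rewrite /dot mulr_suml; apply: eq_bigr => k _; ring.
Qed.

(** On the chaos of order [p + 1] the number operator is multiplication by [p + 1]. Concretely, each
    summand [(p + 1) H_(p+1)] is expanded by [herm_rec] and integrated by parts in its own direction
    [a i], which turns [slope] into [dslope] times a row of the gradient form. *)
Lemma stein_chaos e : 0 < e ->
  E (fun x => dslope e (chaos x) * grad_sqr x) =
  E (fun x => slope e (chaos x) * (p.+1%:R * chaos x)).
Proof.
move=> e0.
have tds : tame K (fun x => dslope e (chaos x)) by exact: tame_dslope tame_chaos.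
have tsl : tame K (fun x => slope e (chaos x)) by exact: tame_slope tame_chaos.
have thd i : tame K (fun x => hermd s (dot K (a i) x) p).
  by case: (p) => [|p'] /=; [exact: tame_cst|exact: tame_herm].
have tg i : tame K (fun x => \sum_j dot K (a i) (a j) * h j x).
  by apply: tame_sum => j _; apply: tameM; [exact: tame_cst|].
have key i : E (fun x => slope e (chaos x) * (p.+1%:R * herm s (dot K (a i) x) p.+1)) =
    E (fun x => dslope e (chaos x) * (c * (h i x * \sum_j dot K (a i) (a j) * h j x))).
  have sm := smoothM (smooth_herm K s (a i) p) (smooth_slope e0 smooth_chaos).
  have := iid_ibp hxi (a i) sm.
  set L := fun x => dot K (a i) x * _ => ibp.
  have tL : tame K L.
    exact: (tameM (tame_dot K (a i)) (tameM (th i) tsl)).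
  transitivity (E (fun x => L x - s * (hermd s (dot K (a i) x) p * slope e (chaos x)))).
    by congr Ex; apply/funext => x; rewrite /L herm_rec; ring.
  have t2 : tame K (fun x => hermd s (dot K (a i) x) p * slope e (chaos x)) by exact: tameM.
  rewrite (ExB hxi)//; last by apply: tameM => //; exact: tame_cst.
  rewrite ibp -(ExB hxi); first last.
  - by apply: tameM => //; exact: tame_cst.
  - exact: (smooth_dtame sm).
  congr Ex; apply/funext => x; rewrite as_ /h; ring.
transitivity (E (fun x => \sum_i c * (dslope e (chaos x) * (c * (h i x * \sum_j dot K (a i) (a j) * h j x))))).
  congr Ex; apply/funext => x; rewrite /grad_sqr mulrCA !mulr_sumr; apply: eq_bigr => i _.
  rewrite [RHS](_ : _ = dslope e (chaos x) * (c ^+ 2) * (h i x * \sum_j dot K (a i) (a j) * h j x)); last by ring.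
  by rewrite !mulr_sumr; apply: eq_bigr => j _; ring.
transitivity (E (fun x => \sum_i c * (slope e (chaos x) * (p.+1%:R * herm s (dot K (a i) x) p.+1)))); last first.
  congr Ex; apply/funext => x; rewrite {3}/chaos !mulr_sumr; apply: eq_bigr => i _; ring.
have t1 i : tame K (fun x => dslope e (chaos x) * (c * (h i x * \sum_j dot K (a i) (a j) * h j x))).
  by apply: tameM => //; apply: tameM; [exact: tame_cst|exact: tameM].
have t2 i : tame K (fun x => slope e (chaos x) * (p.+1%:R * herm s (dot K (a i) x) p.+1)).
  by apply: tameM => //; apply: tameM; [exact: tame_cst|exact: tame_herm].
have tc g : tame K g -> tame K (fun x => c * g x) by move=> tg'; apply: tameM => //; exact: tame_cst.
rewrite !(Ex_sum hxi); first last.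
- by move=> i; exact: tc.
- by move=> i; exact: tc.
by apply: eq_bigr => i _; rewrite !(ExZ hxi)// key.
Qed.

Lemma Ex_grad_sqr : E grad_sqr =
  c ^+ 2 * \sum_i \sum_j dot K (a i) (a j) ^+ p.+1 / p`!%:R.
Proof.
have t i j : tame K (fun x => h i x * h j x) by exact: tameM.
have t' i j : tame K (fun x => dot K (a i) (a j) * (h i x * h j x)).
  by apply: tameM => //; exact: tame_cst.
rewrite /grad_sqr (ExZ hxi); last by apply: tame_sum => i _; exact: tame_sum.
rewrite (Ex_sum hxi); last by move=> i; exact: tame_sum.
congr *%R; apply: eq_bigr => i _; rewrite (Ex_sum hxi)//; apply: eq_bigr => j _.
rewrite (ExZ hxi)//; have := Ex_herm2 hxi (a i) (a j) s p; rewrite as_ => ->.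
by rewrite exprS mulrA.
Qed.

Let cov4 i j k l := E (fun x => (h i x * h j x) * (h k x * h l x)) -
  E (fun x => h i x * h j x) * E (fun x => h k x * h l x).

(** With [B = h k * h l] constant along [a i], [Ex_herm_cov] factorizes the expectation. It is
    enough that one index of the first pair is orthogonal to the second pair; [j] may be correlated
    with [k] and [l]. *)
Let cov4_eq0 i j k l : dot K (a i) (a k) = 0 -> dot K (a i) (a l) = 0 -> cov4 i j k l = 0.
Proof.
move=> ik il; rewrite /cov4.
have sB := smoothM (smooth_herm K s (a k) p) (smooth_herm K s (a l) p).
have := Ex_herm_cov hxi (a := a i) (a j) s p sB.
rewrite as_ -/(h i) => ->; last by move=> x; rewrite ik il !mul0r mulr0 addr0.
have := Ex_herm2 hxi (a i) (a j) s p; rewrite as_ => <-.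
by rewrite subrr.
Qed.

Variables (w : nat) (C4 : R).
Hypothesis dot_ge0 : forall i j, 0 <= dot K (a i) (a j).
Hypothesis dot_le : forall i j, dot K (a i) (a j) <= s.
Hypothesis dot_far : forall i j : 'I_N, ~~ near_idx w i j -> dot K (a i) (a j) = 0.
Hypothesis C4E : forall i, E (fun x => h i x ^+ 4) = C4.

(** The subtracted product is nonnegative because all covariances are, and a product of four numbers
    is at most the mean of their fourth powers. *)
Let cov4_le i j k l : cov4 i j k l <= C4.
Proof.
have Eij i' j' : 0 <= E (fun x => h i' x * h j' x).
  have := Ex_herm2 hxi (a i') (a j') s p; rewrite as_ => ->.
  by rewrite mulr_ge0 ?invr_ge0 ?exprn_ge0.
rewrite /cov4 lerBlDr; apply: (@le_trans _ _ C4); last by rewrite lerDl mulr_ge0.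
have t4 i' : tame K (fun x => h i' x ^+ 4) by exact: tameX.
rewrite [leRHS](_ : _ = E (fun x => 4^-1 * (((h i x ^+ 4 + h j x ^+ 4) + h k x ^+ 4) + h l x ^+ 4))); last first.
  rewrite (ExZ hxi) ?(ExD hxi) ?C4E//; try by repeat apply: tameD.
  by field.
apply: (le_Ex hxi).
- by apply: tameM; exact: tameM.
- by apply: tameM; [exact: tame_cst|repeat apply: tameD].
move=> x; move: (h i x) (h j x) (h k x) (h l x) => {}i {}j {}k {}l.
have h1 := sqr_ge0 (i * j - k * l); have h2 := sqr_ge0 (i ^+ 2 - j ^+ 2); have h3 := sqr_ge0 (k ^+ 2 - l ^+ 2).
rewrite !expr2 in h1 h2 h3 *; rewrite !exprS expr0 !mulr1; lra.
Qed.

(** A term survives only if [i] is within [w] of [j], [k] within [w] of [l], and [i] within [w] of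
    [k] or [l]. Then [j], [k], [l] all lie within [2 w] of [i], which leaves at most [N (4 w + 1)^3]
    terms, each at most [s^2 C4]. *)
Lemma var_grad_sqr : E (fun x => (grad_sqr x - E grad_sqr) ^+ 2) <=
  c ^+ 4 * s ^+ 2 * C4 * (N%:R * (w.*2.*2.+1)%:R ^+ 3).
Proof.
have tG := tame_grad_sqr.
set m := E grad_sqr.
have -> : E (fun x => (grad_sqr x - m) ^+ 2) = E (fun x => grad_sqr x * grad_sqr x) - m * m.
  transitivity (E (fun x => (grad_sqr x * grad_sqr x - 2 * m * grad_sqr x) + m * m)).
    by congr Ex; apply/funext => x; ring.
  have tcG c' : tame K (fun x => c' * grad_sqr x) by apply: tameM => //; exact: tame_cst.
  have tGG : tame K (fun x => grad_sqr x * grad_sqr x) by exact: tameM.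
  rewrite (ExD hxi (tameB tGG (tcG _)) (tame_cst K _)) (ExB hxi tGG (tcG _)) (ExZ hxi _ tG).
  by rewrite Ex_cst -/m; ring.
pose r i j := dot K (a i) (a j).
have t2 i j : tame K (fun x => h i x * h j x) by exact: tameM.
have mE : m = c ^+ 2 * \sum_i \sum_j r i j * E (fun x => h i x * h j x).
  rewrite /m Ex_grad_sqr; congr *%R; apply: eq_bigr => i _; apply: eq_bigr => j _.
  have := Ex_herm2 hxi (a i) (a j) s p; rewrite as_ => ->; by rewrite exprS mulrA.
have sum4 (f g : 'I_N -> 'I_N -> R) : (\sum_i \sum_j f i j) * (\sum_k \sum_l g k l) =
    \sum_i \sum_j \sum_k \sum_l f i j * g k l.
  rewrite mulr_suml; apply: eq_bigr => i _; rewrite mulr_suml; apply: eq_bigr => j _.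
  by rewrite mulr_sumr; apply: eq_bigr => k _; rewrite mulr_sumr.
have -> : E (fun x => grad_sqr x * grad_sqr x) = c ^+ 4 *
    \sum_i \sum_j \sum_k \sum_l r i j * r k l * E (fun x => (h i x * h j x) * (h k x * h l x)).
  transitivity (E (fun x => c ^+ 4 * \sum_i \sum_j \sum_k \sum_l (r i j * r k l) * ((h i x * h j x) * (h k x * h l x)))).
    congr Ex; apply/funext => x; rewrite /grad_sqr mulrACA sum4 -exprD; congr *%R.
    by do 4 (apply: eq_bigr => ? _); rewrite /r; ring.
  have t4 i j k l : tame K (fun x => (r i j * r k l) * ((h i x * h j x) * (h k x * h l x))).
    by apply: tameM; [exact: tame_cst|exact: tameM].
  rewrite (ExZ hxi); last by do 4 (apply: tame_sum => ? _).
  congr *%R.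
  rewrite (Ex_sum hxi); last by move=> i; do 3 (apply: tame_sum => ? _).
  apply: eq_bigr => i _; rewrite (Ex_sum hxi); last by move=> j; do 2 (apply: tame_sum => ? _).
  apply: eq_bigr => j _; rewrite (Ex_sum hxi); last by move=> k; apply: tame_sum.
  apply: eq_bigr => k _; rewrite (Ex_sum hxi)//.
  by apply: eq_bigr => l _; rewrite (ExZ hxi)//; exact: tameM.
rewrite mE mulrACA sum4 -exprD -mulrBr.
rewrite [leRHS](_ : _ = c ^+ 4 * (s ^+ 2 * (C4 * (N%:R * (w.*2.*2.+1)%:R ^+ 3)))); last by rewrite !mulrA.
apply: ler_wpM2l; first by rewrite exprn_even_ge0.
rewrite -sumrB.
have -> : s ^+ 2 * (C4 * (N%:R * (w.*2.*2.+1)%:R ^+ 3)) = \sum_(i < N) s ^+ 2 * C4 * (w.*2.*2.+1)%:R ^+ 3.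
  by rewrite sumr_const card_ord -mulr_natr; ring.
pose n (i j : 'I_N) : R := (near_idx w.*2 i j)%:R.
(* Stated under an index: if [N = 0], the hypotheses say nothing about the signs of [s] and [C4]. *)
have s0 : 'I_N -> 0 <= s by move=> i; rewrite -(as_ i).
have C40 : 'I_N -> 0 <= C4.
  by move=> i; rewrite -(C4E i); apply: Ex_ge0 => x; rewrite exprn_even_ge0.
have nc i : \sum_j n i j <= (w.*2.*2.+1)%:R by rewrite -natr_sum ler_nat near_idx_count.
apply: ler_sum => i _.
have s2C : 0 <= s ^+ 2 * C4 by rewrite mulr_ge0 ?exprn_ge0 ?(s0 i) ?(C40 i).
apply: (@le_trans _ _ (\sum_j \sum_k \sum_l s ^+ 2 * C4 * (n i j * (n i k * n i l)))).
  rewrite -sumrB; apply: ler_sum => j _; rewrite -sumrB; apply: ler_sum => k _.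
  rewrite -sumrB; apply: ler_sum => l _.
  rewrite (_ : _ - _ = r i j * r k l * cov4 i j k l); last by rewrite /cov4; ring.
  have pos : 0 <= s ^+ 2 * C4 * (n i j * (n i k * n i l)).
    by apply: mulr_ge0 => //; apply: mulr_ge0 => //; exact: mulr_ge0.
  have [ij|ij] := boolP (near_idx w i j); last by rewrite /r dot_far// !mul0r.
  have [kl|kl] := boolP (near_idx w k l); last by rewrite /r (dot_far kl) mulr0 !mul0r.
  have ww : (w <= w.*2)%N by rewrite -addnn leq_addr.
  have [|] := boolP (near_idx w i k || near_idx w i l).
    move=> nn.
    have [h1 h2 h3] : [/\ n i j = 1, n i k = 1 & n i l = 1].
      rewrite /n (near_idx_le ww ij); split => //; case/orP: nn => nn.
      + by rewrite (near_idx_le ww nn).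
      + by rewrite -addnn (near_idx_trans nn)// near_idxC.
      + by rewrite -addnn (near_idx_trans nn).
      + by rewrite (near_idx_le ww nn).
    rewrite h1 h2 h3 !mulr1 expr2.
    apply: (@le_trans _ _ (r i j * r k l * C4)); first by rewrite ler_wpM2l ?mulr_ge0 ?dot_ge0.
    by rewrite ler_wpM2r ?(C40 i)// ler_pM ?dot_ge0 ?dot_le.
  rewrite negb_or => /andP[ik il].
  by rewrite cov4_eq0 ?dot_far// mulr0.
rewrite [leLHS](_ : _ = s ^+ 2 * C4 * ((\sum_j n i j) * ((\sum_k n i k) * (\sum_l n i l)))); last first.
  rewrite mulr_suml mulr_sumr; apply: eq_bigr => j _.
  rewrite mulr_suml !mulr_sumr; apply: eq_bigr => k _.
  by rewrite !mulr_sumr; apply: eq_bigr => l _.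
have n0 : 0 <= \sum_j n i j by apply: sumr_ge0.
rewrite ler_wpM2l// !exprS expr0 mulr1; apply: ler_pM => //; first exact: mulr_ge0.
exact: ler_pM.
Qed.

(** Anticoncentration with threshold [v0 / 2] for the squared gradient; Chebyshev around its mean,
    which is at least [v0], bounds the probability of being below the threshold. *)
Lemma Pr_chaos_le e v0 : 0 < e -> 0 < v0 -> v0 <= E grad_sqr ->
  Pr [set z | `|chaos (xi ^~ z)| <= e] <=
  4 / v0 ^+ 2 * (c ^+ 4 * s ^+ 2 * C4 * (N%:R * (w.*2.*2.+1)%:R ^+ 3)) +
  8 * e / v0 * (p.+1%:R * (1 + E (fun x => chaos x ^+ 2))).
Proof.
move=> e0 v00 v0E.
have v20 : 0 < v0 / 2 by rewrite divr_gt0.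
have tC := tame_chaos; have tG := tame_grad_sqr.
have tM : tame K (fun x => p.+1%:R * (1 + chaos x ^+ 2)).
  by apply: tameM; [exact: tame_cst|apply: tameD; [exact: tame_cst|exact: tameX]].
have := @anticoncentration _ _ _ _ _ _ hxi chaos grad_sqr (fun x => p.+1%:R * chaos x)
  (fun x => p.+1%:R * (1 + chaos x ^+ 2)) e (v0 / 2) e0 v20 tC tG _ tM grad_sqr_ge0 _ (stein_chaos e0).
have -> : E (fun x => p.+1%:R * (1 + chaos x ^+ 2)) = p.+1%:R * (1 + E (fun x => chaos x ^+ 2)).
  rewrite (ExZ hxi) ?(ExD hxi) ?Ex_cst//; try exact: tame_cst; try exact: tameX.
  by apply: tameD; [exact: tame_cst|exact: tameX].
move=> /(_ _ _)/le_trans; apply.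
- by apply: tameM => //; exact: tame_cst.
- move=> x; rewrite normrM ger0_norm// ler_wpM2l//.
  have := sqr_ge0 (`|chaos x| - 1); have := normr_ge0 (chaos x).
  by rewrite -[chaos x ^+ 2]real_normK ?num_real// sqrrB expr1n mulr1; lra.
apply: lerD; last by rewrite le_eqVlt; apply/orP; left; apply/eqP; field; rewrite gt_eqF.
have tD : tame K (fun x => grad_sqr x - E grad_sqr) by apply: tameB => //; exact: tame_cst.
apply: (@le_trans _ _ (Pr [set z | v0 / 2 <= `|grad_sqr (xi ^~ z) - E grad_sqr| ])).
  apply: Pr_le.
  - by apply: measurable_lt_set => //; exact: (tame_rv hxi).
  - apply: measurable_le_set => //; apply: measurableT_comp => //; exact: (tame_rv hxi tD).
  - by move=> z /= h1; rewrite -normrN (le_trans _ (ler_norm _))//; lra.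
apply: (le_trans (Pr_chebyshev hxi tD v20)).
rewrite exprMn exprVn invfM invrK -[2 ^+ 2]/(2 * 2) [leRHS]mulrC [leRHS]mulrA.
rewrite (_ : 2 * 2 = 4 :> R); last by ring.
rewrite -[leRHS]mulrA; apply: ler_pM => //.
- by apply: Ex_ge0 => x; exact: sqr_ge0.
- by rewrite mulr_ge0 ?invr_ge0 ?sqr_ge0.
- exact: var_grad_sqr.
- by rewrite mulrC.
Qed.

End stein.

(** * Power sums and the logarithmic limit *)

Section power_sums.
Context {R : realType}.
Implicit Types a b c x : R.

Lemma powR_add x r t : 0 < x -> x `^ (r + t) = x `^ r * x `^ t.
Proof. by move=> x0; rewrite powRD// (gt_eqF x0) implybT. Qed.

Lemma le_powR r x y : 0 <= r -> 0 <= x -> x <= y -> x `^ r <= y `^ r.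
Proof.
by move=> r0 x0 xy; apply: ge0_ler_powR => //; rewrite nnegrE// (le_trans x0).
Qed.

Lemma ln_succ_le n : (0 < n)%N -> ln (n.+1%:R : R) - ln n%:R <= n%:R^-1.
Proof.
move=> n0; have n0' : 0 < n%:R :> R by rewrite ltr0n.
rewrite -ln_div ?posrE//.
have -> : n.+1%:R / n%:R = 1 + n%:R^-1 :> R by rewrite -natr1 mulrDl divff ?gt_eqF// mul1r.
by rewrite le_ln1Dx// (lt_le_trans (y := 0)) ?ltrN10// invr_ge0.
Qed.

Lemma le_ln_succ n : (0 < n)%N -> n.+1%:R^-1 <= ln (n.+1%:R : R) - ln n%:R.
Proof.
move=> n0; have n0' : 0 < n%:R :> R by rewrite ltr0n.
have n1 : 0 < n.+1%:R :> R by rewrite ltr0n.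
rewrite -[leRHS]opprB lerNr -ln_div ?posrE//.
have -> : n%:R / n.+1%:R = 1 + - n.+1%:R^-1 :> R.
  by rewrite -{1}[n](addnK 1%N) addn1 natrB// mulrBl divff ?gt_eqF// mul1r.
by rewrite le_ln1Dx// ltrN2 invf_lt1// ltr1n.
Qed.

Lemma harmonic_le L : (0 < L)%N -> \sum_(1 <= n < L.+1) n%:R^-1 <= 1 + ln L%:R :> R.
Proof.
elim: L => // -[_ _|L IH _]; first by rewrite big_nat1 invr1 ln1 addr0.
rewrite big_nat_recr//= -lerBrDr (le_trans (IH isT))//.
by rewrite lerBrDr -addrA lerD2l -lerBrDl le_ln_succ.
Qed.

Lemma harmonic_ge L M : (0 < L)%N -> (L <= M)%N ->
  ln M%:R - ln L%:R <= \sum_(L <= n < M) n%:R^-1 :> R.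
Proof.
move=> L0; elim: M => [|M IH]; first by rewrite leqn0 => /eqP L0'; rewrite L0' in L0.
rewrite leq_eqVlt => /predU1P[<-|]; first by rewrite subrr big_geq.
rewrite ltnS => LM; rewrite big_nat_recr//=.
have := IH LM; have := @ln_succ_le M (leq_trans L0 LM); lra.
Qed.

(** A telescoping majorant for the tails: [exp u >= 1 + u] applied to the ratio of consecutive
    powers, with [1 / (n + 1)] bounding the increment of the logarithm from below. *)
Lemma powR_tail_step a n : 0 < a -> (0 < n)%N ->
  a * n.+1%:R `^ (- (1 + a)) <= n%:R `^ (- a) - n.+1%:R `^ (- a) :> R.
Proof.
move=> a0 n0; have n0' : 0 < n%:R :> R by rewrite ltr0n.
have n1 : 0 < n.+1%:R :> R by rewrite ltr0n.
have h : n%:R `^ (- a) = n.+1%:R `^ (- a) * expR (a * (ln n.+1%:R - ln n%:R)).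
  rewrite /powR !gt_eqF// -expRD; congr expR; ring.
rewrite h -[leRHS](_ : n.+1%:R `^ (- a) * (expR (a * (ln n.+1%:R - ln n%:R)) - 1) = _); last by ring.
have -> : a * n.+1%:R `^ (- (1 + a)) = n.+1%:R `^ (- a) * (a * n.+1%:R^-1).
  rewrite opprD powR_add//.
  by rewrite powR_inv1 ?ltW//; ring.
rewrite ler_wpM2l ?powR_ge0// (@le_trans _ _ (a * (ln n.+1%:R - ln n%:R)))//.
  by rewrite ler_wpM2l ?(ltW a0)// le_ln_succ.
have := expR_ge1Dx (a * (ln n.+1%:R - ln n%:R)); lra.
Qed.

Lemma powR_tail a L M : 0 < a -> (0 < L)%N ->
  \sum_(L.+1 <= n < M) n%:R `^ (- (1 + a)) <= L%:R `^ (- a) / a :> R.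
Proof.
move=> a0 L0; have [ML|LM] := leqP M L.+1.
  by rewrite big_geq// divr_ge0 ?powR_ge0 ?ltW.
rewrite ler_pdivlMr// mulrC mulr_sumr.
apply: (@le_trans _ _ (L%:R `^ (- a) - M.-1%:R `^ (- a))); last by rewrite gerBl powR_ge0.
have {}LM := ltnW LM; elim: M LM => // M IH; rewrite ltnS leq_eqVlt => /predU1P[<-|LM].
  by rewrite big_geq//= subrr.
rewrite big_nat_recr//=; have := IH LM.
case: M LM {IH} => // M LM /=; have := @powR_tail_step a M a0 (leq_trans L0 LM).
lra.
Qed.

(** The factor 1/2 is a crude loss, from [1 / (1 + u) <= 1 - u / 2] for [0 <= u <= 1]. *)
Lemma powR_head_step c n : 0 < c <= 1 ->
  c / 2 * n.+1%:R `^ (c - 1) <= n.+1%:R `^ c - n%:R `^ c :> R.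
Proof.
move=> /andP[c0 c1]; have n1 : 0 < n.+1%:R :> R by rewrite ltr0n.
have e1 : n.+1%:R `^ (c - 1) = n.+1%:R `^ c * n.+1%:R^-1 :> R.
  by rewrite powR_add// powR_inv1 ?ltW.
case: n n1 e1 => [|n] n1 e1.
  by rewrite !powR1 powR0 ?gt_eqF//; lra.
have n0 : 0 < n.+1%:R :> R by rewrite ltr0n.
set u := ln (n.+2%:R : R) - ln n.+1%:R.
have h : n.+1%:R `^ c = n.+2%:R `^ c * expR (- (c * u)).
  rewrite /powR !gt_eqF// -expRD; congr expR; rewrite /u; ring.
rewrite e1 h -[leRHS](_ : n.+2%:R `^ c * (1 - expR (- (c * u))) = _); last by ring.
rewrite mulrCA ler_wpM2l ?powR_ge0//.
have u0 : n.+2%:R^-1 <= u by exact: le_ln_succ.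
have i0 : 0 < n.+2%:R^-1 :> R by rewrite invr_gt0.
have i1 : n.+2%:R^-1 <= 1 :> R by rewrite invf_le1// ler1n.
set i := n.+2%:R^-1 in u0 i0 i1 *.
have : expR (- (c * u)) <= expR (- (c * i)).
  by rewrite ler_expR lerN2 ler_wpM2l// ltW.
have : expR (- (c * i)) <= (1 + c * i)^-1.
  by rewrite expRN lef_pV2 ?posrE ?expR_gt0 ?expR_ge1Dx// ltr_pwDl// mulr_ge0// ltW.
have : (1 + c * i)^-1 <= 1 - c / 2 * i.
  have ci0 : 0 < c * i by rewrite mulr_gt0.
  have ci1 : c * i <= 1 by rewrite mulr_ile1// ltW.
  rewrite -[leLHS]mul1r ler_pdivrMr ?ltr_pwDl ?(ltW ci0)//; nra.
lra.
Qed.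

Lemma powR_head c M : 0 < c <= 1 ->
  \sum_(1 <= n < M.+1) n%:R `^ (c - 1) <= 2 / c * M%:R `^ c :> R.
Proof.
move=> c01; have c0 : 0 < c by case/andP: c01.
elim: M => [|M IH]; first by rewrite big_geq// powR0 ?gt_eqF// mulr0.
rewrite big_nat_recr//=; have := powR_head_step M c01.
rewrite -(ler_pM2l (_ : 0 < 2 / c)) ?divr_gt0// mulrA.
have -> : 2 / c * (c / 2) = 1 by field; rewrite gt_eqF.
rewrite mul1r mulrBr; lra.
Qed.

End power_sums.

(** * Logarithmic asymptotics of the weighted sum of tail probabilities *)

Section log_limit.
Context {R : realType}.
Variables (gam : R) (pr : nat -> R -> R).
Hypothesis gam0 : 0 < gam.
Hypothesis pr0 : forall N x, 0 <= pr N x.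
Hypothesis pr1 : forall N x, pr N x <= 1.
Hypothesis pr_mono : forall N x y, x <= y -> pr N y <= pr N x.
Hypothesis pr_up : exists2 C, 0 <= C & forall N x, (0 < N)%N -> 0 < x ->
  pr N x <= C * N%:R `^ (2 * gam) / x ^+ 2.
Hypothesis pr_lo : forall eta, 0 < eta -> exists2 del, 0 < del &
  exists N0, forall N, (N0 <= N)%N -> 1 - eta <= pr N (del * N%:R `^ gam).

Let term eps N : R := N%:R^-1 * pr N (eps * N%:R `^ (2 * gam)).
Let F eps : \bar R := (\sum_(1 <= N <oo) (term eps N)%:E)%E.

Let term0 eps N : 0 <= term eps N.
Proof. by rewrite mulr_ge0. Qed.

Let F0 eps : (0 <= F eps)%E.
Proof. by apply: nneseries_ge0 => N _ _; rewrite lee_fin. Qed.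

Let powR_neg_ln eps : 0 < eps -> ln (eps `^ (- gam^-1)) = - ln eps / gam.
Proof. by move=> e0; rewrite ln_powR; ring. Qed.

(** Cut at [L], the integer part of [eps^(-1/gam)]. Below it probabilities are bounded by 1 and the
    harmonic sum gives [- ln eps / gam + 1]. Above it [pr_up] gives [C eps^-2 N^(-1 - 2 gam)], whose
    tail is of order [eps^-2 L^(-2 gam)], hence bounded. *)
Let F_le : exists C, forall eps, 0 < eps < 1 -> (F eps <= (- ln eps / gam + C)%:E)%E.
Proof.
have [C C0 hC] := pr_up.
pose a := 2 * gam; have a0 : 0 < a by rewrite mulr_gt0.
exists (1 + C * 2 `^ a / a) => eps /andP[e0 e1].
pose y := eps `^ (- gam^-1).
have y0 : 0 < y by exact: powR_gt0.
have y1 : 1 <= y.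
  rewrite /y powRN invf_ge1 ?powR_gt0//.
  have gi0 : 0 <= gam^-1 by rewrite invr_ge0 ltW.
  by have := le_powR gi0 (ltW e0) (ltW e1); rewrite powR1.
pose L := Num.truncn y.
have /andP[Ly yL] := truncn_itv (ltW y0).
have L1 : (1 <= L)%N by rewrite truncn_ge_nat ?(ltW y0).
have L0' : 0 < L%:R :> R by rewrite ltr0n.
have y2L : y <= 2 * L%:R.
  rewrite (le_trans (ltW yL))// -/L -natr1.
  have : 1 <= L%:R :> R by rewrite ler1n.
  lra.
have ya : y `^ (- a) = eps ^+ 2.
  rewrite /y -powRrM (_ : - gam^-1 * - a = 2%:R); first by rewrite powR_mulrn ?ltW.
  by rewrite /a; field; rewrite gt_eqF.
have La : L%:R `^ (- a) <= 2 `^ a * eps ^+ 2.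
  rewrite -ya powRN -[leRHS]invrK lef_pV2 ?posrE ?powR_gt0 ?invr_gt0 ?mulr_gt0 ?powR_gt0//.
  rewrite invfM -!powRN opprK -(ler_pM2l (powR_gt0 a (ltr0Sn R 1))) mulrA powRN.
  rewrite divff ?gt_eqF ?powR_gt0// mul1r -powRM ?(ltW L0')//.
  by apply: le_powR => //; exact: ltW.
have partial M : \sum_(1 <= N < M) term eps N <= - ln eps / gam + (1 + C * 2 `^ a / a).
  apply: (@le_trans _ _ (\sum_(1 <= N < L.+1) N%:R^-1 + \sum_(L.+1 <= N < M) C * eps ^- 2 * N%:R `^ (- (1 + a)))).
    have s1 : \sum_(1 <= N < L.+1) term eps N <= \sum_(1 <= N < L.+1) N%:R^-1.
      by apply: ler_sum => N _; rewrite ler_piMr.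
    have s2 : \sum_(L.+1 <= N < M) term eps N <= \sum_(L.+1 <= N < M) C * eps ^- 2 * N%:R `^ (- (1 + a)).
      rewrite big_nat_cond [leRHS]big_nat_cond; apply: ler_sum => N /andP[/andP[LN _] _].
      have N0 : (0 < N)%N by exact: leq_trans LN.
      have N0' : 0 < N%:R :> R by rewrite ltr0n.
      have x0 : 0 < eps * N%:R `^ (2 * gam) by rewrite mulr_gt0 ?powR_gt0.
      apply: (@le_trans _ _ (N%:R^-1 * (C * N%:R `^ (2 * gam) / (eps * N%:R `^ (2 * gam)) ^+ 2))).
        by rewrite ler_wpM2l ?invr_ge0// hC.
      rewrite -/a opprD powR_add// powR_inv1 ?(ltW N0')// powRN.
      rewrite le_eqVlt; apply/orP; left; apply/eqP; field.
      by rewrite !gt_eqF ?powR_gt0.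
    have [LM|ML] := leqP L.+1 M.
      by rewrite (@big_cat_nat _ _ _ L.+1)//= lerD.
    rewrite [X in _ <= _ + X]big_geq 1?ltnW// addr0.
    apply: le_trans s1; case: M ML s2 => [|M] ML _; first by rewrite big_geq// sumr_ge0.
    by rewrite [leRHS](@big_cat_nat _ _ _ M.+1)//= ?lerDl ?sumr_ge0// ltnW.
  have h1 : \sum_(1 <= N < L.+1) N%:R^-1 <= 1 + - ln eps / gam.
    apply: (le_trans (harmonic_le L1)); rewrite lerD2l -powR_neg_ln// ler_ln ?posrE//.
  have h2 : \sum_(L.+1 <= N < M) C * eps ^- 2 * N%:R `^ (- (1 + a)) <= C * 2 `^ a / a.
    rewrite -mulr_sumr.
    apply: (@le_trans _ _ (C * eps ^- 2 * (2 `^ a * eps ^+ 2 / a))).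
      rewrite ler_wpM2l//; first by rewrite mulr_ge0// invr_ge0 sqr_ge0.
      by rewrite (le_trans (powR_tail M a0 L1))// ler_wpM2r// invr_ge0 ltW.
    rewrite le_eqVlt; apply/orP; left; apply/eqP; field.
    by rewrite !gt_eqF.
  lra.
rewrite /F; apply: lime_le.
  by apply: is_cvg_nneseries => N _ _; rewrite lee_fin.
by apply: nearW => M; rewrite sumEFin lee_fin.
Qed.

(** For [N <= (del / eps)^(1/gam)] the threshold [eps N^(2 gam)] is at most [del N^gam], so [pr_lo]
    applies and the harmonic sum from [N0] on gives the logarithm. *)
Let F_ge eta : 0 < eta < 1 -> exists C, forall eps, 0 < eps ->
  (((1 - eta) * (- ln eps / gam - C))%:E <= F eps)%E.
Proof.
move=> /andP[eta0 eta1]; have [del del0 [N0 hN0]] := pr_lo eta0.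
exists (ln N0.+1%:R - ln del / gam) => eps e0.
pose y := (del / eps) `^ (gam^-1).
have de0 : 0 < del / eps by exact: divr_gt0.
have y0 : 0 < y by exact: powR_gt0.
pose L := Num.truncn y.
have /andP[Ly yL] := truncn_itv (ltW y0).
have lny : ln y = (ln del - ln eps) / gam by rewrite ln_powR ln_div// mulrC.
(* If the cutoff has not passed [N0], the claimed lower bound is nonpositive. *)
have [LN|NL] := leqP L.+1 N0.+1.
  apply: le_trans (F0 eps); rewrite lee_fin; apply: mulr_ge0_le0; first lra.
  have : ln y <= ln N0.+1%:R.
    by rewrite ler_ln ?posrE// (le_trans (ltW yL))// ler_nat.
  by rewrite lny; lra.
apply: (@le_trans _ _ (\sum_(1 <= N < L.+1) (term eps N)%:E)%E); last first.
  by apply: nneseries_lim_ge => N _ _; rewrite lee_fin.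
rewrite sumEFin lee_fin.
apply: (@le_trans _ _ (\sum_(N0.+1 <= N < L.+1) (1 - eta) * N%:R^-1)).
  rewrite -mulr_sumr ler_wpM2l//; first lra.
  have := @harmonic_ge R N0.+1 L.+1 isT (ltnW NL).
  have : ln y <= ln (L.+1%:R : R) by rewrite ler_ln ?posrE// ltW.
  by rewrite lny; lra.
apply: (@le_trans _ _ (\sum_(N0.+1 <= N < L.+1) term eps N)).
  rewrite big_nat_cond [leRHS]big_nat_cond; apply: ler_sum => N /andP[/andP[NN NL'] _].
  have N1 : (0 < N)%N by exact: leq_trans NN.
  have N1' : 0 < N%:R :> R by rewrite ltr0n.
  rewrite mulrC ler_wpM2l ?invr_ge0//.
  rewrite (le_trans (hN0 N (ltnW NN)))//; apply: pr_mono.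
  rewrite mulrC (_ : 2 * gam = gam + gam); last by ring.
  rewrite powR_add// -mulrA [leRHS]mulrC ler_wpM2l ?powR_ge0//.
  rewrite -ler_pdivlMr//.
  have -> : del / eps = y `^ gam by rewrite -powRrM mulVf ?gt_eqF// powRr1// ltW.
  apply: le_powR; rewrite ?(ltW gam0)// (le_trans _ Ly)// ler_nat.
  by rewrite -ltnS.
rewrite [leRHS](@big_cat_nat _ _ _ N0.+1)//= ?lerDr ?sumr_ge0//.
exact: ltnW.
Qed.

Lemma log_limit : ((1 / (- ln eps))%:E * F eps)%E @[eps --> 0^'+] --> (1 / gam)%:E.
Proof.
have [C hC] := F_le.
have Ffin eps : 0 < eps < 1 -> F eps \is a fin_num.
  by move=> /hC h; rewrite ge0_fin_numE// (le_lt_trans h)// ltry.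
have big (B : R) : \forall eps \near 0^'+, 0 < eps < 1 /\ B <= - ln eps.
  near=> eps; have e0 : 0 < eps by [].
  split.
    by rewrite e0/=; near: eps; exact: nbhs_right_lt.
  rewrite lerNr -[leRHS]expRK ler_ln ?posrE ?expR_gt0//.
  by near: eps; apply: nbhs_right_le; exact: expR_gt0.
apply: cvg_EFin.
  by near=> eps; rewrite fin_numM// Ffin//; near: eps; apply: filterS (big 0) => t [].
apply/cvgrPdist_le => e e0.
(* In the lower bound half of [e] pays for [eta / gam] and half for the constant of [F_ge] divided
   by [- ln eps]; the minimum with 1/2 keeps [eta < 1]. *)
pose eta := Num.min 2^-1 (e * gam / 2).
have eta0 : 0 < eta by rewrite lt_min invr_gt0 ltr0n/= divr_gt0// mulr_gt0.
have eta1 : 0 < eta < 1.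
  by rewrite eta0/= gt_min (_ : 2^-1 < 1)// invf_lt1// ltr1n.
have [D hD] := F_ge eta1.
pose B := `|C| / e + `|D| * 2 / e + 1.
near=> eps.
have [e01 Bl] : 0 < eps < 1 /\ B <= - ln eps by near: eps; exact: big.
have /andP[ep0 ep1] := e01.
set l := - ln eps in Bl *.
have B0 : 0 < B by rewrite ltr_wpDl// addr_ge0// divr_ge0 ?mulr_ge0 ?(ltW e0).
have l0 : 0 < l by exact: lt_le_trans Bl.
pose f := fine (F eps).
have FE : F eps = f%:E by rewrite /f fineK// Ffin.
have fle : f <= l / gam + C by rewrite -lee_fin -FE; exact: hC.
have fge : (1 - eta) * (l / gam - D) <= f by rewrite -lee_fin -FE; exact: hD.
rewrite /= FE -EFinM /= div1r.
have Cl : C / l <= e.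
  rewrite ler_pdivrMr// (le_trans (ler_norm _))// -ler_pdivrMl// mulrC.
  by apply: le_trans Bl; rewrite /B -addrA lerDl addr_ge0// divr_ge0 ?mulr_ge0 ?(ltW e0).
have Dl : `|D| / l <= e / 2.
  rewrite ler_pdivrMr// mulrAC ler_pdivlMr// -ler_pdivrMl// mulrC.
  apply: le_trans Bl; rewrite /B.
  have : 0 <= `|C| / e by rewrite divr_ge0 ?(ltW e0).
  lra.
have li : 0 < l^-1 by rewrite invr_gt0.
have gi : 0 < gam^-1 by rewrite invr_gt0.
have up : l^-1 * f <= gam^-1 + C / l.
  by rewrite mulrC ler_pdivrMr// mulrDl divfK ?gt_eqF// mulrC.
have lo : (1 - eta) * (gam^-1 - D / l) <= l^-1 * f.
  rewrite [leRHS]mulrC ler_pdivlMr// (_ : _ * l = (1 - eta) * (l / gam - D))//.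
  by field; rewrite !gt_eqF.
have etag : eta / gam <= e / 2.
  by rewrite ler_pdivrMr// mulrAC /eta ge_min lexx orbT.
rewrite -/l (div1r l) ler_norml; apply/andP; split; first by lra.
have : (1 - eta) * (D / l) <= e / 2.
  apply: (@le_trans _ _ (1 * (`|D| / l))); last by rewrite mul1r.
  apply: (@le_trans _ _ ((1 - eta) * (`|D| / l))).
    by rewrite ler_wpM2l ?ler_wpM2r ?ler_norm ?ltW//; lra.
  by apply: ler_wpM2r; [rewrite divr_ge0 ?(ltW l0)|lra].
have : (1 - eta) * gam^-1 = gam^-1 - eta / gam by ring.
rewrite mulrBr in lo; lra.
Unshelve. all: end_near. Qed.

End log_limit.

(** * Covariances of the truncated moving average *)

Definition idist (i j : nat) : nat := (i - j + (j - i))%N.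

Section finite_sums.
Context {R : realType}.

Lemma ler_sum_range (g : nat -> R) (a b n N : nat) : (forall k, 0 <= g k) -> (a <= b)%N -> (n <= N)%N ->
  \sum_(b <= k < n) g k <= \sum_(a <= k < N) g k.
Proof.
move=> g0 ab nN; have [nb|bn] := leqP n b; first by rewrite big_geq// sumr_ge0.
have aN := leq_trans ab (leq_trans (ltnW bn) nN).
rewrite [leRHS](@big_cat_nat _ _ _ b)//=; last exact: leq_trans (ltnW bn) nN.
rewrite [X in _ <= _ + X](@big_cat_nat _ _ _ n)//=; last exact: ltnW.
by rewrite addrCA lerDl addr_ge0// sumr_ge0.
Qed.

(** For a fixed row, each distance is attained at most once on either side of the diagonal. *)
Lemma sum_idist_le (g : nat -> R) N : (forall k, 0 <= g k) ->
  \sum_(i < N) \sum_(j < N) g (idist i j) <= 2 * N%:R * \sum_(0 <= k < N) g k.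
Proof.
move=> g0.
have -> : 2 * N%:R * \sum_(0 <= k < N) g k = \sum_(i < N) (2 * \sum_(0 <= k < N) g k).
  by rewrite sumr_const card_ord -[RHS]mulr_natr; ring.
apply: ler_sum => -[i iN] _ /=.
rewrite -(big_mkord xpredT (fun j => g (idist i j))) (@big_cat_nat _ _ _ i)//=; last exact: ltnW.
rewrite mulr2n mulrDl mul1r; apply: lerD.
  rewrite big_nat_rev/= (eq_big_nat _ _ (F2 := fun j => g (j + 1)%N)); last first.
    by move=> j /andP[_ ji]; rewrite /idist; congr g; lia.
  have -> : \sum_(0 <= j < i) g (j + 1)%N = \sum_(1 <= j < i.+1) g j.
    by rewrite -[1%N]add0n big_addn subn1.
  exact: ler_sum_range.
rewrite (eq_big_nat _ _ (F2 := fun j => g (j - i)%N)); last first.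
  by move=> j /andP[ij _]; rewrite /idist; congr g; lia.
rewrite -{1}[i]add0n big_addn (eq_bigr g) => [|j _]; last by rewrite addnK.
by apply: ler_sum_range => //; exact: leq_subr.
Qed.

Lemma subrX_le (a b : R) q : 0 <= b -> b <= a -> a <= 1 -> a ^+ q - b ^+ q <= q%:R * (a - b).
Proof.
move=> b0 ba a1; have a0 := le_trans b0 ba.
elim: q => [|q IH]; first by rewrite !expr0 subrr mul0r.
have -> : a ^+ q.+1 - b ^+ q.+1 = a * (a ^+ q - b ^+ q) + (a - b) * b ^+ q by rewrite !exprS; ring.
rewrite -[q.+1%:R]natr1 [leRHS]mulrDl mul1r; apply: lerD.
  apply: le_trans IH; rewrite ler_piMl// subr_ge0 lerXn2r ?nnegrE//.
by rewrite ler_piMr ?subr_ge0// exprn_ile1// (le_trans ba).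
Qed.

End finite_sums.

Section moving_average_weights.
Context {R : realType}.
Variable beta : R.
Hypothesis hbeta : 1 / 2 < beta < 1.
Let a0 := 2 * beta - 1.
Let a0_gt0 : 0 < a0. Proof. by rewrite /a0; case/andP: hbeta; lra. Qed.
Let b0 : 0 < 1 - beta <= 1. Proof. by case/andP: hbeta; lra. Qed.
Local Notation kap := (kappa beta).
Local Notation al := (alpha beta).

Let Z (n : nat) : R := \sum_(1 <= j < n.+1) j%:R `^ (- (2 * beta)).

Let Z_le n : Z n <= 1 + a0^-1.
Proof.
rewrite /Z; case: n => [|n]; first by rewrite big_geq// addr_ge0// invr_ge0 ltW.
rewrite big_ltn// powR1 lerD2l.
have := @powR_tail R a0 1 n.+2 a0_gt0 isT; rewrite powR1 div1r.
by rewrite (_ : 1 + a0 = 2 * beta)// /a0; ring.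
Qed.

Let Z_nd : nondecreasing_seq Z.
Proof.
by move=> m n mn; apply: ler_sum_range => // k; exact: powR_ge0.
Qed.

Let Z_cvg : Z @ \oo --> limn Z.
Proof.
apply: nondecreasing_is_cvgn => //; exists (1 + a0^-1) => _ [n _ <-]; exact: Z_le.
Qed.

Let Z_le_lim n : Z n <= limn Z.
Proof. by apply: nondecreasing_cvgn_le => //; apply: cvgP Z_cvg. Qed.

Let limZ_ge1 : 1 <= limn Z.
Proof. by apply: le_trans (Z_le_lim 1); rewrite /Z big_nat1 powR1. Qed.

Let limZ_gt0 : 0 < limn Z. Proof. exact: lt_le_trans limZ_ge1. Qed.

Lemma kappa_gt0 : 0 < kap.
Proof. exact: powR_gt0. Qed.

Let kap2 : kap ^+ 2 * limn Z = 1.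
Proof.
rewrite /kappa -/Z -powR_mulrn ?powR_ge0// -powRrM.
rewrite (_ : - (1 / 2) * 2%:R = -1); last by field.
by rewrite powR_inv1 ?(ltW limZ_gt0)// mulVf// gt_eqF.
Qed.

Lemma alpha0 : al 0 = 0.
Proof.
rewrite /alpha powR0 ?mulr0// oppr_eq0 gt_eqF//; case/andP: hbeta; lra.
Qed.

Lemma alpha_ge0 i : 0 <= al i.
Proof. by rewrite mulr_ge0 ?powR_ge0 ?(ltW kappa_gt0). Qed.

Lemma alpha_le i j : (0 < i)%N -> (i <= j)%N -> al j <= al i.
Proof.
move=> i0 ij; rewrite ler_wpM2l ?(ltW kappa_gt0)// !powRN lef_pV2 ?posrE ?powR_gt0 ?ltr0n//.
  by apply: le_powR; rewrite ?ler_nat//; case/andP: hbeta; lra.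
exact: leq_trans ij.
Qed.

Lemma alpha_sqr i : (0 < i)%N -> al i ^+ 2 = kap ^+ 2 * i%:R `^ (- (1 + a0)).
Proof.
move=> i0; rewrite /alpha exprMn; congr *%R; rewrite expr2 -powR_add ?ltr0n//.
by congr (_ `^ _); rewrite /a0; ring.
Qed.

Definition trunc_alpha m i : R := if (i <= m)%N then al i else 0.

Definition trunc_var m : R := \sum_(1 <= i < m.+1) al i ^+ 2.

(* For [p <= b] the truncated difference [p - b] is 0, where [alpha] vanishes because
   [0 `^ (- beta) = 0]. *)
Definition weights m b (p : nat) : R := trunc_alpha m (p - b).

Lemma trunc_alpha_ge0 m i : 0 <= trunc_alpha m i.
Proof. by rewrite /trunc_alpha; case: ifP => // _; exact: alpha_ge0. Qed.

Lemma trunc_alpha_le m i : trunc_alpha m i <= al i.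
Proof. by rewrite /trunc_alpha; case: ifP => // _; exact: alpha_ge0. Qed.

Lemma trunc_alpha_mono m M i : (m <= M)%N -> trunc_alpha m i <= trunc_alpha M i.
Proof.
move=> mM; rewrite /trunc_alpha; case: ifP => [im|_]; first by rewrite (leq_trans im).
by case: ifP => // _; exact: alpha_ge0.
Qed.

Lemma trunc_varE m : trunc_var m = kap ^+ 2 * Z m.
Proof.
rewrite /trunc_var /Z mulr_sumr big_nat_cond [RHS]big_nat_cond.
apply: eq_bigr => i /andP[/andP[i0 _] _]; rewrite alpha_sqr//.
by congr (_ * _ `^ _); rewrite /a0; ring.
Qed.

Lemma trunc_var_le1 m : trunc_var m <= 1.
Proof. by rewrite trunc_varE -kap2 ler_wpM2l ?sqr_ge0. Qed.

Lemma trunc_var_ge m : (0 < m)%N -> kap ^+ 2 <= trunc_var m.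
Proof.
move=> m0; rewrite trunc_varE ler_peMr ?sqr_ge0//.
have -> : 1 = Z 1 by rewrite /Z big_nat1 powR1.
exact: Z_nd.
Qed.

Lemma cvg_trunc_var : trunc_var @ \oo --> (1 : R).
Proof.
rewrite (_ : trunc_var = fun m => kap ^+ 2 * Z m); last by apply/funext => m; exact: trunc_varE.
by rewrite -[X in _ --> X]kap2; apply: cvgMr; exact: Z_cvg.
Qed.

(** Shift by the larger index [b']; the terms up to [b'] vanish because the second weight is there
    [alpha 0 = 0]. *)
Lemma dot_weightsE K m m' b b' : (b <= b')%N -> (b' < K)%N ->
  dot K (weights m b) (weights m' b') =
  \sum_(1 <= i < K - b') trunc_alpha m (i + (b' - b)) * trunc_alpha m' i.
Proof.
move=> bb bK; rewrite /dot -(big_mkord xpredT (fun p => weights m b p * weights m' b' p)).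
rewrite (@big_cat_nat _ _ _ b'.+1)//= big_nat_cond big1 ?add0r; last first.
  move=> p /andP[/andP[_ pb] _]; rewrite {2}/weights (_ : (p - b' = 0)%N); last by lia.
  by rewrite /trunc_alpha /= alpha0 mulr0.
rewrite -[b'.+1]add1n big_addn big_nat_cond [RHS]big_nat_cond.
apply: eq_bigr => i /andP[/andP[i1 _] _].
by rewrite /weights addnK; congr (trunc_alpha _ _ * _); lia.
Qed.

Lemma dot_weights_self K m b : (m < K - b)%N ->
  dot K (weights m b) (weights m b) = trunc_var m.
Proof.
move=> mK; rewrite dot_weightsE//; last by lia.
rewrite (@big_cat_nat _ _ _ m.+1)//= [X in _ + X]big_nat_cond [X in _ + X]big1 ?addr0; last first.
  move=> i /andP[/andP[mi _] _]; rewrite {2}/trunc_alpha leqNgt mi/= mulr0//.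
rewrite big_nat_cond [RHS]big_nat_cond; apply: eq_bigr => i /andP[/andP[_ im] _].
by rewrite subnn addn0 /trunc_alpha -ltnS im expr2.
Qed.

Lemma dot_weights_ge0 K m m' b b' : 0 <= dot K (weights m b) (weights m' b').
Proof. by apply: sumr_ge0 => p _; rewrite mulr_ge0 ?trunc_alpha_ge0. Qed.

Lemma dot_weights_mono K m1 m2 M1 M2 b b' : (m1 <= M1)%N -> (m2 <= M2)%N ->
  dot K (weights m1 b) (weights m2 b') <= dot K (weights M1 b) (weights M2 b').
Proof.
by move=> h1 h2; apply: ler_sum => p _; rewrite ler_pM ?trunc_alpha_ge0// trunc_alpha_mono.
Qed.

Lemma dot_le_self K (x y : nat -> R) s : dot K x x = s -> dot K y y = s -> dot K x y <= s.
Proof.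
move=> xs ys; rewrite -[leRHS](_ : (dot K x x + dot K y y) / 2 = s); last by rewrite xs ys; field.
rewrite ler_pdivlMr// /dot -big_split/= mulr_suml; apply: ler_sum => i _.
have := sqr_ge0 (x i - y i); rewrite expr2; lra.
Qed.

Definition corr_const : R := kap ^+ 2 * (2 / (1 - beta) + (2 * beta - 1)^-1).

Definition corr_bound (k : nat) : R :=
  if k == 0%N then 1 else corr_const * k%:R `^ (- (2 * beta - 1)).

Lemma corr_const_ge0 : 0 <= corr_const.
Proof.
rewrite mulr_ge0 ?sqr_ge0// addr_ge0//; first by rewrite divr_ge0//; case/andP: b0 => /ltW.
by rewrite invr_ge0 ltW.
Qed.

Lemma corr_bound_ge0 k : 0 <= corr_bound k.
Proof. by rewrite /corr_bound; case: eqP => // _; rewrite mulr_ge0 ?corr_const_ge0 ?powR_ge0. Qed.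

(** At lag [k] the sum is split at [i = k]. For [i <= k], [alpha (i + k) <= alpha k] and the sum of
    [i^(-beta)] is of order [k^(1 - beta)]; for [i > k], [alpha (i + k) <= alpha i] leaves the tail
    of [i^(-2 beta)]. Both are of order [k^(1 - 2 beta)] and give the two summands of
    [corr_const]. *)
Lemma dot_weights_bound K m m' b b' : (b < b')%N -> (b' < K)%N ->
  dot K (weights m b) (weights m' b') <= corr_const * (b' - b)%:R `^ (- a0).
Proof.
move=> bb bK; rewrite dot_weightsE ?(ltnW bb)//; set k := (b' - b)%N.
have k0 : (0 < k)%N by rewrite subn_gt0.
have kR : 0 < k%:R :> R by rewrite ltr0n.
set I := (K - b')%N.
have t0 i : 0 <= al (i + k) * al i by rewrite mulr_ge0 ?alpha_ge0.
(* The range is enlarged so that it reaches [k] and can be split there. *)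
apply: (@le_trans _ _ (\sum_(1 <= i < maxn I k.+1) al (i + k) * al i)).
  apply: (@le_trans _ _ (\sum_(1 <= i < I) al (i + k) * al i)).
    by apply: ler_sum => i _; rewrite ler_pM ?trunc_alpha_ge0 ?trunc_alpha_le.
  by apply: ler_sum_range => //; exact: leq_maxl.
rewrite (@big_cat_nat _ _ _ k.+1)//= ?leq_maxr//.
have h1 : \sum_(1 <= i < k.+1) al (i + k) * al i <= kap ^+ 2 * (2 / (1 - beta)) * k%:R `^ (- a0).
  apply: (@le_trans _ _ (\sum_(1 <= i < k.+1) kap ^+ 2 * k%:R `^ (- beta) * i%:R `^ ((1 - beta) - 1))).
    rewrite big_nat_cond [leRHS]big_nat_cond; apply: ler_sum => i /andP[/andP[i0 _] _].
    rewrite [leRHS](_ : _ = al k * al i).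
      by rewrite ler_wpM2r ?alpha_ge0// alpha_le// leq_addl.
    rewrite /alpha (_ : 1 - beta - 1 = - beta); last by ring.
    by ring.
  rewrite -mulr_sumr (le_trans (ler_wpM2l _ (powR_head k b0)))//.
    by rewrite mulr_ge0 ?sqr_ge0 ?powR_ge0.
  rewrite [leLHS](_ : _ = kap ^+ 2 * (2 / (1 - beta)) * (k%:R `^ (- beta) * k%:R `^ (1 - beta))); last by ring.
  by rewrite -powR_add// (_ : - beta + (1 - beta) = - a0)// /a0; ring.
have h2 : \sum_(k.+1 <= i < maxn I k.+1) al (i + k) * al i <= kap ^+ 2 * a0^-1 * k%:R `^ (- a0).
  apply: (@le_trans _ _ (\sum_(k.+1 <= i < maxn I k.+1) kap ^+ 2 * i%:R `^ (- (1 + a0)))).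
    rewrite big_nat_cond [leRHS]big_nat_cond; apply: ler_sum => i /andP[/andP[ki _] _].
    have i0 : (0 < i)%N by exact: leq_trans ki.
    by rewrite -alpha_sqr// expr2 ler_wpM2r ?alpha_ge0// alpha_le// leq_addr.
  rewrite -mulr_sumr (le_trans (ler_wpM2l _ (powR_tail _ a0_gt0 k0))) ?sqr_ge0//.
  by rewrite (mulrC (k%:R `^ _)) mulrA.
by rewrite /corr_const mulrDr mulrDl lerD.
Qed.

Lemma dot_weights_le K m m' b b' : (m < K - b)%N -> (m' < K - b')%N -> (b < K)%N -> (b' < K)%N ->
  dot K (weights m b) (weights m' b') <= corr_bound (idist b b').
Proof.
move=> mK mK' bK bK'; rewrite /corr_bound /idist.
case: (ltngtP b b') => [bb|bb|bb].
- rewrite (_ : b - b' = 0)%N ?add0n; last by lia.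
  rewrite subn_eq0 leqNgt bb/=; exact: dot_weights_bound.
- rewrite (_ : b' - b = 0)%N ?addn0; last by lia.
  rewrite subn_eq0 leqNgt bb/= dotC; exact: dot_weights_bound.
- rewrite -bb in bK' mK' *; rewrite subnn /=.
  (* On the diagonal both truncations are raised to the larger one, where the product is a
     variance. *)
  apply: (@le_trans _ _ (dot K (weights (maxn m m') b) (weights (maxn m m') b))).
    by apply: dot_weights_mono; rewrite ?leq_maxl ?leq_maxr.
  by rewrite dot_weights_self ?trunc_var_le1// gtn_max mK mK'.
Qed.

Lemma dot_weights_far K m b b' : (b < K)%N -> (b' < K)%N -> ~~ near_idx m b b' ->
  dot K (weights m b) (weights m b') = 0.
Proof.
have far c c' : (c < K)%N -> (c' < K)%N -> (c + m < c')%N -> dot K (weights m c) (weights m c') = 0.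
  move=> cK cK' cc; rewrite dot_weightsE//; last by lia.
  rewrite big_nat_cond big1// => i /andP[/andP[i1 _] _].
  by rewrite {1}/trunc_alpha ifF ?mul0r//; lia.
move=> bK bK'; rewrite negb_and -!ltnNge => /orP[h|h]; last exact: far.
by rewrite dotC; exact: far.
Qed.

(** At lag [k] the products with [i + k <= m] are untouched by either truncation, so the difference
    only involves [i > m - k] and is a tail of the squared weights. *)
Lemma dot_weights_diff K m M b b' : (m <= M)%N -> (b < K)%N -> (b' < K)%N -> (idist b b' < m)%N ->
  dot K (weights M b) (weights M b') - dot K (weights m b) (weights m b') <=
  kap ^+ 2 / a0 * (m - idist b b')%:R `^ (- a0).
Proof.
move=> mM; wlog bb : b b' / (b <= b')%N => [W bK bK' d|bK bK'].
  case/orP: (leq_total b b') => bb; first exact: W.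
  by rewrite (dotC K (weights M b)) (dotC K (weights m b)) /idist addnC W// /idist addnC.
rewrite /idist (_ : b - b' = 0)%N ?add0n; last by lia.
set k := (b' - b)%N => km.
rewrite !dot_weightsE// -/k -sumrB; set I := (K - b')%N.
have L0 : (0 < m - k)%N by rewrite subn_gt0.
apply: (@le_trans _ _ (\sum_((m - k).+1 <= i < maxn I (m - k).+1) kap ^+ 2 * i%:R `^ (- (1 + a0)))); last first.
  rewrite -mulr_sumr (le_trans (ler_wpM2l _ (powR_tail _ a0_gt0 L0))) ?sqr_ge0//.
  by rewrite (mulrC (_ `^ _)) mulrA.
pose g i : R := if (m - k < i)%N then kap ^+ 2 * i%:R `^ (- (1 + a0)) else 0.
have g0 i : 0 <= g i by rewrite /g; case: ifP => // _; rewrite mulr_ge0 ?sqr_ge0 ?powR_ge0.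
apply: (@le_trans _ _ (\sum_(1 <= i < maxn I (m - k).+1) g i)).
  apply: (@le_trans _ _ (\sum_(1 <= i < I) g i)); last by apply: ler_sum_range => //; exact: leq_maxl.
  rewrite big_nat_cond [leRHS]big_nat_cond; apply: ler_sum => i /andP[/andP[i1 _] _].
  rewrite /g; case: ltnP => h.
    apply: (@le_trans _ _ (al (i + k) * al i)).
      rewrite lerBlDr (le_trans (y := al (i + k) * al i))//.
        by rewrite ler_pM ?trunc_alpha_ge0 ?trunc_alpha_le.
      by rewrite lerDl mulr_ge0 ?trunc_alpha_ge0.
    by rewrite -alpha_sqr// expr2 ler_wpM2r ?alpha_ge0// alpha_le// leq_addr.
  have ik : (i + k <= m)%N by lia.
  rewrite /trunc_alpha ik (leq_trans ik mM) (leq_trans _ ik) ?leq_addr//.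
  by rewrite (leq_trans _ (leq_trans ik mM)) ?leq_addr// subrr.
rewrite (@big_cat_nat _ _ _ (m - k).+1)//= ?leq_maxr//.
rewrite big_nat_cond big1 ?add0r; last by move=> i /andP[/andP[_ h] _]; rewrite /g ltnNge -ltnS h.
by rewrite big_nat_cond [leRHS]big_nat_cond; apply: ler_sum => i /andP[/andP[h _] _]; rewrite /g h.
Qed.

End moving_average_weights.

(** * Sums of covariance powers and Hermite asymptotics *)

Lemma powR_pow (R : realType) (x r : R) n : (x `^ r) ^+ n = x `^ (r * n%:R).
Proof. by rewrite powRrM powR_mulrn ?powR_ge0. Qed.

Section correlation_sums.
Context {R : realType}.
Variable beta : R.
Hypothesis hbeta : 1 / 2 < beta < 1.
Local Notation a0 := (2 * beta - 1).

Let corr_boundX q k : (0 < k)%N ->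
  corr_bound beta k ^+ q = corr_const beta ^+ q * k%:R `^ (- (a0 * q%:R)).
Proof.
move=> k0; rewrite /corr_bound gtn_eqF// exprMn powR_pow.
by congr (_ * _ `^ _); ring.
Qed.

Lemma corr_tail_short q e : 1 < a0 * q%:R -> 0 < e ->
  exists2 k1, (0 < k1)%N & forall N, \sum_(k1 <= k < N) corr_bound beta k ^+ q <= e.
Proof.
move=> aq e0; pose a := a0 * q%:R - 1; have a_gt0 : 0 < a by rewrite /a subr_gt0.
pose D := corr_const beta ^+ q / a.
have D0 : 0 <= D by rewrite divr_ge0 ?(ltW a_gt0)// exprn_ge0// corr_const_ge0.
(* Chosen so that [D k^(-a) <= e] for [k >= y]; [D + 1] keeps the base positive when [D = 0]. *)
pose y := ((D + 1) / e) `^ a^-1.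
have De : 0 < (D + 1) / e by rewrite divr_gt0// ltr_wpDl.
have y0 : 0 < y by exact: powR_gt0.
exists (Num.truncn y).+2 => // N.
have yk : y <= (Num.truncn y).+1%:R by have /andP[_ /ltW] := truncn_itv (ltW y0).
set k := (Num.truncn y).+1 in yk *.
have k0 : 0 < k%:R :> R by rewrite ltr0n.
have -> : \sum_(k.+1 <= i < N) corr_bound beta i ^+ q =
    corr_const beta ^+ q * \sum_(k.+1 <= i < N) i%:R `^ (- (1 + a)).
  rewrite mulr_sumr big_nat_cond [RHS]big_nat_cond; apply: eq_bigr => i /andP[/andP[ki _] _].
  rewrite corr_boundX; last exact: leq_trans ki.
  by congr (_ * _ `^ _); rewrite /a; ring.
apply: (@le_trans _ _ (corr_const beta ^+ q * (k%:R `^ (- a) / a))).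
  by rewrite ler_wpM2l ?exprn_ge0 ?corr_const_ge0// powR_tail.
rewrite mulrA mulrAC -/D powRN ler_pdivrMr ?powR_gt0// mulrC -ler_pdivrMr//.
apply: (@le_trans _ _ (y `^ a)); last by apply: le_powR => //; exact: ltW.
rewrite -powRrM mulVf ?gt_eqF// powRr1 ?(ltW De)// ler_wpM2r ?invr_ge0 ?(ltW e0)//.
by rewrite lerDl.
Qed.

Lemma corr_sum_short q : 1 < a0 * q%:R ->
  exists C, forall N, \sum_(0 <= k < N) corr_bound beta k ^+ q <= C.
Proof.
move=> aq; have [k1 k10 h] := corr_tail_short aq ltr01.
exists (\sum_(0 <= k < k1) corr_bound beta k ^+ q + 1) => N.
have g0 k : 0 <= corr_bound beta k ^+ q by rewrite exprn_ge0// corr_bound_ge0.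
apply: (@le_trans _ _ (\sum_(0 <= k < maxn N k1) corr_bound beta k ^+ q)).
  by apply: ler_sum_range => //; exact: leq_maxl.
by rewrite (@big_cat_nat _ _ _ k1)//= ?leq_maxr// lerD2l.
Qed.

Lemma corr_sum_long p : a0 * p%:R < 1 -> exists2 C, 0 <= C & forall N, (0 < N)%N ->
  \sum_(0 <= k < N) corr_bound beta k ^+ p <= C * N%:R `^ (1 - a0 * p%:R).
Proof.
move=> ap; pose c := 1 - a0 * p%:R.
have a0_ge0 : 0 <= a0 by case/andP: hbeta; lra.
have c01 : 0 < c <= 1 by rewrite /c subr_gt0 ap /= gerBl mulr_ge0.
have /andP[c0 _] := c01.
have C0 : 0 <= corr_const beta ^+ p by rewrite exprn_ge0 ?corr_const_ge0.
exists (1 + corr_const beta ^+ p * (2 / c)).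
  by rewrite addr_ge0// mulr_ge0// divr_ge0 ?ltW.
move=> [//|N] _; rewrite big_ltn// {1}/corr_bound eqxx expr1n mulrDl mul1r; apply: lerD.
  rewrite -/c -[leLHS](powRr0 N.+1%:R) ler_powR ?(ltW c0)// ler1n//.
have -> : \sum_(1 <= k < N.+1) corr_bound beta k ^+ p =
    corr_const beta ^+ p * \sum_(1 <= k < N.+1) k%:R `^ (c - 1).
  rewrite mulr_sumr big_nat_cond [RHS]big_nat_cond; apply: eq_bigr => i /andP[/andP[i0 _] _].
  by rewrite corr_boundX//; congr (_ * _ `^ _); rewrite /c; ring.
rewrite -mulrA ler_wpM2l// (le_trans (powR_head N c01))// ler_wpM2l ?divr_ge0 ?(ltW c0)//.
by apply: le_powR => //; rewrite ?(ltW c0)// ler_nat.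
Qed.

End correlation_sums.

Section hermite_polynomials.
Context {R : realType}.

(** The monic Hermite polynomials, generated by the creation operator that arises when the Gaussian
    is differentiated; the normalization by [q!] comes in [hermite_herm]. *)
Fixpoint hermite_poly (q : nat) : {poly R} :=
  if q is q'.+1 then 'X * hermite_poly q' - (hermite_poly q')^`() else 1.

Lemma horner_hermite_polyS q (x : R) :
  (hermite_poly q.+1).[x] = x * (hermite_poly q).[x] - (hermite_poly q)^`().[x].
Proof. by rewrite /= hornerD hornerN mulrC hornerMX mulrC. Qed.

Lemma derive1n_gauss q (x : R) :
  derive1n q (fun y : R => expR (- (y ^+ 2 / 2))) x =
  (-1) ^+ q * (hermite_poly q).[x] * expR (- (x ^+ 2 / 2)).
Proof.
elim: q x => [|q IH] x; first by rewrite derive1n0 expr0 hornerC !mul1r.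
rewrite derive1nS.
rewrite (_ : derive1n q _ = fun y => (-1) ^+ q * (hermite_poly q).[y] * expR (- (y ^+ 2 / 2))); last first.
  by apply/funext => y; exact: IH.
rewrite derive1E.
have h1 : is_derive x (1 : R) (horner (hermite_poly q)) (hermite_poly q)^`().[x] by exact: is_derive_poly.
have h2 : is_derive x (1 : R) (fun y : R => expR (- (y ^+ 2 / 2))) (- x * expR (- (x ^+ 2 / 2))).
  by apply: is_derive_eq; rewrite /GRing.scale /=; field.
have h3 : is_derive x (1 : R) (fun y => (-1) ^+ q * (hermite_poly q).[y] * expR (- (y ^+ 2 / 2)))
   ((-1) ^+ q.+1 * (hermite_poly q.+1).[x] * expR (- (x ^+ 2 / 2))).
  apply: is_derive_eq; rewrite horner_hermite_polyS [(-1) ^+ q.+1]exprS /GRing.scale /=; ring.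
by have [_ ->] := h3.
Qed.

Lemma deriv_hermite_poly q : (hermite_poly q.+1)^`() = q.+1%:R *: hermite_poly q.
Proof.
elim: q => [|q IH].
  by rewrite /= mulr1 derivB derivX -polyC1 derivC deriv0 subr0 scale1r polyC1.
have -> : hermite_poly q.+2 = 'X * hermite_poly q.+1 - (hermite_poly q.+1)^`() by [].
rewrite derivB derivM derivX mul1r IH derivZ.
have : hermite_poly q.+1 = 'X * hermite_poly q - (hermite_poly q)^`() by [].
move: (hermite_poly q.+1) (hermite_poly q) => h1 h0 e.
have e2 : q.+1%:R *: h1 = q.+1%:R *: ('X * h0) - q.+1%:R *: h0^`() by rewrite e scalerBr.
by rewrite -scalerAr -[q.+2%:R]natr1 scalerDl scale1r e2 -addrA addrC.
Qed.

(** The derivative formula yields the creation recursion; [deriv_hermite_poly] turns it into the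
    three-term recursion that defines [herm]. *)
Lemma hermite_herm q (x : R) : hermite q x = herm 1 x q.
Proof.
have -> : hermite q x = (hermite_poly q).[x] / q`!%:R.
  rewrite /hermite derive1n_gauss.
  have e1 : (-1) ^+ q * (-1) ^+ q = 1 :> R by rewrite -exprMn mulrNN mulr1 expr1n.
  have e2 : expR (x ^+ 2 / 2) * expR (- (x ^+ 2 / 2)) = 1 by rewrite expRxMexpNx_1.
  rewrite [LHS](_ : _ = ((-1) ^+ q * (-1) ^+ q) * (expR (x ^+ 2 / 2) * expR (- (x ^+ 2 / 2))) * ((hermite_poly q).[x] / q`!%:R)); last by ring.
  by rewrite e1 e2 !mul1r.
suff : (hermite_poly q).[x] / q`!%:R = herm 1 x q /\
    (hermite_poly q.+1).[x] / q.+1`!%:R = herm 1 x q.+1 by case.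
elim: q => [|q [IH1 IH2]].
  split => /=; first by rewrite hornerC fact0 divr1.
  by rewrite -polyC1 derivC subr0 mulr1 hornerX (_ : 1`! = 1)%N// divr1.
split => //; rewrite hermSS -IH1 -IH2 mul1r.
rewrite horner_hermite_polyS deriv_hermite_poly hornerZ.
rewrite [q.+2`!]factS [q.+1`!]factS !natrM.
have n1 : q.+1%:R != 0 :> R by rewrite pnatr_eq0.
have n2 : q.+2%:R != 0 :> R by rewrite pnatr_eq0.
have n3 : q`!%:R != 0 :> R by rewrite pnatr_eq0 -lt0n fact_gt0.
move: n1 n2 n3; move: (q.+1%:R) (q.+2%:R) (q`!%:R) => u v f u0 v0 f0.
move: ((hermite_poly q.+1).[x]) ((hermite_poly q).[x]) => A B.
by field; rewrite f0 u0 v0.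
Qed.

(** Both parameters move, because the truncated average is evaluated at its own variance while the
    limit has variance 1. *)
Lemma herm_lipschitz q (A : R) : 0 <= A -> exists2 C, 0 <= C & forall s x y,
  0 <= s <= 1 -> `|x| <= A -> `|y| <= A ->
  `|herm s x q| <= C /\ `|herm s x q - herm 1 y q| <= C * (`|x - y| + `|1 - s|).
Proof.
move=> A0.
pose Q p C := forall s x y : R, 0 <= s <= 1 -> `|x| <= A -> `|y| <= A ->
  `|herm s x p| <= C /\ `|herm s x p - herm 1 y p| <= C * (`|x - y| + `|1 - s|).
suff : (exists2 C, 0 <= C & Q q C) /\ (exists2 C, 0 <= C & Q q.+1 C) by case.
elim: q => [|q [[C1 C10 h1] [C2 C20 h2]]].
  split.
    by exists 1 => // s x y _ _ _ /=; rewrite subrr normr0 normr1 mul1r addr_ge0.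
  exists (A + 1); first by rewrite addr_ge0.
  move=> s x y _ xA yA /=; split; first by rewrite (le_trans xA)// lerDl.
  rewrite mulrDl mul1r (le_trans (y := `|x - y| + `|1 - s|))// ?lerDl//.
  by rewrite lerDr mulr_ge0// addr_ge0.
split; first by exists C2.
exists (C2 + A * C2 + 2 * C1); first by rewrite !addr_ge0 ?mulr_ge0.
move=> s x y s01 xA yA; have /andP[s0 s1] := s01.
have [h1a h1b] := h1 s x y s01 xA yA; have [h2a h2b] := h2 s x y s01 xA yA.
set D := `|x - y| + `|1 - s| in h1b h2b *.
have D0 : 0 <= D by rewrite addr_ge0.
have v1 : `|q.+2%:R^-1 : R| <= 1 by rewrite ger0_norm ?invr_ge0// invf_le1// ler1n.
have red (u b : R) : `|u| <= b -> `|u / q.+2%:R| <= b.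
  by move=> ub; rewrite normrM (le_trans _ ub)// ler_piMr.
have tri (u1 u2 c1 c2 : R) : `|u1| <= c1 -> `|u2| <= c2 -> `|u1 + u2| <= c1 + c2.
  by move=> k1 k2; rewrite (le_trans (ler_normD _ _))// lerD.
have mul (u1 u2 c1 c2 : R) : `|u1| <= c1 -> `|u2| <= c2 -> `|u1 * u2| <= c1 * c2.
  by move=> k1 k2; rewrite normrM ler_pM.
have ns : `|s| <= 1 by rewrite ger0_norm.
rewrite !hermSS; split.
  apply: (red); rewrite -[leRHS](_ : A * C2 + (1 * C1 + (C2 + C1)) = _); last by ring.
  apply: (@le_trans _ _ (A * C2 + 1 * C1)).
    by apply: (tri); [exact: mul|rewrite normrN; exact: mul].
  by rewrite addrA lerDl addr_ge0.
rewrite -mulrBl; apply: (red).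
have -> : x * herm s x q.+1 - s * herm s x q - (y * herm 1 y q.+1 - 1 * herm 1 y q) =
  (x - y) * herm s x q.+1 + (y * (herm s x q.+1 - herm 1 y q.+1) +
  ((1 - s) * herm s x q + - (herm s x q - herm 1 y q))) by ring.
rewrite -[leRHS](_ : D * C2 + (A * (C2 * D) + (D * C1 + C1 * D)) = _); last by ring.
apply: (tri); first by apply: (mul) => //; rewrite /D lerDl.
apply: (tri); first exact: (mul).
apply: (tri); last by rewrite normrN.
by apply: (mul) => //; rewrite /D lerDr.
Qed.

End hermite_polynomials.

(** * Moments of a limit in probability of variables bounded in L^2 *)

Section uniform_integrability.
Context d (T : measurableType d) (R : realType) (P : probability T R).
Local Notation Pr := (Pr P).

Lemma markov_set (A : set T) (f : T -> R) (c : R) : measurable A -> measurable_fun setT f ->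
  (forall w, 0 <= f w) -> 0 <= c -> (forall w, A w -> c <= f w) ->
  ((c * Pr A)%:E <= \int[P]_w (f w)%:E)%E.
Proof.
move=> mA mf f0 c0 Af; rewrite EFinM -Pr_EFin// -integral_cst//.
apply: (@le_trans _ _ (\int[P]_(w in A) (f w)%:E)%E).
  apply: ge0_le_integral => //.
  apply: measurable_funTS; exact/measurable_EFinP.
apply: ge0_subset_integral => //; first exact/measurable_EFinP.
by move=> w _; rewrite lee_fin.
Qed.

Lemma integral_indicZ (A : set T) (c : R) : measurable A -> 0 <= c ->
  (\int[P]_w (c * \1_A w)%:E = (c * Pr A)%:E)%E.
Proof.
move=> mA c0; under eq_integral do rewrite EFinM.
rewrite ge0_integralZl//.
- by rewrite integral_indic// setIT EFinM; congr (_ * _)%E; exact: Pr_EFin.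
- by apply/measurable_EFinP; exact: measurable_indic.
Qed.

Variables (Z : T -> R) (ZM : nat -> T -> R).
Hypothesis mZ : measurable_fun setT Z.
Hypothesis mZM : forall M, measurable_fun setT (ZM M).
Hypothesis ZM2 : forall M, (\int[P]_w (ZM M w ^+ 2)%:E <= 1)%E.
Hypothesis ZZM : forall t eta : R, 0 < t -> 0 < eta -> exists M,
  Pr [set w | t <= `|Z w - ZM M w|] <= eta.

Let mdiff M : measurable_fun setT (fun w => `|Z w - ZM M w|).
Proof. by apply: measurableT_comp => //; exact: measurable_funB. Qed.

Let mset t M : measurable [set w | t <= `|Z w - ZM M w|].
Proof. exact: measurable_le_set. Qed.

(** A Fatou argument on [min (Z^2, k)]. Where [|Z - ZM| < 1], [Z^2 <= 2 ZM^2 + 2]; elsewhere the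
    integrand is at most [k] on a set of probability at most [1 / (k + 1)]. The total is
    [2 + 2 + 1 = 5], and [k] goes to infinity. *)
Lemma sqr_integral_limit : (\int[P]_w (Z w ^+ 2)%:E <= 5%:E)%E.
Proof.
have mZ2 : measurable_fun setT (fun w => Z w ^+ 2) by exact: measurable_funX.
have bnd (k : nat) : (\int[P]_w (Num.min (Z w ^+ 2) k%:R)%:E <= 5%:E)%E.
  have k1 : 0 < k.+1%:R^-1 :> R by rewrite invr_gt0.
  have [M hM] := ZZM ltr01 k1.
  set A := [set w | 1 <= `|Z w - ZM M w|] in hM.
  have mA : measurable A by exact: mset.
  apply: (@le_trans _ _ (\int[P]_w ((2 * ZM M w ^+ 2)%:E + (2%:E + (k%:R * \1_A w)%:E)))%E).
    apply: ge0_le_integral => //.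
    - by move=> w _; rewrite lee_fin le_min sqr_ge0/=.
    - by apply/measurable_EFinP; apply: measurable_minr.
    - apply: emeasurable_funD; first by apply/measurable_EFinP; apply: measurable_funM => //; exact: measurable_funX.
      apply: emeasurable_funD => //; apply/measurable_EFinP; apply: measurable_funM => //.
    - move=> w _; rewrite -!EFinD lee_fin.
      have [Aw|nAw] := pselect (A w).
        rewrite indicE mem_set// mulr1 (le_trans (y := k%:R))// ?ge_min ?lexx ?orbT//.
        by rewrite addrA lerDr addr_ge0// mulr_ge0// sqr_ge0.
      rewrite indicE memNset// mulr0 addr0 ge_min; apply/orP; left.
      have dl : `|Z w - ZM M w| <= 1 by rewrite leNgt; apply/negP => /ltW.
      have d2 : (Z w - ZM M w) ^+ 2 <= 1 by rewrite -real_normK ?num_real// exprn_ile1.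
      have := sqr_ge0 (Z w - 2 * ZM M w).
      by move: d2; rewrite !expr2; lra.
  rewrite ge0_integralD//; first last.
  - apply: emeasurable_funD => //; apply/measurable_EFinP; apply: measurable_funM => //.
  - by move=> w _; rewrite -EFinD lee_fin addr_ge0// mulr_ge0.
  - by apply/measurable_EFinP; apply: measurable_funM => //; exact: measurable_funX.
  - by move=> w _; rewrite lee_fin mulr_ge0// sqr_ge0.
  rewrite ge0_integralD//; last by apply/measurable_EFinP; apply: measurable_funM.
  rewrite integral_cst// [X in (_ * X)%E]probability_setT mule1 integral_indicZ//.
  have -> : (\int[P]_w (2 * ZM M w ^+ 2)%:E = 2%:E * \int[P]_w (ZM M w ^+ 2)%:E)%E.
    under eq_integral do rewrite EFinM.
    rewrite ge0_integralZl//; last by move=> w _; rewrite lee_fin sqr_ge0.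
    by apply/measurable_EFinP; exact: measurable_funX.
  have -> : 5%:E = (2%:E * 1 + (2%:E + 1%:E) : \bar R)%E by rewrite mule1 -!EFinD; congr EFin; ring.
  apply: leeD; first by rewrite lee_pmul2l.
  rewrite leeD2l// lee_fin (le_trans (ler_wpM2l (ler0n _ _) hM))//.
  by rewrite ler_pdivrMr// mul1r ler_nat.
have lim_min (w : T) : limn (fun k => (Num.min (Z w ^+ 2) k%:R)%:E) = (Z w ^+ 2)%:E.
  apply/cvg_lim => //; apply: cvg_near_cst; near=> k.
  congr EFin; apply/min_idPl; near: k; exact: nbhs_infty_ger.
under eq_integral do rewrite -lim_min.
rewrite monotone_convergence//; first last.
- by move=> w _ k l kl; rewrite lee_fin le_min ge_min lexx/= ge_min ler_nat kl orbT.
- by move=> k w _; rewrite lee_fin le_min sqr_ge0/=.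
- by move=> k; apply/measurable_EFinP; apply: measurable_minr.
apply: lime_le; last exact: nearW.
apply: ereal_nondecreasing_is_cvgn => k l kl; apply: ge0_le_integral => //.
- by move=> w _; rewrite lee_fin le_min sqr_ge0/=.
- by apply/measurable_EFinP; apply: measurable_minr.
- by apply/measurable_EFinP; apply: measurable_minr.
- by move=> w _; rewrite lee_fin le_min ge_min lexx/= ge_min ler_nat kl orbT.
Unshelve. all: end_near. Qed.

Hypothesis iZM : forall M, P.-integrable setT (EFin \o ZM M).
Hypothesis EZM : forall M, \int[P]_w ZM M w = 0.

Lemma integrable_sqr (f : T -> R) C : measurable_fun setT f ->
  (\int[P]_w (f w ^+ 2)%:E <= C%:E)%E ->
  P.-integrable setT (EFin \o (fun w => f w ^+ 2)).
Proof.
move=> mf fC; apply/integrableP; split.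
  by apply/measurable_EFinP; exact: measurable_funX.
under eq_integral => w _ do rewrite /= ger0_norm ?sqr_ge0//.
by rewrite (le_lt_trans fC)// ltry.
Qed.

Lemma integrable_of_sqr (f : T -> R) : measurable_fun setT f ->
  P.-integrable setT (EFin \o (fun w => f w ^+ 2)) -> P.-integrable setT (EFin \o f).
Proof.
move=> mf f2; apply: (@le_integrable _ _ _ _ _ measurableT _ (EFin \o (fun w => 1 + f w ^+ 2))).
- exact/measurable_EFinP.
- move=> w _; rewrite /= lee_fin [leRHS]ger0_norm ?addr_ge0 ?sqr_ge0//.
  have := sqr_ge0 (`|f w| - 1); have := normr_ge0 (f w).
  by rewrite -[f w ^+ 2]real_normK ?num_real// sqrrB expr1n mulr1; lra.
- rewrite (_ : _ \o _ = (fun w => 1%:E + (f w ^+ 2)%:E)%E)//.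
  by apply: integrableD => //; exact: finite_measure_integrable_cst.
Qed.

(** Second moments give uniform integrability: off [A] the difference is below [e / 3], and on [A]
    one uses [u <= del u^2 + 1 / (4 del)]. *)
Lemma mean_limit : \int[P]_w Z w = 0.
Proof.
have iZ2 : P.-integrable setT (EFin \o (fun w => Z w ^+ 2)).
  exact: integrable_sqr sqr_integral_limit.
have iZ := integrable_of_sqr mZ iZ2.
have iZM2 M : P.-integrable setT (EFin \o (fun w => ZM M w ^+ 2)).
  exact: integrable_sqr (ZM2 M).
have EZ2 : \int[P]_w (Z w ^+ 2) <= 5.
  rewrite -lee_fin /Rintegral fineK; first exact: sqr_integral_limit.
  exact: integrable_fin_num iZ2.
have EZM2 M : \int[P]_w (ZM M w ^+ 2) <= 1.
  rewrite -lee_fin /Rintegral fineK; first exact: ZM2.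
  exact: integrable_fin_num (iZM2 M).
apply/eqP; rewrite -normr_le0; apply/ler_addgt0Pl => e e0; rewrite addr0.
(* The quadratic part costs [2 del (5 + 1) = 12 del], which is then [e / 3]; the bound [4 del e / 3]
   on [Pr A] brings the third part to [e / 3] as well. *)
pose del := e / 36; have del0 : 0 < del by rewrite divr_gt0.
have e3 : 0 < e / 3 by rewrite divr_gt0.
have eta0 : 0 < 4 * del * (e / 3) by rewrite !mulr_gt0.
have [M hM] := ZZM e3 eta0; set A := [set w | _] in hM.
have mA : measurable A by exact: mset.
have iD : P.-integrable setT (EFin \o (fun w => Z w - ZM M w)).
  by rewrite (_ : _ \o _ = (fun w => (Z w)%:E - (ZM M w)%:E)%E)//; exact: (integrableB measurableT iZ (iZM M)).
have -> : \int[P]_w Z w = \int[P]_w (Z w - ZM M w) by rewrite RintegralB// EZM subr0.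
apply: (le_trans (le_normr_Rintegral _ iD)) => //.
have iA : P.-integrable setT (EFin \o (fun w => (4 * del)^-1 * \1_A w)).
  rewrite (_ : _ \o _ = (fun w => ((4 * del)^-1)%:E * (\1_A w)%:E)%E)//.
  by apply: integrableZl => //; exact: integrable_indic.
have i2 : P.-integrable setT (EFin \o (fun w => del * 2 * Z w ^+ 2)).
  rewrite (_ : _ \o _ = (fun w => (del * 2)%:E * (Z w ^+ 2)%:E)%E)//.
  exact: integrableZl.
have i3 : P.-integrable setT (EFin \o (fun w => del * 2 * ZM M w ^+ 2)).
  rewrite (_ : _ \o _ = (fun w => (del * 2)%:E * (ZM M w ^+ 2)%:E)%E)//.
  by apply: integrableZl => //; exact: iZM2.
have i1 : P.-integrable setT (EFin \o cst (e / 3)) by exact: finite_measure_integrable_cst.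
have i12 : P.-integrable setT (EFin \o (fun w => e / 3 + del * 2 * Z w ^+ 2)).
  by rewrite (_ : _ \o _ = (fun w => (e / 3)%:E + (del * 2 * Z w ^+ 2)%:E)%E)//; exact: integrableD.
have i123 : P.-integrable setT (EFin \o (fun w => e / 3 + del * 2 * Z w ^+ 2 + del * 2 * ZM M w ^+ 2)).
  by rewrite (_ : _ \o _ = (fun w => (e / 3 + del * 2 * Z w ^+ 2)%:E + (del * 2 * ZM M w ^+ 2)%:E)%E)//; exact: integrableD.
apply: (@le_trans _ _ (\int[P]_w (e / 3 + del * 2 * Z w ^+ 2 + del * 2 * ZM M w ^+ 2 + (4 * del)^-1 * \1_A w))).
  apply: le_Rintegral => //.
  - by rewrite (_ : _ \o _ = abse \o (EFin \o (fun w => Z w - ZM M w)))//; exact: integrable_abse.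
  - by rewrite (_ : _ \o _ = (fun w => (e / 3 + del * 2 * Z w ^+ 2 + del * 2 * ZM M w ^+ 2)%:E + ((4 * del)^-1 * \1_A w)%:E)%E)//; exact: integrableD.
  - move=> w _; have z2 := sqr_ge0 (Z w); have zm2 := sqr_ge0 (ZM M w).
    have dz2 : 0 <= del * 2 * Z w ^+ 2 by apply: mulr_ge0 => //; rewrite mulr_ge0// ltW.
    have dm2 : 0 <= del * 2 * ZM M w ^+ 2 by apply: mulr_ge0 => //; rewrite mulr_ge0// ltW.
    have [Aw|nAw] := pselect (A w); last first.
      rewrite indicE memNset// mulr0 addr0.
      have : `|Z w - ZM M w| <= e / 3 by rewrite leNgt; apply/negP => /ltW.
      lra.
    rewrite indicE mem_set// mulr1.
    set u := `|Z w - ZM M w|.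
    have u1 : u <= del * u ^+ 2 + (4 * del)^-1.
      rewrite -subr_ge0 (_ : _ - _ = del * (u - (2 * del)^-1) ^+ 2); first by rewrite mulr_ge0 ?sqr_ge0 ?(ltW del0).
      by field; rewrite gt_eqF.
    have u2 : u ^+ 2 <= 2 * Z w ^+ 2 + 2 * ZM M w ^+ 2.
      rewrite real_normK ?num_real//; have := sqr_ge0 (Z w + ZM M w); rewrite !expr2; lra.
    have u3 : del * u ^+ 2 <= del * 2 * Z w ^+ 2 + del * 2 * ZM M w ^+ 2.
      by have := ler_wpM2l (ltW del0) u2; rewrite mulrDr !mulrA.
    apply: (le_trans u1); rewrite lerD2r (le_trans u3)// -[leRHS]addrA lerDr ltW//.
rewrite RintegralD// RintegralD// RintegralD// Rintegral_cst// !RintegralZl//; last exact: integrable_indic.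
have -> : \int[P]_x \1_A x = Pr A by rewrite /Rintegral integral_indic// setIT.
have -> : fine (P setT) = 1 by rewrite probability_setT.
rewrite mulr1.
have h1 : del * 2 * \int[P]_w (Z w ^+ 2) <= del * 2 * 5 by rewrite ler_wpM2l// mulr_ge0// ltW.
have h2 : del * 2 * \int[P]_w (ZM M w ^+ 2) <= del * 2 * 1 by rewrite ler_wpM2l ?EZM2// mulr_ge0// ltW.
have h3 : (4 * del)^-1 * Pr A <= e / 3 by rewrite mulrC ler_pdivrMr ?mulr_gt0// mulrC.
have h4 : del * 2 * 5 + del * 2 * 1 = e / 3 by rewrite /del; field.
lra.
Qed.

End uniform_integrability.

(** * Approximation by truncated moving averages *)

Section truncation.
Context (R : realType) (d : measure_display) (T : measurableType d) (P : probability T R).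
Variables (W : R -> {RV P >-> R}) (hW : two_sided_brownian_motion W).
Variables (beta : R) (hbeta : 1 / 2 < beta < 1) (q : nat) (hq : (1 <= q)%N).
Variables (X : nat -> {RV P >-> R}) (hX : is_moving_average W (alpha beta) X).
Local Notation Pr := (Pr P).

Definition increment (t : R) (w : T) : R := W t w - W (t - 1) w.

(* Time runs backwards from [N], so that the weight of the noise variable [p]
   in [X (N - b)] is [alpha (p - b)]. *)
Definition noise K N p (w : T) : R :=
  if (p < K)%N then increment (N%:R - p%:R) w else 0.

Lemma measurable_RV (Y : {RV P >-> R}) : measurable_fun [set: T] Y.
Proof. exact: measurable_funPT. Qed.

Lemma measurable_increment t : measurable_fun [set: T] (increment t).
Proof. by apply: measurable_funB; exact: measurable_RV. Qed.

Lemma iid_noise K N : iid_normal P K (noise K N).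
Proof.
split=> [p|p Kp|p B pK mB|B mB].
- by rewrite /noise; case: (p < K)%N; [exact: measurable_increment|exact: measurable_cst].
- by apply/funext => w; rewrite /noise ltnNge Kp.
- rewrite (_ : _ @^-1` _ = [set w | B (W (N%:R - p%:R) w - W (N%:R - p%:R - 1) w)]); last first.
    by apply/seteqP; split => w; rewrite /noise /= pK.
  rewrite (tsbm_gaussian hW)//; last by rewrite ltrBlDr ltrDl.
  by rewrite opprB addrC subrK sqrtr1.
(* Noise variables are numbered backwards in time, the hypothesis on increments forwards; [rev_ord]
   passes from one to the other. *)
- pose t i : R := N%:R - K%:R + i%:R.
  have t_inc i : (i < K)%N -> t i < t i.+1 by move=> _; rewrite /t ltrD2l ltr_nat.
  have key (i : 'I_K) w : noise K N (rev_ord i) w = W (t i.+1) w - W (t i) w.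
    rewrite /noise ltn_ord /increment /=.
    have e : N%:R - (K - i.+1)%:R = t i.+1 by rewrite /t natrB//; ring.
    by rewrite e; congr (_ - W _ w); rewrite /t -natr1; ring.
  have := tsbm_independent hW t_inc (B := fun i => B (rev_ord i)) (fun i => mB _).
  rewrite [X in X = _ -> _](_ : _ = P [set w | forall i, (i < K)%N -> B i (noise K N i w)]); last first.
    congr (P _); apply/seteqP; split => w /= h.
      move=> i iK; pose j := Ordinal iK.
      have : B (rev_ord (rev_ord j)) (noise K N (rev_ord (rev_ord j)) w) by rewrite key; exact: h.
      by rewrite rev_ordK.
    by move=> i; have := h (rev_ord i) (ltn_ord _); rewrite key.
  move=> ->; rewrite (reindex_inj rev_ord_inj)/=; apply: eq_bigr => i _.
  congr (P _); apply/funext => w; change (B (rev_ord (rev_ord i))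
    (W (t (rev_ord i).+1) w - W (t (rev_ord i)) w) = B i (noise K N i w)).
  by rewrite -key !rev_ordK.
Qed.

Definition partial_average n M (w : T) : R :=
  \sum_(1 <= i < M.+1) alpha beta i * increment (n%:R - i%:R) w.

Lemma dot_noise N M b w : (b <= N)%N ->
  dot (N + M).+1 (weights beta M b) (noise (N + M).+1 N ^~ w) = partial_average (N - b) M w.
Proof.
move=> bN; set K := (N + M).+1.
rewrite /dot -(big_mkord xpredT (fun p => weights beta M b p * noise K N p w)).
rewrite (@big_cat_nat _ _ _ b.+1)//=; last by rewrite /K; lia.
rewrite big_nat_cond big1 ?add0r; last first.
  move=> p /andP[/andP[_ pb] _]; rewrite /weights (_ : (p - b = 0)%N); last by lia.
  by rewrite /trunc_alpha /= alpha0// mul0r.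
rewrite -[b.+1]add1n big_addn (@big_cat_nat _ _ _ M.+1)//=; last by rewrite /K; lia.
rewrite [X in _ + X]big_nat_cond [X in _ + X]big1 ?addr0; last first.
  move=> i /andP[/andP[Mi _] _].
  by rewrite /weights addnK /trunc_alpha leqNgt Mi/= mul0r.
rewrite /partial_average big_nat_cond [RHS]big_nat_cond; apply: eq_bigr => i /andP[/andP[i1 iM] _].
rewrite /weights addnK /trunc_alpha -ltnS iM /noise.
have -> : (i + b < K)%N by rewrite /K; lia.
by congr (_ * increment _ w); rewrite natrB// natrD; ring.
Qed.

(** Taken at the exact variance of the truncation, so that its mean is 0 and its second moment is
    that of the q-th chaos for every [M]. *)
Definition herm_trunc n M (w : T) : R :=
  herm (trunc_var beta M) (partial_average n M w) q.

Lemma herm_truncE N M b w : (b <= N)%N ->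
  herm_trunc (N - b) M w =
  herm (trunc_var beta M) (dot (N + M).+1 (weights beta M b) (noise (N + M).+1 N ^~ w)) q.
Proof. by move=> bN; rewrite dot_noise. Qed.

Let self n M b : (b <= n)%N ->
  dot (n + M).+1 (weights beta M b) (weights beta M b) = trunc_var beta M.
Proof. by move=> bn; apply: dot_weights_self => //; lia. Qed.

Let herm_trunc0 n M : herm_trunc n M =
  (fun w => herm (trunc_var beta M) (dot (n + M).+1 (weights beta M 0) (noise (n + M).+1 n ^~ w)) q).
Proof. by apply/funext => w; rewrite -herm_truncE// subn0. Qed.

Lemma measurable_herm_trunc n M : measurable_fun [set: T] (herm_trunc n M).
Proof.
rewrite herm_trunc0.
exact: (tame_rv (iid_noise (n + M).+1 n) (tame_herm _ (trunc_var beta M) (weights beta M 0) q)).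
Qed.

Lemma integrable_herm_trunc n M : P.-integrable setT (EFin \o herm_trunc n M).
Proof.
rewrite herm_trunc0; apply: (tame_integrable (iid_noise _ _) (g := fun x => herm _ (dot _ _ x) q)).
exact: tame_herm.
Qed.

Lemma mean_herm_trunc n M : \int[P]_w herm_trunc n M w = 0.
Proof.
have := Ex_herm1 (iid_noise (n + M).+1 n) (weights beta M 0) q.-1.
by rewrite prednK// self// herm_trunc0.
Qed.

Lemma sqr_herm_trunc n M : (\int[P]_w (herm_trunc n M w ^+ 2)%:E <= 1)%E.
Proof.
have := Ex_herm2 (iid_noise (n + M).+1 n) (weights beta M 0) (weights beta M 0) (trunc_var beta M) q.
rewrite self// => e.
have t2 : tame (n + M).+1 (fun x : nat -> R => herm (trunc_var beta M) (dot (n + M).+1 (weights beta M 0) x) q ^+ 2).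
  by apply: tameX; exact: tame_herm.
have i2 := tame_integrable (iid_noise (n + M).+1 n) t2.
rewrite -[leLHS]fineK; last first.
  rewrite herm_trunc0; exact: (integrable_fin_num measurableT i2).
rewrite lee_fin.
have -> : fine (\int[P]_w (herm_trunc n M w ^+ 2)%:E)%E = trunc_var beta M ^+ q / q`!%:R.
  by rewrite -e herm_trunc0 /Ex /Rintegral; congr fine; apply: eq_integral.
have s0 : 0 <= trunc_var beta M by apply: sumr_ge0 => i _; exact: sqr_ge0.
rewrite ler_pdivrMr ?ltr0n ?fact_gt0// mul1r (@le_trans _ _ 1)//.
  by rewrite exprn_ile1// trunc_var_le1.
by rewrite ler1n fact_gt0.
Qed.

Lemma measurable_partial_average n M : measurable_fun [set: T] (partial_average n M).
Proof.
apply: measurable_sum => i; apply: measurable_funM => //; exact: measurable_increment.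
Qed.

Lemma partial_average_cvg n t eta : 0 < t -> 0 < eta -> exists M0, forall M, (M0 <= M)%N ->
  Pr [set w | t <= `|X n w - partial_average n M w|] <= eta.
Proof.
move=> t0 eta0; have /fine_cvgP[fin] := hX n.
move=> /cvgrPdist_le /(_ (t ^+ 2 * eta)) /(_ (mulr_gt0 (exprn_gt0 2 t0) eta0)) h.
near \oo => M0.
exists M0 => M M0M.
have fM : 'E_P[(fun w => (X n w - partial_average n M w) ^+ 2)%R]%E \is a fin_num.
  move: M M0M; near: M0; case: fin => N0 _ hN0; exists N0 => // M0 /= NM M MM.
  exact: (hN0 _ (leq_trans NM MM)).
have hM : `|fine 'E_P[(fun w => (X n w - partial_average n M w) ^+ 2)%R]%E| <= t ^+ 2 * eta.
  move: M M0M {fM}; near: M0; case: h => N0 _ hN0; exists N0 => // M0 /= NM M MM.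
  by have := hN0 _ (leq_trans NM MM); rewrite /= sub0r normrN.
have mD : measurable_fun setT (fun w => X n w - partial_average n M w).
  by apply: measurable_funB; [exact: measurable_RV|exact: measurable_partial_average].
have mA : measurable [set w | t <= `|X n w - partial_average n M w|].
  by apply: measurable_le_set => //; exact: measurableT_comp.
rewrite -(ler_pM2l (exprn_gt0 2 t0)); apply: le_trans hM.
apply: le_trans (ler_norm _); rewrite -lee_fin fineK// unlock.
apply: markov_set => //.
- exact: measurable_funX.
- by move=> w; exact: sqr_ge0.
- exact: sqr_ge0.
- by move=> w /= tw; rewrite -[leRHS]real_normK ?num_real// lerXn2r ?nnegrE ?(ltW t0).
Unshelve. all: end_near. Qed.

Lemma mulr_norm_sqr_partial n M : \int[P]_w (partial_average n M w ^+ 2) <= 1.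
Proof.
have := Ex_herm2 (iid_noise (n + M).+1 n) (weights beta M 0) (weights beta M 0) 1 1.
rewrite self//= expr1 (_ : 1`! = 1)%N// divr1 => e.
apply: le_trans (trunc_var_le1 hbeta M); rewrite -e le_eqVlt; apply/orP; left; apply/eqP.
rewrite /Ex; congr Rintegral; apply/funext => w.
by rewrite -[n in partial_average n]subn0 -dot_noise// expr2.
Qed.

Lemma tight n eta : 0 < eta -> exists2 A, 0 < A & Pr [set w | A < `|X n w|] <= eta.
Proof.
move=> eta0; have e2 : 0 < eta / 2 by rewrite divr_gt0.
have [M hM] := partial_average_cvg n ltr01 e2.
have {}hM := hM M (leqnn M).
(* As [A0 >= 1], also [A0^2 >= 2 / eta], so Chebyshev costs at most [eta / 2]. *)
pose A0 := Num.max 1 (2 / eta).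
have A01 : 1 <= A0 by rewrite le_max lexx.
have A0p : 0 < A0 by exact: lt_le_trans A01.
exists (1 + A0); first by rewrite addr_gt0.
have mX := measurable_RV (X n); have mY := measurable_partial_average n M.
have mS1 : measurable [set w | 1 <= `|X n w - partial_average n M w|].
  by apply: measurable_le_set => //; apply: measurableT_comp => //; exact: measurable_funB.
have mS2 : measurable [set w | A0 <= `|partial_average n M w|].
  by apply: measurable_le_set => //; exact: measurableT_comp.
have sub : [set w | 1 + A0 < `|X n w|] `<=`
    [set w | 1 <= `|X n w - partial_average n M w|] `|` [set w | A0 <= `|partial_average n M w|].
  move=> w /= h; have [h1|h1] := leP 1 `|X n w - partial_average n M w|; [by left|right].
  rewrite leNgt; apply/negP => h2.
  have : `|X n w| <= `|X n w - partial_average n M w| + `|partial_average n M w|.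
    by rewrite -{1}(subrK (partial_average n M w) (X n w)) ler_normD.
  lra.
have mS : measurable [set w | 1 + A0 < `|X n w|].
  by apply: measurable_lt_set => //; exact: measurableT_comp.
apply: (le_trans (Pr_le P mS (measurableU _ _ mS1 mS2) sub)).
apply: (le_trans (Pr_setU _ mS1 mS2)); rewrite [leRHS]splitr lerD//.
have pE w : partial_average n M w = dot (n + M).+1 (weights beta M 0) (noise (n + M).+1 n ^~ w).
  by rewrite dot_noise// subn0.
have := Pr_chebyshev (iid_noise (n + M).+1 n) (tame_dot (n + M).+1 (weights beta M 0)) A0p.
rewrite (_ : [set w | _] = [set w | A0 <= `|partial_average n M w|]); last first.
  by apply/seteqP; split => w /=; rewrite pE.
move=> /le_trans; apply.
have -> : Ex P (noise (n + M).+1 n) (fun x => dot (n + M).+1 (weights beta M 0) x ^+ 2) =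
    \int[P]_w (partial_average n M w ^+ 2).
  by rewrite /Ex; congr Rintegral; apply/funext => w; rewrite pE.
have A2 : 0 < A0 ^+ 2 by rewrite exprn_gt0.
rewrite ler_pdivrMr// (le_trans (mulr_norm_sqr_partial _ _))//.
have : 2 / eta <= A0 by rewrite le_max lexx orbT.
rewrite ler_pdivrMr// => h; rewrite mulrAC ler_pdivlMr// mul1r (le_trans h)// mulrC ler_pM2l//.
by rewrite expr2 ler_pMr.
Qed.

Lemma measurable_hermite_X n : measurable_fun [set: T] (fun w => hermite q (X n w)).
Proof.
have mX := measurable_RV (X n); have [Q hQ] := herm_poly (1 : R) q.
rewrite (_ : (fun _ => _) = (fun w => Q.[X n w])); last by apply/funext => w; rewrite hermite_herm hQ.
apply: measurableT_comp => //; apply: continuous_measurable_fun; exact: continuous_horner.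
Qed.

Lemma herm_trunc_cvg n t eta : 0 < t -> 0 < eta -> exists M0, forall M, (M0 <= M)%N ->
  Pr [set w | t <= `|hermite q (X n w) - herm_trunc n M w|] <= eta.
Proof.
move=> t0 eta0; have e2 : 0 < eta / 2 by rewrite divr_gt0.
have [A A0 hA] := tight n e2.
have [C C0 hC] := herm_lipschitz q (addr_ge0 (ltW A0) ler01).
(* The minimum with 1 keeps the truncated average within [A + 1], where the Lipschitz constant [C]
   is valid; the second bound makes the error [2 C th] smaller than [t]. *)
pose th := Num.min 1 (t / (4 * (C + 1))).
have C1 : 0 < C + 1 by rewrite ltr_wpDl.
have th0 : 0 < th by rewrite lt_min ltr01 divr_gt0// mulr_gt0.
have [M1 hM1] := partial_average_cvg n th0 e2.
have := cvg_trunc_var hbeta => /cvgrPdist_le /(_ _ th0)[M2 _ hM2].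
exists (maxn M1 M2) => M; rewrite geq_max => /andP[MM1 MM2].
have mX := measurable_RV (X n); have mY := measurable_partial_average n M.
have mS1 : measurable [set w | A < `|X n w|].
  by apply: measurable_lt_set => //; exact: measurableT_comp.
have mS2 : measurable [set w | th <= `|X n w - partial_average n M w|].
  by apply: measurable_le_set => //; apply: measurableT_comp => //; exact: measurable_funB.
have sub : [set w | t <= `|hermite q (X n w) - herm_trunc n M w|] `<=`
    [set w | A < `|X n w|] `|` [set w | th <= `|X n w - partial_average n M w|].
  move=> w /= tw; have [h1|h1] := ltP A `|X n w|; [by left|right].
  rewrite leNgt; apply/negP => h2.
  have th1 : th <= 1 by rewrite ge_min lexx.
  have Y1 : `|partial_average n M w| <= A + 1.
    have : `|partial_average n M w| <= `|X n w| + `|X n w - partial_average n M w|.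
      rewrite -{1}(subKr (X n w) (partial_average n M w)) (le_trans (ler_normB _ _))//.
    lra.
  have X1 : `|X n w| <= A + 1 by rewrite (le_trans h1)// lerDl.
  have s01 : 0 <= trunc_var beta M <= 1.
    rewrite trunc_var_le1// andbT; apply: sumr_ge0 => i _; exact: sqr_ge0.
  have [_ h3] := hC _ _ _ s01 Y1 X1.
  have h4 : `|1 - trunc_var beta M| <= th by exact: hM2.
  move: tw; rewrite hermite_herm distrC /herm_trunc => tw.
  have h5 := le_trans tw h3.
  have h6 : C * (`|partial_average n M w - X n w| + `|1 - trunc_var beta M|) <= C * (2 * th).
    by rewrite ler_wpM2l// distrC; lra.
  have h7 : 4 * (C + 1) * th <= t.
    by rewrite mulrC -ler_pdivlMr ?mulr_gt0// ge_min lexx orbT.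
  nra.
have mS : measurable [set w | t <= `|hermite q (X n w) - herm_trunc n M w|].
  apply: measurable_le_set => //; apply: measurableT_comp => //; apply: measurable_funB.
    exact: measurable_hermite_X.
  exact: measurable_herm_trunc.
apply: (le_trans (Pr_le P mS (measurableU _ _ mS1 mS2) sub)).
apply: (le_trans (Pr_setU _ mS1 mS2)); rewrite [leRHS]splitr lerD//.
exact: hM1.
Qed.

(** The law of [X n] is only known through its truncations, so the vanishing of the centering is
    obtained as a limit of exact zero means. *)
Lemma mean_hermite n : fine 'E_P[(fun v => hermite q (X n v))%R]%E = 0.
Proof.
rewrite unlock; apply: (@mean_limit _ _ _ P _ (herm_trunc n)).
- exact: measurable_hermite_X.
- exact: measurable_herm_trunc.
- exact: sqr_herm_trunc.
- move=> t eta t0 eta0; have [M0 h] := herm_trunc_cvg n t0 eta0.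
  by exists M0; exact: h.
- exact: integrable_herm_trunc.
- exact: mean_herm_trunc.
Qed.

Definition trunc_sum N M (x : nat -> R) : R :=
  \sum_(b < N) herm (trunc_var beta M) (dot (N + M).+1 (weights beta M b) x) q.

Lemma hermite_sumE N w : hermite_sum q X N w = \sum_(b < N) hermite q (X (N - b)%N w).
Proof.
rewrite /hermite_sum big_nat_rev/= big_add1/= big_mkord; apply: eq_bigr => b _.
by rewrite mean_hermite subr0; congr (hermite q (X _ w)); lia.
Qed.

Lemma measurable_hermite_sum N : measurable_fun [set: T] (hermite_sum q X N).
Proof.
rewrite (_ : hermite_sum q X N = fun w => \sum_(b < N) hermite q (X (N - b)%N w)).
  by apply: measurable_sum => b; exact: measurable_hermite_X.
by apply/funext => w; exact: hermite_sumE.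
Qed.

Lemma Pr_sum_small (u : nat -> nat -> T -> R) : (forall b M, measurable_fun setT (u b M)) ->
  (forall b t eta, 0 < t -> 0 < eta -> exists M0, forall M, (M0 <= M)%N ->
     Pr [set w | t <= `|u b M w|] <= eta) ->
  forall N t eta, 0 < t -> 0 < eta -> exists M0, forall M, (M0 <= M)%N ->
     Pr [set w | t <= `|\sum_(b < N) u b M w|] <= eta.
Proof.
move=> mu hu; elim => [|N IH] t eta t0 eta0.
  exists 0%N => M _; rewrite (_ : [set w | _] = set0) ?/Pr ?measure0 ?ltW//.
  by apply/seteqP; split => // w /=; rewrite big_ord0 normr0 leNgt t0.
have t2 : 0 < t / 2 by rewrite divr_gt0.
have e2 : 0 < eta / 2 by rewrite divr_gt0.
have [M1 h1] := IH _ _ t2 e2; have [M2 h2] := hu N _ _ t2 e2.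
exists (maxn M1 M2) => M; rewrite geq_max => /andP[MM1 MM2].
have ms n : measurable_fun setT (fun w => \sum_(b < n) u b M w) by apply: measurable_sum.
have mA : measurable [set w | t / 2 <= `|\sum_(b < N) u b M w|].
  by apply: measurable_le_set => //; exact: measurableT_comp.
have mB : measurable [set w | t / 2 <= `|u N M w|].
  by apply: measurable_le_set => //; exact: measurableT_comp.
apply: (@le_trans _ _ (Pr ([set w | t / 2 <= `|\sum_(b < N) u b M w|] `|` [set w | t / 2 <= `|u N M w|]))).
  apply: Pr_le; [|exact: measurableU|].
    by apply: measurable_le_set => //; exact: measurableT_comp.
  move=> w /=; rewrite big_ord_recr/= => h.
  have [k1|k1] := leP (t / 2) `|\sum_(b < N) u b M w|; [by left|right].
  have := ler_normD (\sum_(b < N) u b M w) (u N M w); lra.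
apply: (le_trans (Pr_setU _ mA mB)); rewrite [leRHS]splitr lerD//; [exact: h1|exact: h2].
Qed.

Lemma trunc_sum_cvg N t eta : 0 < t -> 0 < eta -> exists M0, forall M, (M0 <= M)%N ->
  Pr [set w | t <= `|hermite_sum q X N w - trunc_sum N M (noise (N + M).+1 N ^~ w)|] <= eta.
Proof.
move=> t0 eta0.
have [M0 h] := @Pr_sum_small (fun b M w => hermite q (X (N - b)%N w) - herm_trunc (N - b) M w)
  (fun b M => measurable_funB (measurable_hermite_X _) (measurable_herm_trunc _ _))
  (fun b t' eta' t0' eta0' => herm_trunc_cvg (N - b) t0' eta0') N t eta t0 eta0.
exists M0 => M MM; have := h M MM.
congr (Pr _ <= _); apply/funext => w /=; rewrite hermite_sumE /trunc_sum -sumrB.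
by under eq_bigr => b _ do rewrite (herm_truncE _ _ (ltnW (ltn_ord b))).
Qed.

End truncation.

(** * Second moments and reduction to nondegeneracy *)

Section moments.
Context (R : realType) (d : measure_display) (T : measurableType d) (P : probability T R).
Variables (beta : R) (hbeta : 1 / 2 < beta < 1).
Variables (N m K : nat) (mK : (N + m < K)%N) (xi : nat -> T -> R) (hxi : iid_normal P K xi).

(** The coefficients [c] are 1 for the sum itself, and powers of the products with the window for
    its directional derivatives. *)
Lemma weighted_sum_moment p (c : 'I_N -> R) A : (forall b, 0 <= c b <= A) ->
  Ex P xi (fun x => (\sum_b c b *
    herm (trunc_var beta m) (dot K (weights beta m b) x) p) ^+ 2) <=
  A ^+ 2 * (2 * N%:R * \sum_(0 <= k < N) corr_bound beta k ^+ p).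
Proof.
move=> cA; rewrite (Ex_sqr_herm_sum hxi c (a := fun b : 'I_N => weights beta m b)); last first.
  by move=> b; apply: dot_weights_self => //; have := ltn_ord b; lia.
apply: (@le_trans _ _ (\sum_(i < N) \sum_(j < N) A ^+ 2 * corr_bound beta (idist i j) ^+ p)).
  apply: ler_sum => i _; apply: ler_sum => j _.
  have /andP[ci0 ciA] := cA i; have /andP[cj0 cjA] := cA j.
  have d0 : 0 <= dot K (weights beta m i) (weights beta m j) by exact: dot_weights_ge0.
  have dle : dot K (weights beta m i) (weights beta m j) <= corr_bound beta (idist i j).
    by apply: dot_weights_le => //; have := ltn_ord i; have := ltn_ord j; lia.
  have dX : dot K (weights beta m i) (weights beta m j) ^+ p / p`!%:R <=
      corr_bound beta (idist i j) ^+ p.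
    rewrite ler_pdivrMr ?ltr0n ?fact_gt0// (@le_trans _ _ (corr_bound beta (idist i j) ^+ p))//.
      by rewrite lerXn2r// nnegrE corr_bound_ge0.
    by rewrite ler_peMr ?exprn_ge0 ?corr_bound_ge0// ler1n fact_gt0.
  apply: ler_pM => //; first exact: mulr_ge0.
    by rewrite divr_ge0// exprn_ge0.
  by rewrite expr2; exact: ler_pM.
under eq_bigr => i _ do rewrite -mulr_sumr.
rewrite -mulr_sumr ler_wpM2l ?sqr_ge0//.
by apply: (sum_idist_le (g := fun k => corr_bound beta k ^+ p)) => k; rewrite exprn_ge0 ?corr_bound_ge0.
Qed.

Lemma sum_herm_moment q : Ex P xi (fun x => (\sum_(b < N)
    herm (trunc_var beta m) (dot K (weights beta m b) x) q) ^+ 2) <=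
  2 * N%:R * \sum_(0 <= k < N) corr_bound beta k ^+ q.
Proof.
have := @weighted_sum_moment q (fun=> 1) 1 (fun=> _).
rewrite expr1n mul1r => h; apply: le_trans (h _); last by rewrite ler01 lexx.
rewrite le_eqVlt; apply/orP; left; apply/eqP; congr (Ex P xi _); apply/funext => x.
by congr (_ ^+ 2); apply: eq_bigr => b _; rewrite mul1r.
Qed.

End moments.

Lemma tame_trunc_sum {R : realType} (beta : R) N M q : tame (N + M).+1 (trunc_sum beta q N M).
Proof. by apply: tame_sum => b _; exact: tame_herm. Qed.

Section moment_growth.
Context (R : realType) (d : measure_display) (T : measurableType d) (P : probability T R).
Variables (beta : R) (hbeta : 1 / 2 < beta < 1) (q : nat).

Definition moment_growth gam := exists2 C, 0 <= C &
  forall N M (xi : nat -> T -> R), (0 < N)%N ->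
  iid_normal P (N + M).+1 xi ->
  Ex P xi (fun x => trunc_sum beta q N M x ^+ 2) <= C * N%:R `^ (2 * gam).

(** [M] tends to infinity before [N]: [M0] may depend on [N], but [del] and [N0] may not depend on
    [M]. *)
Definition nondegenerate gam := forall eta, 0 < eta -> exists2 del, 0 < del &
  exists N0, forall N, (N0 <= N)%N -> exists M0, forall M, (M0 <= M)%N ->
  forall xi : nat -> T -> R,
  iid_normal P (N + M).+1 xi ->
  Pr P [set w | `|trunc_sum beta q N M (xi ^~ w)| <= del * N%:R `^ gam] <= eta.

Lemma moment_growth_short : 1 < (2 * beta - 1) * q%:R -> moment_growth (1 / 2).
Proof.
move=> hq; have [C hC] := corr_sum_short hbeta hq.
have C0 : 0 <= C by have := hC 0%N; rewrite big_geq.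
exists (2 * C) => [|N M xi N0 hxi]; first exact: mulr_ge0.
apply: (le_trans (sum_herm_moment hbeta (ltnSn _) hxi q)).
rewrite (_ : 2 * (1 / 2) = 1 :> R); last by field.
by rewrite powRr1 ?ler0n// mulrAC ler_wpM2r// ler_wpM2l.
Qed.

Lemma moment_growth_long : (2 * beta - 1) * q%:R < 1 ->
  moment_growth (1 - q%:R * (beta - 1 / 2)).
Proof.
move=> hq; have [C C0 hC] := corr_sum_long hbeta hq.
exists (2 * C) => [|N M xi N0 hxi]; first exact: mulr_ge0.
apply: (le_trans (sum_herm_moment hbeta (ltnSn _) hxi q)).
rewrite (_ : 2 * (1 - _) = 1 + (1 - (2 * beta - 1) * q%:R)); last by field.
rewrite powR_add ?ltr0n// powRr1 ?ler0n// mulrACA -!mulrA ler_wpM2l// !mulrA [_ * C]mulrC -mulrA.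
by rewrite mulrCA ler_wpM2l ?ler0n// hC.
Qed.

End moment_growth.

(** * From truncated sums to the logarithmic limit *)

Section assembly.
Context (R : realType) (d : measure_display) (T : measurableType d) (P : probability T R).
Variables (W : R -> {RV P >-> R}) (hW : two_sided_brownian_motion W).
Variables (beta : R) (hbeta : 1 / 2 < beta < 1) (q : nat) (hq : (1 <= q)%N).
Variables (X : nat -> {RV P >-> R}) (hX : is_moving_average W (alpha beta) X).
Variables (gam : R) (gam0 : 0 < gam).
Hypothesis gU : moment_growth P beta q gam.
Hypothesis gL : nondegenerate P beta q gam.

Let pr N x := Pr P [set w | x < `|hermite_sum q X N w|].

Let mS N : measurable_fun [set: T] (hermite_sum q X N).
Proof. exact: (measurable_hermite_sum hW hbeta hq hX N). Qed.

Let mlt N x : measurable [set w | x < `|hermite_sum q X N w|].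
Proof. by apply: measurable_lt_set => //; exact: measurableT_comp. Qed.

Let mle N x : measurable [set w | `|hermite_sum q X N w| <= x].
Proof. by apply: measurable_le_set => //; exact: measurableT_comp. Qed.

Let ns N M p := noise W (N + M).+1 N p.
Let hns N M : iid_normal P (N + M).+1 (ns N M).
Proof. exact: (iid_noise hW). Qed.

Let mtr N M : measurable_fun [set: T] (fun w => trunc_sum beta q N M (ns N M ^~ w)).
Proof. exact: (tame_rv (hns N M) (tame_trunc_sum beta N M q)). Qed.

Let mdiff N M x : measurable
  [set w | x <= `|hermite_sum q X N w - trunc_sum beta q N M (ns N M ^~ w)|].
Proof.
by apply: measurable_le_set => //; apply: measurableT_comp => //; exact: measurable_funB.
Qed.

Let pr_up : exists2 C, 0 <= C & forall N x, (0 < N)%N -> 0 < x ->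
  pr N x <= C * N%:R `^ (2 * gam) / x ^+ 2.
Proof.
have [C C0 hC] := gU; exists (4 * C) => [|N x N0 x0]; first exact: mulr_ge0.
have x2 : 0 < x / 2 by rewrite divr_gt0.
(* The slack [eta] absorbs the probability of a large truncation error; [M] depends on it, the
   moment bound does not. *)
apply/ler_addgt0Pr => eta eta0.
have [M hM] := trunc_sum_cvg hW hbeta hq hX N x2 eta0.
have {}hM := hM M (leqnn M).
have mA : measurable [set w | x / 2 <= `|trunc_sum beta q N M (ns N M ^~ w)|].
  by apply: measurable_le_set => //; exact: measurableT_comp.
have sub : [set w | x < `|hermite_sum q X N w|] `<=`
    [set w | x / 2 <= `|trunc_sum beta q N M (ns N M ^~ w)|] `|`
    [set w | x / 2 <= `|hermite_sum q X N w - trunc_sum beta q N M (ns N M ^~ w)|].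
  move=> w /= xw; have [h|h] := leP (x / 2) `|trunc_sum beta q N M (ns N M ^~ w)|; [by left|right].
  have := ler_distD 0 (hermite_sum q X N w) (trunc_sum beta q N M (ns N M ^~ w)).
  have := lerB_dist (hermite_sum q X N w) (trunc_sum beta q N M (ns N M ^~ w)).
  lra.
apply: (le_trans (Pr_le P (mlt N x) (measurableU _ _ mA (mdiff N M _)) sub)).
apply: (le_trans (Pr_setU P mA (mdiff N M _))); rewrite lerD//.
apply: (le_trans (Pr_chebyshev (hns N M) (tame_trunc_sum beta N M q) x2)).
rewrite (_ : 4 * C * _ / x ^+ 2 = C * N%:R `^ (2 * gam) / (x / 2) ^+ 2); last first.
  by field; rewrite gt_eqF.
by rewrite ler_wpM2r ?invr_ge0 ?sqr_ge0// hC.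
Qed.

Let pr_lo eta : 0 < eta -> exists2 del, 0 < del &
  exists N0, forall N, (N0 <= N)%N -> 1 - eta <= pr N (del * N%:R `^ gam).
Proof.
move=> eta0; have e2 : 0 < eta / 2 by rewrite divr_gt0.
have [del del0 [N0 hN0]] := gL e2.
exists (del / 2); first by rewrite divr_gt0.
exists N0.+1 => N NN; have Np : (0 < N)%N by lia.
have [M1 h1] := hN0 N (ltnW NN).
have x0 : 0 < del / 2 * N%:R `^ gam by rewrite mulr_gt0 ?divr_gt0 ?powR_gt0 ?ltr0n.
have [M2 h2] := trunc_sum_cvg hW hbeta hq hX N x0 e2.
pose M := maxn M1 M2; have {}h1 := h1 M (leq_maxl _ _) _ (hns N M).
have {}h2 := h2 M (leq_maxr _ _).
have -> : pr N (del / 2 * N%:R `^ gam) = 1 - Pr P [set w | `|hermite_sum q X N w| <= del / 2 * N%:R `^ gam].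
  rewrite -Pr_setC//; congr (Pr P _); apply/seteqP; split => w /=.
    by rewrite ltNge => /negP.
  by move/negP; rewrite -ltNge.
rewrite lerB//.
have mA : measurable [set w | `|trunc_sum beta q N M (ns N M ^~ w)| <= del * N%:R `^ gam].
  by apply: measurable_le_set => //; exact: measurableT_comp.
have sub : [set w | `|hermite_sum q X N w| <= del / 2 * N%:R `^ gam] `<=`
    [set w | `|trunc_sum beta q N M (ns N M ^~ w)| <= del * N%:R `^ gam] `|`
    [set w | del / 2 * N%:R `^ gam <= `|hermite_sum q X N w - trunc_sum beta q N M (ns N M ^~ w)|].
  move=> w /= hw.
  have [h|h] := leP (del / 2 * N%:R `^ gam) `|hermite_sum q X N w - trunc_sum beta q N M (ns N M ^~ w)|; [by right|left].
  have := lerB_dist (trunc_sum beta q N M (ns N M ^~ w)) (hermite_sum q X N w).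
  rewrite distrC; lra.
apply: (le_trans (Pr_le P (mle N _) (measurableU _ _ mA (mdiff N M _)) sub)).
by apply: (le_trans (Pr_setU P mA (mdiff N M _))); rewrite [leRHS]splitr lerD.
Qed.

Lemma hermite_sum_log_limit : ((1 / (- ln eps))%:E *
    \sum_(1 <= N <oo) (N%:R^-1)%:E *
      P [set w | (eps * N%:R `^ (2 * gam) < `|hermite_sum q X N w|)%R])%E @[eps --> 0^'+]
  --> (1 / gam)%:E.
Proof.
have := log_limit gam0 (pr := pr) (fun N x => Pr_ge0 P _) (fun N x => Pr_le1 P (mlt N x)) _ pr_up pr_lo.
have mono N x y : x <= y -> pr N y <= pr N x.
  by move=> xy; apply: Pr_le => // w /=; exact: le_lt_trans.
move=> /(_ mono); apply: cvg_trans; apply: near_eq_cvg; apply: nearW => eps.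
by congr (_ * _)%E; apply: eq_eseriesr => N _; rewrite (Pr_EFin P (mlt _ _)) -EFinM.
Qed.

End assembly.

(** * Nondegeneracy for short memory *)

Lemma Ex_mulBB d (T : measurableType d) (R : realType) (P : probability T R) K
    (xi : nat -> T -> R) (hxi : iid_normal P K xi) (f1 g1 f2 g2 : (nat -> R) -> R) :
  tame K f1 -> tame K g1 -> tame K f2 -> tame K g2 ->
  Ex P xi (fun x => (f1 x - g1 x) * (f2 x - g2 x)) =
  Ex P xi (fun x => f1 x * f2 x) - Ex P xi (fun x => f1 x * g2 x) -
  Ex P xi (fun x => g1 x * f2 x) + Ex P xi (fun x => g1 x * g2 x).
Proof.
move=> tf1 tg1 tf2 tg2.
have t1 := tameM tf1 tf2; have t2 := tameM tf1 tg2.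
have t3 := tameM tg1 tf2; have t4 := tameM tg1 tg2.
rewrite -(ExB hxi t1 t2) -(ExB hxi (tameB t1 t2) t3) -(ExD hxi (tameB (tameB t1 t2) t3) t4).
by congr (Ex P xi _); apply/funext => x; ring.
Qed.

Lemma Ex_herm_diff d (T : measurableType d) (R : realType) (P : probability T R) K
    (xi : nat -> T -> R) (hxi : iid_normal P K xi) s t (a a' b b' : nat -> R) p :
  dot K a a = s -> dot K b b = t ->
  Ex P xi (fun x => (herm s (dot K a x) p - herm t (dot K b x) p) *
                    (herm s (dot K a' x) p - herm t (dot K b' x) p)) =
  (dot K a a' ^+ p - dot K a b' ^+ p - dot K b a' ^+ p + dot K b b' ^+ p) / p`!%:R.
Proof.
move=> as_ bt; have h := @tame_herm R K.
rewrite (Ex_mulBB hxi (h s a p) (h t b p) (h s a' p) (h t b' p)).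
by rewrite -as_ -bt !(Ex_herm2 hxi) mulrDl !mulrBl.
Qed.

Section short_memory.
Context (R : realType) (d : measure_display) (T : measurableType d) (P : probability T R).
Variables (beta : R) (hbeta : 1 / 2 < beta < 1) (p : nat).
Hypothesis hq : 1 < (2 * beta - 1) * p.+1%:R.

Let herm_sum m N K (x : nat -> R) : R :=
  \sum_(b < N) herm (trunc_var beta m) (dot K (weights beta m b) x) p.+1.

Let a0_gt0 : 0 < 2 * beta - 1.
Proof. by move: hbeta; lra. Qed.

Let ltnK m N K (b : 'I_N) : (N + m < K)%N -> (b < K)%N.
Proof. by have := ltn_ord b; lia. Qed.

Let weights_self m N K (b : 'I_N) : (N + m < K)%N ->
  dot K (weights beta m b) (weights beta m b) = trunc_var beta m.
Proof. by move=> NK; apply: dot_weights_self => //; have := ltn_ord b; lia. Qed.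

(** The order of quantifiers is the point: [e] is obtained from bounds uniform in [m], and only [N0]
    depends on [m]. *)
Lemma anticoncentration_fixed_memory eta : 0 < eta -> exists2 e, 0 < e &
  forall m, (0 < m)%N -> exists N0, forall N, (N0 <= N)%N -> forall K, (N + m < K)%N ->
  forall xi : nat -> T -> R,
  iid_normal P K xi ->
  Pr P [set w | `|herm_sum m N K (xi ^~ w)| <= e * N%:R `^ (1 / 2)] <= eta.
Proof.
move=> eta0; have [C hC] := corr_sum_short hbeta hq.
have C0 : 0 <= C by have := hC 0%N; rewrite big_geq.
have e2 : 0 < eta / 2 by rewrite divr_gt0.
have k0 := kappa_gt0 hbeta.
(* A lower bound for the mean squared gradient: only diagonal terms are kept, and [trunc_var m] is
   at least its first term [alpha_1^2 = kappa^2]. *)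
pose v0 := (kappa beta ^+ 2) ^+ p.+1 / p`!%:R.
have v00 : 0 < v0 by rewrite divr_gt0 ?exprn_gt0// ltr0n fact_gt0.
pose B := p.+1%:R * (1 + 2 * C).
have B0 : 0 < B by rewrite mulr_gt0// ltr_wpDr// mulr_ge0.
exists (eta / 2 * v0 / (8 * B)).
  by apply: divr_gt0; apply: mulr_gt0.
set e := eta / 2 * v0 / _ => m m0.
have e0 : 0 < e by apply: divr_gt0; apply: mulr_gt0.
have [C4 hC4] := Ex_herm4 P (trunc_var beta m) p.
(* Numerator of the Chebyshev term, of order [1 / N]: the scaling contributes [c^4 = N^-2] against
   the factor [N] of [var_grad_sqr]. *)
pose D := 4 / v0 ^+ 2 * (`|C4| * (m.*2.*2.+1)%:R ^+ 3).
have D0 : 0 <= D by rewrite mulr_ge0 ?divr_ge0 ?sqr_ge0 ?mulr_ge0 ?exprn_ge0.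
pose N0 := (Num.truncn (D / (eta / 2))).+1.
exists N0 => N NN K NK xi hxi.
have Np : (0 < N)%N by apply: leq_trans NN.
have NR : 0 < N%:R :> R by rewrite ltr0n.
have DN : D / N%:R <= eta / 2.
  rewrite ler_pdivrMr// mulrC -ler_pdivrMr//.
  apply: (@le_trans _ _ N0%:R); last by rewrite ler_nat.
  by apply/ltW; rewrite /N0 truncnS_gt.
pose c : R := (N%:R `^ (1 / 2))^-1.
have s0 : 0 < N%:R `^ (1 / 2) :> R by rewrite powR_gt0.
have s2 : (N%:R `^ (1 / 2)) ^+ 2 = N%:R :> R.
  by rewrite powR_pow (_ : 1 / 2 * 2%:R = 1) ?powRr1 ?ler0n//; field.
have c0 : 0 < c by rewrite invr_gt0.
have c2 : c ^+ 2 = N%:R^-1 by rewrite /c exprVn s2.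
pose a (b : 'I_N) := weights beta m b.
have as_ b : dot K (a b) (a b) = trunc_var beta m by exact: weights_self.
have bK (b : 'I_N) : (b < K)%N by exact: ltnK NK.
have sm0 : 0 <= trunc_var beta m by apply: sumr_ge0 => i _; exact: sqr_ge0.
have vE : v0 <= Ex P xi (grad_sqr K a (trunc_var beta m) c p).
  rewrite (Ex_grad_sqr hxi c p as_) c2 mulrC ler_pdivlMr//.
  apply: (@le_trans _ _ (\sum_(i < N) v0)).
    by rewrite sumr_const card_ord mulr_natr.
  apply: ler_sum => i _; rewrite (bigD1 i)//= as_ ler_wpDr//.
    by apply: sumr_ge0 => j _; rewrite divr_ge0// exprn_ge0// dot_weights_ge0.
  rewrite ler_wpM2r ?invr_ge0// lerXn2r ?nnegrE ?sqr_ge0//.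
  exact: trunc_var_ge.
have far (i j : 'I_N) : ~~ near_idx m i j -> dot K (a i) (a j) = 0.
  by move=> ij; apply: dot_weights_far (bK i) (bK j) ij.
have C4E (i : 'I_N) : Ex P xi (fun x => herm (trunc_var beta m) (dot K (a i) x) p ^+ 4) = C4.
  exact: hC4.
have a0 (i j : 'I_N) : 0 <= dot K (a i) (a j) by exact: dot_weights_ge0.
have := Pr_chaos_le hxi (c := c) as_ a0 (fun i j => dot_le_self (as_ i) (as_ j)) far C4E e0 v00 vE.
have -> : [set w | `|chaos K a (trunc_var beta m) c p (xi ^~ w)| <= e] =
    [set w | `|herm_sum m N K (xi ^~ w)| <= e * N%:R `^ (1 / 2)].
  apply/funext => w /=; rewrite /chaos normrM (ger0_norm (ltW c0)) /c mulrC ler_pdivrMr//.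
move=> /le_trans; apply; rewrite [leRHS]splitr; apply: lerD.
  apply: le_trans DN.
  rewrite (_ : D / _ = 4 / v0 ^+ 2 * (N%:R^-1 * `|C4| * (m.*2.*2.+1)%:R ^+ 3)); last by rewrite /D; ring.
  rewrite ler_wpM2l ?divr_ge0 ?sqr_ge0// mulrA ler_wpM2r ?exprn_ge0//.
  rewrite (_ : c ^+ 4 = N%:R^-1 * N%:R^-1); last by rewrite (_ : 4 = 2 * 2)%N// exprM c2 expr2.
  rewrite (_ : _ * N%:R = N%:R^-1 * (trunc_var beta m ^+ 2 * C4)); last by field; rewrite gt_eqF.
  rewrite ler_wpM2l ?invr_ge0// (le_trans (ler_norm _))// normrM (ger0_norm (sqr_ge0 _)).
  by rewrite ler_piMl// exprn_ile1// trunc_var_le1.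
have chE : Ex P xi (fun x => chaos K a (trunc_var beta m) c p x ^+ 2) <= 2 * C.
  rewrite (_ : (fun x => _) = (fun x => c ^+ 2 * herm_sum m N K x ^+ 2)); last first.
    by apply/funext => x; rewrite /chaos exprMn.
  rewrite (ExZ hxi); last by apply: tameX; apply: tame_sum => b _; exact: tame_herm.
  rewrite c2 mulrC ler_pdivrMr//.
  apply: (le_trans (sum_herm_moment hbeta NK hxi p.+1)).
  by rewrite mulrAC ler_wpM2r// ler_wpM2l.
apply: (@le_trans _ _ (8 * e / v0 * B)).
  by apply: ler_wpM2l; [apply: divr_ge0 (ltW v00); exact: mulr_ge0 (ltW e0)|rewrite ler_wpM2l// lerD2l].
rewrite /e le_eqVlt; apply/orP; left; apply/eqP; field.
by rewrite !gt_eqF.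
Qed.

(** The weights are nonnegative, so the mixed covariances dominate those at level [m]; hence the
    covariance of two differences is at most the difference of the q-th powers at levels [M] and
    [m], where [q = p + 1]. Pairs at distance at least [k1] are handled by the decay of covariances,
    closer pairs by the smallness of the removed tail of weights. *)
Lemma memory_approximation eps : 0 < eps -> exists2 m, (0 < m)%N &
  forall N M, (m <= M)%N ->
  forall xi : nat -> T -> R,
  iid_normal P (N + M).+1 xi ->
  Ex P xi (fun x => (trunc_sum beta p.+1 N M x - herm_sum m N (N + M).+1 x) ^+ 2) <=
  eps * N%:R.
Proof.
move=> eps0; have e4 : 0 < eps / 4 by rewrite divr_gt0.
have [k1 k10 hk1] := corr_tail_short hbeta hq e4.
pose A := p.+1%:R * (kappa beta ^+ 2 / (2 * beta - 1)).
have A0 : 0 < A by rewrite mulr_gt0 ?ltr0n// divr_gt0 ?exprn_gt0 ?kappa_gt0.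
(* [L] will satisfy [A k1 L^(-(2 beta - 1)) <= eps / 4]; with [m = k1 + L], at least [L] lags remain
   after a shift by less than [k1]. *)
pose y := A * k1%:R / (eps / 4).
have y0 : 0 < y by rewrite divr_gt0// mulr_gt0// ltr0n.
pose L := (Num.truncn (y `^ (2 * beta - 1)^-1)).+1.
have yL : y <= L%:R `^ (2 * beta - 1).
  apply: (@le_trans _ _ ((y `^ (2 * beta - 1)^-1) `^ (2 * beta - 1))).
    by rewrite -powRrM mulVf ?gt_eqF// powRr1// ltW.
  apply: le_powR; [exact: ltW|exact: powR_ge0|].
  by apply/ltW; rewrite /L truncnS_gt.
have L0 : 0 < L%:R `^ (2 * beta - 1) by apply: lt_le_trans yL.
pose tau := A * L%:R `^ (- (2 * beta - 1)).
have tau0 : 0 <= tau by rewrite mulr_ge0 ?powR_ge0// ltW.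
have tauk : k1%:R * tau <= eps / 4.
  rewrite /tau powRN mulrA ler_pdivrMr// [k1%:R * A]mulrC.
  by rewrite [leRHS]mulrC -ler_pdivrMr.
exists (k1 + L)%N; first by rewrite addn_gt0 k10.
set m := (k1 + L)%N => N M mM xi hxi; set K := (N + M).+1.
pose sM := trunc_var beta M; pose sm := trunc_var beta m.
pose u (b : 'I_N) x := herm sM (dot K (weights beta M b) x) p.+1 - herm sm (dot K (weights beta m b) x) p.+1.
have tu b : tame K (u b) by apply: tameB; exact: tame_herm.
have NmK m' : (m' <= M)%N -> (N + m' < K)%N by move=> m'M; rewrite ltnS leq_add2l.
have bK (b : 'I_N) : (b < K)%N by exact: ltnK (NmK M (leqnn M)).
have selfM (b : 'I_N) : dot K (weights beta M b) (weights beta M b) = sM.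
  exact: weights_self (NmK M (leqnn M)).
rewrite (_ : (fun x => _) = (fun x => (\sum_b 1 * u b x) ^+ 2)); last first.
  apply/funext => x; rewrite /trunc_sum /herm_sum -sumrB; congr (_ ^+ 2).
  by apply: eq_bigr => b _; rewrite mul1r.
rewrite (Ex_sqr_sum hxi (fun=> 1) tu).
(* Each of the two ranges sums to at most [eps / 4], and [sum_idist_le] contributes the factor
   [2 N]. *)
pose g k := if (k < k1)%N then tau else corr_bound beta k ^+ p.+1.
have g0 k : 0 <= g k by rewrite /g; case: ifP => // _; rewrite exprn_ge0 ?corr_bound_ge0.
apply: (@le_trans _ _ (\sum_(i < N) \sum_(j < N) g (idist i j))); last first.
  apply: (le_trans (sum_idist_le N g0)); rewrite mulrAC ler_wpM2r//.
  have gN : \sum_(0 <= k < N) g k <= \sum_(0 <= k < k1 + N) g k.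
    by apply: ler_sum_range => //; exact: leq_addl.
  rewrite [leRHS](@big_cat_nat _ _ _ k1)//= ?leq_addr// in gN.
  have g1 : \sum_(0 <= k < k1) g k = k1%:R * tau.
    rewrite big_nat_cond (eq_bigr (fun=> tau)); last by move=> k /andP[/andP[_ kk] _]; rewrite /g kk.
    by rewrite -big_nat_cond sumr_const_nat subn0 mulr_natl.
  have g2 : \sum_(k1 <= k < k1 + N) g k <= eps / 4.
    rewrite big_nat_cond (eq_bigr (fun k => corr_bound beta k ^+ p.+1)); last first.
      by move=> k /andP[/andP[kk _] _]; rewrite /g ltnNge kk.
    by rewrite -big_nat_cond hk1.
  by move: tauk g1 g2 gN; lra.
apply: ler_sum => i _; apply: ler_sum => j _; rewrite !mul1r.
pose D m1 (b1 : nat) m2 (b2 : nat) := dot K (weights beta m1 b1) (weights beta m2 b2).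
rewrite (Ex_herm_diff hxi _ _ _ (selfM i) (weights_self i (NmK _ mM))).
rewrite -/(D M i M j) -/(D M i m j) -/(D m i M j) -/(D m i m j).
have d0 m1 b1 m2 b2 : 0 <= D m1 b1 m2 b2 by exact: dot_weights_ge0.
have h1 : D m i m j ^+ p.+1 <= D M i m j ^+ p.+1.
  by rewrite lerXn2r ?nnegrE//; exact: dot_weights_mono.
have h2 : D m i m j ^+ p.+1 <= D m i M j ^+ p.+1.
  by rewrite lerXn2r ?nnegrE//; exact: dot_weights_mono.
have h3 : D m i m j <= D M i M j by exact: dot_weights_mono.
have dM : D M i M j <= corr_bound beta (idist i j).
  by apply: dot_weights_le => //; rewrite ltn_subRL ltnS leq_add2r ltnW.
have dM1 : D M i M j <= 1.
  by apply: le_trans (dot_le_self (selfM i) (selfM j)) (trunc_var_le1 hbeta M).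
have h4 : D M i M j ^+ p.+1 - D m i m j ^+ p.+1 <= g (idist i j).
  rewrite /g; case: ltnP => ij; last first.
    apply: (@le_trans _ _ (D M i M j ^+ p.+1)); first by rewrite gerBl exprn_ge0.
    by rewrite lerXn2r ?nnegrE ?corr_bound_ge0.
  apply: (le_trans (subrX_le p.+1 (d0 _ _ _ _) h3 dM1)); rewrite /tau /A -mulrA ler_wpM2l//.
  have ijm : (idist i j < m)%N by exact: leq_trans ij (leq_addr _ _).
  apply: (le_trans (dot_weights_diff hbeta mM (bK i) (bK j) ijm)).
  rewrite ler_wpM2l ?divr_ge0 ?sqr_ge0 ?(ltW a0_gt0)// !powRN lef_pV2 ?posrE//; last first.
    by rewrite powR_gt0// ltr0n subn_gt0.
  apply: le_powR (ltW a0_gt0) _ _ => //.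
  by rewrite ler_nat leq_subRL ?(ltnW ijm)// leq_add2r ltnW.
rewrite ler_pdivrMr ?ltr0n ?fact_gt0//.
apply: (@le_trans _ _ (g (idist i j))); first by move: h1 h2 h4; lra.
by rewrite ler_peMr// ler1n fact_gt0.
Qed.

Lemma nondegenerate_short : nondegenerate P beta p.+1 (1 / 2).
Proof.
move=> eta eta0; have e2 : 0 < eta / 2 by rewrite divr_gt0.
have [e e0 he] := anticoncentration_fixed_memory e2.
exists (e / 2); first by rewrite divr_gt0.
have ee : 0 < e / 2 by rewrite divr_gt0.
have eps0 : 0 < eta / 2 * (e / 2) ^+ 2 by rewrite mulr_gt0// exprn_gt0.
have [m m0 hm] := memory_approximation eps0.
have [N0 hN0] := he m m0.
exists N0.+1 => N NN; exists m => M mM xi hxi.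
have Np : (0 < N)%N by exact: leq_ltn_trans (leq0n _) NN.
set K := (N + M).+1 in hxi *.
have NR : 0 < N%:R :> R by rewrite ltr0n.
have s0 : 0 < N%:R `^ (1 / 2) :> R by rewrite powR_gt0.
have s2 : (N%:R `^ (1 / 2)) ^+ 2 = N%:R :> R.
  by rewrite powR_pow (_ : 1 / 2 * 2%:R = 1) ?powRr1 ?ler0n//; field.
have tS : tame K (trunc_sum beta p.+1 N M) by exact: tame_trunc_sum.
have th : tame K (herm_sum m N K) by apply: tame_sum => b _; exact: tame_herm.
have tD := tameB tS th.
have mA : measurable [set w | `|herm_sum m N K (xi ^~ w)| <= e * N%:R `^ (1 / 2)].
  by apply: measurable_le_set => //; apply: measurableT_comp => //; exact: (tame_rv hxi th).
have mB : measurable [set w | e / 2 * N%:R `^ (1 / 2) <= `|trunc_sum beta p.+1 N M (xi ^~ w) - herm_sum m N K (xi ^~ w)|].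
  by apply: measurable_le_set => //; apply: measurableT_comp => //; exact: (tame_rv hxi tD).
have mC : measurable [set w | `|trunc_sum beta p.+1 N M (xi ^~ w)| <= e / 2 * N%:R `^ (1 / 2)].
  by apply: measurable_le_set => //; apply: measurableT_comp => //; exact: (tame_rv hxi tS).
have sub : [set w | `|trunc_sum beta p.+1 N M (xi ^~ w)| <= e / 2 * N%:R `^ (1 / 2)] `<=`
    [set w | `|herm_sum m N K (xi ^~ w)| <= e * N%:R `^ (1 / 2)] `|`
    [set w | e / 2 * N%:R `^ (1 / 2) <= `|trunc_sum beta p.+1 N M (xi ^~ w) - herm_sum m N K (xi ^~ w)|].
  move=> w /= h.
  have [k|k] := leP (e / 2 * N%:R `^ (1 / 2)) `|trunc_sum beta p.+1 N M (xi ^~ w) - herm_sum m N K (xi ^~ w)|; [by right|left].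
  have := lerB_dist (herm_sum m N K (xi ^~ w)) (trunc_sum beta p.+1 N M (xi ^~ w)).
  rewrite distrC; lra.
apply: (le_trans (Pr_le P mC (measurableU _ _ mA mB) sub)).
apply: (le_trans (Pr_setU P mA mB)); rewrite [leRHS]splitr; apply: lerD.
  by apply: (hN0 N (ltnW NN) K _ xi hxi); rewrite ltnS leq_add2l.
have x0 : 0 < e / 2 * N%:R `^ (1 / 2) by rewrite mulr_gt0.
apply: (le_trans (Pr_chebyshev hxi tD x0)).
by rewrite ler_pdivrMr ?exprn_gt0// exprMn s2 mulrA hm.
Qed.

End short_memory.

(** * Nondegeneracy for long memory *)

Section directional_derivative.
Context d (T : measurableType d) (R : realType) (P : probability T R).
Variables (K : nat) (xi : nat -> T -> R) (hxi : iid_normal P K xi).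

(** Integration by parts of [slope e (F) * F1] in the direction [h] gives the identity with
    [V = F1^2] and [U = (h . x) F1 - F2]. The last factor is the mean of a quadratic majorant of
    [|U|]. *)
Lemma directional_anticoncentration (h : nat -> R) F dF F1 dF1 F2 e eta :
  smooth K F dF -> smooth K F1 dF1 -> tame K F2 ->
  (forall x, dF h x = F1 x) -> (forall x, dF1 h x = F2 x) -> 0 < e -> 0 < eta ->
  Pr P [set w | `|F (xi ^~ w)| <= e] <=
  Pr P [set w | F1 (xi ^~ w) ^+ 2 < eta] + 4 * e / eta *
    (dot K h h + Ex P xi (fun x => F1 x ^+ 2) + (1 + Ex P xi (fun x => F2 x ^+ 2))).
Proof.
move=> sF sF1 tF2 dFE dF1E e0 eta0.
have tF := smooth_tame sF; have tF1 := smooth_tame sF1.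
have th := tame_dot K h.
have ts := tame_slope e0 tF; have td := tame_dslope e tF.
pose M x := (dot K h x ^+ 2 + F1 x ^+ 2) + (1 + F2 x ^+ 2).
have tM : tame K M.
  by apply: tameD; [apply: tameD; exact: tameX|apply: tameD; [exact: tame_cst|exact: tameX]].
have EM : Ex P xi M = dot K h h + Ex P xi (fun x => F1 x ^+ 2) + (1 + Ex P xi (fun x => F2 x ^+ 2)).
  rewrite (ExD hxi (tameD (tameX 2 th) (tameX 2 tF1)) (tameD (tame_cst K 1) (tameX 2 tF2))).
  rewrite (ExD hxi (tameX 2 th) (tameX 2 tF1)) (ExD hxi (tame_cst K 1) (tameX 2 tF2)) Ex_cst.
  by have := Ex_herm2 hxi h h 1 1; rewrite /= expr1 (_ : 1`! = 1)%N// divr1 => <-.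
rewrite -EM.
apply: (anticoncentration hxi (V := fun x => F1 x ^+ 2) (U := fun x => dot K h x * F1 x - F2 x) e0 eta0 tF
  (tameX 2 tF1) (tameB (tameM th tF1) tF2) tM).
- by move=> x; exact: sqr_ge0.
- move=> x; rewrite (le_trans (ler_normB _ _))// /M lerD//.
    rewrite normrM -[dot K h x ^+ 2]real_normK ?num_real// -[F1 x ^+ 2]real_normK ?num_real//.
    have := sqr_ge0 (`|dot K h x| - `|F1 x|); have := sqr_ge0 (`|dot K h x|); have := sqr_ge0 (`|F1 x|).
    by rewrite sqrrB; lra.
  rewrite -[F2 x ^+ 2]real_normK ?num_real//.
  have := sqr_ge0 (`|F2 x| - 1); have := sqr_ge0 `|F2 x|.
  by rewrite sqrrB; lra.
- have := iid_ibp hxi h (smoothM (smooth_slope e0 sF) sF1).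
  have -> : Ex P xi (fun x => dslope e (F x) * dF h x * F1 x + slope e (F x) * dF1 h x) =
      Ex P xi (fun x => dslope e (F x) * F1 x ^+ 2) + Ex P xi (fun x => slope e (F x) * F2 x).
    rewrite -(ExD hxi (tameM td (tameX 2 tF1)) (tameM ts tF2)); congr (Ex P xi _).
    by apply/funext => x; rewrite dFE dF1E expr2 mulrA.
  move=> k.
  have t1 : tame K (fun x => dot K h x * (slope e (F x) * F1 x)) by exact: tameM th (tameM ts tF1).
  have -> : Ex P xi (fun x => slope e (F x) * (dot K h x * F1 x - F2 x)) =
      Ex P xi (fun x => dot K h x * (slope e (F x) * F1 x)) - Ex P xi (fun x => slope e (F x) * F2 x).
    rewrite -(ExB hxi t1 (tameM ts tF2)); congr (Ex P xi _).
    by apply/funext => x; ring.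
  by rewrite k addrK.
Qed.

End directional_derivative.

Section window.
Context {R : realType}.

(** A unit vector. The indices [N <= p < 2 N] are times in [(-N, 0]], in the past of every summand
    [b < N] and at lags below [2 N]. *)
Definition window N (p : nat) : R := (N%:R `^ (1 / 2))^-1 * (N <= p < N.*2)%N%:R.

Lemma dot_window K N (a : nat -> R) : (N.*2 <= K)%N ->
  dot K a (window N) = (N%:R `^ (1 / 2))^-1 * \sum_(N <= p < N.*2) a p.
Proof.
move=> NK; rewrite (big_nat_widenl N 0)// (big_nat_widen _ _ _ _ _ NK) big_mkcond big_mkord mulr_sumr.
apply: eq_bigr => p _; rewrite /window andbC mulrCA; case: ifP => _; rewrite ?mulr1//.
by rewrite !mulr0.
Qed.

Lemma dot_window_self K N : (0 < N)%N -> (N.*2 <= K)%N -> dot K (window N) (window N) = 1.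
Proof.
move=> N0 NK; rewrite dot_window//.
rewrite big_nat_cond (eq_bigr (fun=> (N%:R `^ (1 / 2))^-1)); last first.
  by move=> p /andP[pN _]; rewrite /window pN mulr1.
rewrite -big_nat_cond sumr_const_nat -addnn addnK -[_^-1 *+ N]mulr_natr mulrA -expr2 exprVn powR_pow.
rewrite (_ : 1 / 2 * 2%:R = 1); last by field.
by rewrite powRr1 ?ler0n// mulVf// pnatr_eq0 -lt0n.
Qed.

Variables (beta : R) (hbeta : 1 / 2 < beta < 1).

(** Every lag lies between 1 and [2 N]: from below each of the [N] weights is at least
    [alpha (2 N)]; from above their sum is at most the full sum up to [2 N], of order
    [N^(1 - beta)]. The normalization divides by [N^(1/2)]. *)
Lemma dot_weights_window : exists c1 c2 : R, [/\ 0 < c1, 0 <= c2 & forall N M K b, (0 < N)%N ->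
  (N.*2 <= M)%N -> (N + M < K)%N -> (b < N)%N ->
  c1 * N%:R `^ (1 / 2 - beta) <= dot K (weights beta M b) (window N) <=
  c2 * N%:R `^ (1 / 2 - beta)].
Proof.
have k0 := kappa_gt0 hbeta.
have b1 : 0 < 1 - beta <= 1 by move: hbeta; lra.
have b10 : 0 < 1 - beta by case/andP: b1.
exists (kappa beta * 2 `^ (- beta)), (kappa beta * (2 / (1 - beta)) * 2 `^ (1 - beta)).
split=> [||N M K b N0 NM MK bN].
- by rewrite mulr_gt0// powR_gt0.
- by rewrite !mulr_ge0 ?powR_ge0 ?invr_ge0 ?(ltW k0) ?(ltW b10).
have NR : 0 < N%:R :> R by rewrite ltr0n.
have s0 : 0 < N%:R `^ (1 / 2) :> R by rewrite powR_gt0.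
have N2R : N.*2%:R = 2 * N%:R :> R by rewrite -mul2n natrM.
have NK : (N.*2 <= K)%N by lia.
have wE : \sum_(N <= p < N.*2) weights beta M b p = \sum_(N - b <= i < N.*2 - b) alpha beta i.
  rewrite -{1}(subnK (ltnW bN)) big_addn big_nat_cond [RHS]big_nat_cond; apply: eq_bigr => i /andP[/andP[i1 i2] _].
  rewrite /weights addnK /trunc_alpha (_ : (i <= M)%N)//.
  by rewrite (leq_trans (ltnW i2))// (leq_trans (leq_subr _ _)).
rewrite dot_window// wE; apply/andP; split.
  rewrite [leRHS]mulrC ler_pdivlMr//.
  apply: (@le_trans _ _ (\sum_(N - b <= i < N.*2 - b) alpha beta N.*2)); last first.
    rewrite big_nat_cond [leRHS]big_nat_cond; apply: ler_sum => i /andP[/andP[i1 i2] _].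
    by apply: alpha_le => //; lia.
  rewrite sumr_const_nat (_ : (N.*2 - b - (N - b) = N)%N); last by lia.
  rewrite -[alpha _ _ *+ N]mulr_natr /alpha N2R powRM ?ler0n// -!mulrA ler_wpM2l ?(ltW k0)// ler_wpM2l ?powR_ge0//.
  have -> : N%:R `^ (1 / 2 - beta) * N%:R `^ (1 / 2) = N%:R `^ (- beta) * N%:R `^ 1 :> R.
    by rewrite -!powR_add//; congr (_ `^ _); field.
  by rewrite powRr1 ?ler0n.
rewrite mulrC ler_pdivrMr//.
apply: (@le_trans _ _ (\sum_(1 <= i < N.*2.+1) alpha beta i)).
  apply: ler_sum_range; [exact: alpha_ge0|by rewrite subn_gt0|].
  by rewrite leqW// leq_subr.
have bE : - beta = (1 - beta) - 1 by ring.
under eq_bigr => i _ do rewrite /alpha bE.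
rewrite -mulr_sumr; apply: (le_trans (ler_wpM2l (ltW k0) (powR_head _ b1))).
have -> : N.*2%:R `^ (1 - beta) = 2 `^ (1 - beta) * (N%:R `^ (1 / 2 - beta) * N%:R `^ (1 / 2)).
  by rewrite N2R powRM ?ler0n// -powR_add//; congr (_ * _ `^ _); field.
by rewrite !mulrA.
Qed.

End window.

Section long_memory.
Context (R : realType) (d : measure_display) (T : measurableType d) (P : probability T R).
Variables (beta : R) (hbeta : 1 / 2 < beta < 1) (q : nat).
Hypothesis hq : (2 * beta - 1) * q%:R < 1.
Let gam : R := 1 - q%:R * (beta - 1 / 2).

Let a0_gt0 : 0 < 2 * beta - 1.
Proof. by move: hbeta; lra. Qed.

(* The [j]-th derivative of [trunc_sum / N ^ gam] in the direction [window N]. *)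
Definition iter_deriv (N M j : nat) (x : nat -> R) : R :=
  (N%:R `^ gam)^-1 * \sum_(b < N) dot (N + M).+1 (weights beta M b) (window N) ^+ j *
    (if (j <= q)%N then herm (trunc_var beta M) (dot (N + M).+1 (weights beta M b) x) (q - j) else 0).

Lemma smooth_iter_deriv N M j : (j <= q)%N -> exists2 dG,
  smooth (N + M).+1 (iter_deriv N M j) dG & forall x, dG (window N) x = iter_deriv N M j.+1 x.
Proof.
move=> jq; set K := (N + M).+1.
eexists.
  rewrite /iter_deriv jq; apply: smoothZ.
  apply: (@smooth_sum R K _ _ (fun (b : 'I_N) x => dot K (weights beta M b) (window N) ^+ j *
     herm (trunc_var beta M) (dot K (weights beta M b) x) (q - j))
     (fun (b : 'I_N) h x => dot K (weights beta M b) (window N) ^+ j *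
     (dot K h (weights beta M b) * hermd (trunc_var beta M) (dot K (weights beta M b) x) (q - j)))) => b.
  by apply: smoothZ; exact: smooth_herm.
move=> x /=; rewrite /iter_deriv; congr (_ * _); apply: eq_bigr => b _.
rewrite dotC mulrA -exprSr; congr (_ * _).
case: ltnP => h; first by rewrite -[(q - j)%N]prednK ?subn_gt0// -subnS.
by rewrite (_ : q - j = 0)%N//; apply/eqP; rewrite subn_eq0.
Qed.

(** Each derivative lowers the Hermite degree by one, which raises the variance by [N^(2 beta - 1)],
    and brings a squared factor [N^(1 - 2 beta)]; the two cancel, so every [j] has the same order.
    The case [j > q] is needed for [j = q + 1], the derivative of the last nonzero one. *)
Lemma iter_deriv_moment j : exists2 C, 0 <= C & forall N M (xi : nat -> T -> R),
  (0 < N)%N -> (N.*2 <= M)%N -> iid_normal P (N + M).+1 xi ->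
  Ex P xi (fun x => iter_deriv N M j x ^+ 2) <= C.
Proof.
have [jq|jq] := leqP j q; last first.
  exists 0 => // N M xi N0 NM hxi.
  rewrite (_ : (fun x => _) = fun=> 0) ?Ex_cst//; apply/funext => x.
  rewrite /iter_deriv leqNgt jq /= big1 ?mulr0 ?expr0n// => b _; exact: mulr0.
have hqj : (2 * beta - 1) * (q - j)%:R < 1.
  by apply: le_lt_trans hq; rewrite ler_wpM2l ?(ltW a0_gt0)// ler_nat leq_subr.
have [C C0 hC] := corr_sum_long hbeta hqj.
have [c1 [c2 [c10 c20 hc]]] := dot_weights_window hbeta.
exists ((c2 ^+ j) ^+ 2 * (2 * C)) => [|N M xi N0 NM hxi]; first exact: mulr_ge0 (sqr_ge0 _) (mulr_ge0 _ C0).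
have NR : 0 < N%:R :> R by rewrite ltr0n.
set K := (N + M).+1 in hxi *.
pose rho (b : 'I_N) := dot K (weights beta M b) (window N).
have rhoP (b : 'I_N) : 0 <= rho b ^+ j <= (c2 * N%:R `^ (1 / 2 - beta)) ^+ j.
  have /andP[r1 r2] := hc N M K b N0 NM (ltnSn _) (ltn_ord b).
  have r0 : 0 <= rho b by apply: le_trans r1; rewrite mulr_ge0 ?powR_ge0// ltW.
  by rewrite exprn_ge0//= lerXn2r ?nnegrE// mulr_ge0 ?powR_ge0.
have tS : tame K (fun x => (\sum_b rho b ^+ j * herm (trunc_var beta M) (dot K (weights beta M b) x) (q - j)) ^+ 2).
  by apply: tameX; apply: tame_sum => b _; apply: tameM; [exact: tame_cst|exact: tame_herm].
have -> : Ex P xi (fun x => iter_deriv N M j x ^+ 2) = (N%:R `^ gam)^-1 ^+ 2 *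
   Ex P xi (fun x => (\sum_b rho b ^+ j * herm (trunc_var beta M) (dot K (weights beta M b) x) (q - j)) ^+ 2).
  rewrite -(ExZ hxi _ tS); congr (Ex P xi _); apply/funext => x.
  by rewrite /iter_deriv jq exprMn.
rewrite exprVn mulrC ler_pdivrMr ?exprn_gt0 ?powR_gt0//.
apply: (le_trans (weighted_sum_moment hbeta (ltnSn _) hxi (q - j) rhoP)).
apply: (@le_trans _ _ (((c2 * N%:R `^ (1 / 2 - beta)) ^+ j) ^+ 2 *
   (2 * N%:R * (C * N%:R `^ (1 - (2 * beta - 1) * (q - j)%:R))))).
  by rewrite ler_wpM2l ?sqr_ge0// ler_wpM2l ?mulr_ge0// hC.
rewrite exprMn exprMn -!exprM !powR_pow le_eqVlt; apply/orP; left; apply/eqP.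
set r1 := _ `^ _; set r2 := _ `^ _; set r3 := _ `^ _.
have r123 : r1 * (N%:R * r2) = r3.
  rewrite -[X in r1 * (X * r2)](@powRr1 _ N%:R) ?ler0n// /r1 /r2 -!powR_add//.
  by congr (_ `^ _); rewrite /gam natrB// natrM; field.
by rewrite -r123; ring.
Qed.

(** Descending induction on the order of the derivative, [k] counting the steps down from [q]: a
    lower bound on one derivative, with second moments of it and of the next, gives
    anticoncentration of the previous one. *)
Lemma iter_deriv_nondegenerate k : (k <= q)%N -> forall eta, 0 < eta -> exists2 del, 0 < del &
  forall N M (xi : nat -> T -> R), (0 < N)%N -> (N.*2 <= M)%N -> iid_normal P (N + M).+1 xi ->
  Pr P [set w | `|iter_deriv N M (q - k) (xi ^~ w)| <= del] <= eta.
Proof.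
elim: k => [_|k IH kq] eta eta0.
  have [c1 [c2 [c10 c20 hc]]] := dot_weights_window hbeta.
  (* The derivative of order [q] is deterministic, as [herm] of degree 0 is 1. Its [N] terms are at
     least [(c1 N^(1/2 - beta))^q], and [1 + q (1/2 - beta) = gam], so it is at least [c1^q] and the
     event is empty. *)
  exists (c1 ^+ q / 2) => [|N M xi N0 NM hxi]; first by rewrite divr_gt0// exprn_gt0.
  rewrite (_ : [set w | _] = set0); first by rewrite /Pr measure0 ltW.
  apply/seteqP; split => // w /=; apply/negP; rewrite -ltNge subn0.
  have NR : 0 < N%:R :> R by rewrite ltr0n.
  apply: (@lt_le_trans _ _ (c1 ^+ q)).
    by rewrite ltr_pdivrMr// ltr_pMr ?exprn_gt0// ltr1n.
  apply: le_trans (ler_norm _).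
  rewrite /iter_deriv leqnn subnn [leRHS]mulrC ler_pdivlMr ?powR_gt0//.
  apply: (@le_trans _ _ (\sum_(b < N) (c1 * N%:R `^ (1 / 2 - beta)) ^+ q)).
    rewrite sumr_const card_ord exprMn powR_pow -[(_ * _) *+ N]mulr_natr -mulrA ler_wpM2l ?exprn_ge0 ?(ltW c10)//.
    rewrite -[X in _ * X](@powRr1 _ N%:R) ?ler0n// -powR_add// le_eqVlt; apply/orP; left; apply/eqP.
    by congr (_ `^ _); rewrite /gam; field.
  apply: ler_sum => b _; rewrite /= mulr1.
  have /andP[r1 r2] := hc N M (N + M).+1 b N0 NM (ltnSn _) (ltn_ord b).
  have r0 : 0 <= c1 * N%:R `^ (1 / 2 - beta) by rewrite mulr_ge0 ?powR_ge0// ltW.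
  by rewrite lerXn2r// nnegrE// (le_trans r0).
have e2 : 0 < eta / 2 by rewrite divr_gt0.
have [del del0 hdel] := IH (ltnW kq) _ e2.
set j := (q - k.+1)%N.
have jS : (q - k)%N = j.+1 by rewrite /j subnS prednK// subn_gt0.
have jq : (j.+1 <= q)%N by rewrite -jS leq_subr.
have [C1 C10 hC1] := iter_deriv_moment j.+1.
have [C2 C20 hC2] := iter_deriv_moment j.+2.
have d2 : 0 < del ^+ 2 by rewrite exprn_gt0.
pose B := 1 + C1 + (1 + C2).
have B0 : 0 < B by rewrite addr_gt0// ltr_wpDr.
exists (eta / 2 * del ^+ 2 / (4 * B)) => [|N M xi N0 NM hxi].
  by apply: divr_gt0; apply: mulr_gt0.
set e := _ / (4 * B); have e0 : 0 < e by apply: divr_gt0; apply: mulr_gt0.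
have [dG sG dGE] := smooth_iter_deriv N M (ltnW jq).
have [dG1 sG1 dG1E] := smooth_iter_deriv N M jq.
have tG2 : tame (N + M).+1 (iter_deriv N M j.+2).
  rewrite (_ : iter_deriv N M j.+2 = dG1 (window N)); first exact: smooth_dtame sG1 _.
  by apply/funext => x; rewrite dG1E.
apply: (le_trans (directional_anticoncentration hxi sG sG1 tG2 dGE dG1E e0 d2)).
rewrite [leRHS]splitr; apply: lerD.
  apply: le_trans (hdel N M xi N0 NM hxi); rewrite jS.
  have mG := tame_rv hxi (smooth_tame sG1).
  apply: Pr_le.
  - by apply: measurable_lt_set => //; exact: measurable_funX.
  - by apply: measurable_le_set => //; exact: measurableT_comp.
  - move=> w /=; rewrite -[X in X < _]real_normK ?num_real// => h.
    by rewrite leNgt; apply/negP => k1; move: h; rewrite ltNge lerXn2r ?nnegrE ?(ltW del0) ?(ltW k1).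
apply: (@le_trans _ _ (4 * e / del ^+ 2 * B)).
  apply: ler_wpM2l; first by apply: divr_ge0 (ltW d2); exact: mulr_ge0 (ltW e0).
  rewrite /B; apply: lerD; last by rewrite lerD2l; exact: hC2.
  rewrite dot_window_self//; first by rewrite lerD2l; exact: hC1.
  by rewrite (leq_trans NM)// leqW// leq_addl.
rewrite /e le_eqVlt; apply/orP; left; apply/eqP; field.
by rewrite !gt_eqF.
Qed.

Lemma nondegenerate_long : nondegenerate P beta q gam.
Proof.
move=> eta eta0; have [del del0 h] := iter_deriv_nondegenerate (leqnn q) eta0.
exists del => //; exists 1%N => N N0; exists N.*2 => M NM xi hxi.
apply: le_trans (h N M xi N0 NM hxi).
rewrite subnn (_ : [set w | _ <= del] = [set w | `|trunc_sum beta q N M (xi ^~ w)| <= del * N%:R `^ gam])//.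
have g0 : 0 < (N%:R : R) `^ gam by rewrite powR_gt0 ?ltr0n.
apply/funext => w /=; rewrite -ler_pdivrMr// /iter_deriv leq0n subn0 normrM gtr0_norm ?invr_gt0// mulrC.
by congr (`|_| / _ <= _ : Prop); apply: eq_bigr => b _; rewrite expr0 mul1r.
Qed.

End long_memory.

Theorem proposition4 (R : realType) (d : measure_display)
    (T : measurableType d) (P : probability T R)
    (W : R -> {RV P >-> R}) (hW : two_sided_brownian_motion W)
    (beta : R) (hbeta : 1 / 2 < beta < 1) (q : nat) (hq : (1 <= q)%N)
    (X : nat -> {RV P >-> R}) (hX : is_moving_average W (alpha beta) X) :
  (1 / (2 * beta - 1) < q%:R ->
     ((1 / (- ln eps))%:E * f1 q X eps)%E @[eps --> 0^'+] --> 2%:E) /\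
  (q%:R < 1 / (2 * beta - 1) ->
     ((1 / (- ln eps))%:E * f2 beta q X eps)%E @[eps --> 0^'+]
       --> (1 / (1 + q%:R / 2 - beta * q%:R))%:E).
Proof.
have a0 : 0 < 2 * beta - 1 by move: hbeta; lra.
split=> [|].
  rewrite ltr_pdivrMr// mulrC => q1.
  have nd : nondegenerate P beta q (1 / 2).
    by move: q1; rewrite -(prednK hq); exact: nondegenerate_short.
  have := hermite_sum_log_limit hW hbeta hq hX _ (moment_growth_short P hbeta q1) nd.
  rewrite (_ : 1 / (1 / 2) = 2 :> R); last by field.
  move=> /(_ (divr_gt0 ltr01 (ltr0n R 2))); apply: cvg_trans; apply: near_eq_cvg; apply: nearW => eps.
  have e : 2 * (1 / 2) = 1 :> R by field.
  by congr (_ * _)%E; apply: eq_eseriesr => N _; rewrite e powRr1.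
rewrite ltr_pdivlMr// mulrC => q1.
pose gam := 1 - q%:R * (beta - 1 / 2).
have gam0 : 0 < gam by rewrite /gam; move: q1; lra.
have := hermite_sum_log_limit hW hbeta hq hX gam0 (moment_growth_long P hbeta q1) (nondegenerate_long P hbeta q1).
rewrite (_ : 1 + q%:R / 2 - beta * q%:R = gam); last by rewrite /gam; field.
apply: cvg_trans; apply: near_eq_cvg; apply: nearW => eps.
(* The exponent in [f2] is twice the order of the sum, as required by [hermite_sum_log_limit]. *)
have e : 2 * gam = - (2 * beta * q%:R) + q%:R + 2 by rewrite /gam; field.
by congr (_ * _)%E; apply: eq_eseriesr => N _; rewrite e.
Qed.
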